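(* Let $w\in\mathcal V$ be the weak solution of Problem $\mathcal P^s_Q$ with datum $g\in L^2(\Omega)$ and let $\mathbf p:=t^{1-2s}\nabla_{xt}w$ be its flux. Let $\widetilde w\in\mathcal V$, $\mathbf y\in Y^s_{\rm div}$, ${\rm e}_w:=\widetilde w-w$, $\mathbf e_{\mathbf p}:=\mathbf y-\mathbf p$. (i) For all $\alpha_1,\alpha_2>0$ with $\alpha_1+\alpha_2<1$, $$(1-\alpha_1-\alpha_2)|||\nabla_{xt}{\rm e}_w|||^2+|||t^{2s-1}\mathbf e_{\mathbf p}|||^2\le|||\nabla_{xt}\widetilde w-t^{2s-1}\mathbf y|||^2+\frac{C_F^2}{\alpha_1}|||t^{2s-1}{\rm div}_{xt}\mathbf y|||^2+\frac{C_F^{2s}\kappa_s^2}{\alpha_2}\|g+y_{d+1}(\cdot,0)\|^2.$$ (ii) For all $\alpha_1,\alpha_2>0$, $$(1+\alpha_1+\alpha_2)|||\nabla_{xt}{\rm e}_w|||^2+|||t^{2s-1}\mathbf e_{\mathbf p}|||^2\ge|||\nabla_{xt}\widetilde w-t^{2s-1}\mathbf y|||^2-\frac{C_F^2}{\alpha_1}|||t^{2s-1}{\rm div}_{xt}\mathbf y|||^2-\frac{C_F^{2s}\kappa_s^2}{\alpha_2}\|g+y_{d+1}(\cdot,0)\|^2.$$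
   Context: $\Omega\subset\mathbb R^d$, $d\ge1$, is a bounded connected open set with Lipschitz boundary, $0<s<1$, $Q:=\Omega\times(0,+\infty)$, $\Gamma:=\partial\Omega\times(0,+\infty)$. Points of $Q$ are $(x,t)$, $\nabla_{xt}w=\{\nabla_xw,w_t\}$, and ${\rm div}_{xt}$ is the (distributional) divergence in all $d+1$ variables. $\|\cdot\|$ is the norm of $L^2(\Omega)$. For scalar or vector functions on $Q$, $|||v|||^2:=\int_Q t^{1-2s}|v|^2\,dxdt$. The space $\mathcal V$ is the closure of smooth functions on $\overline Q$ with bounded support vanishing on $\Gamma$ with respect to the norm $|||\nabla_{xt}w|||$; $w(\cdot,0)$ denotes the trace of $w\in\mathcal V$ on $\Omega\times\{0\}$. Constants: $C_F=C_F(\Omega):=\lambda_1^{-1/2}$, where $\lambda_1$ is the minimal eigenvalue of the Dirichlet Laplacian in $\Omega$; $C_s:=2^{1-2s}\frac{\Gamma(1-s)}{\Gamma(s)}$ (Gamma function); $\kappa_s:=C_s^{-1/2}$. Problem $\mathcal P^s_Q$: for given $g\in L^2(\Omega)$ find $w\in\mathcal V$ with $w_{tt}+\frac{1-2s}{t}w_t+\Delta_xw=0$ in $Q$, $-\lim_{t\to0+}t^{1-2s}w_t=g$ in $\Omega$, $w=0$ on $\Gamma$, understood weakly: $$\int_Q t^{1-2s}\nabla_{xt}w\cdot\nabla_{xt}\eta\,dxdt-\int_\Omega g\,\eta(x,0)\,dx=0\qquad\forall\eta\in\mathcal V.$$ Fluxes: $Y^s$ is the set of vector functions $\mathbf y=\{y_1,\dots,y_{d+1}\}$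 on $Q$ with $\int_Q t^{2s-1}|\mathbf y|^2\,dxdt<\infty$, and $Y^s_{\rm div}:=\{\mathbf y\in Y^s:\int_Q t^{2s-1}|{\rm div}_{xt}\mathbf y|^2\,dxdt<\infty\}$. For $\mathbf y\in Y^s_{\rm div}$ the trace $y_{d+1}(\cdot,0)$ is understood in the weak sense: $\int_\Omega\eta(x,0)y_{d+1}(x,0)\,dx=-\int_Q(\eta\,{\rm div}_{xt}\mathbf y+\nabla_{xt}\eta\cdot\mathbf y)\,dxdt$ for all $\eta\in\mathcal V$; $\|g+y_{d+1}(\cdot,0)\|:=+\infty$ if this trace is not in $L^2(\Omega)$. *)

(* Defs.v *)
From HB Require Import structures.
From mathcomp Require Import all_boot all_order all_algebra.
From mathcomp Require Import all_classical all_reals all_analysis.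

Set Implicit Arguments.
Unset Strict Implicit.
Unset Printing Implicit Defensive.
Import Order.TTheory GRing.Theory Num.Theory.
Import numFieldNormedType.Exports.

Local Open Scope classical_set_scope.
Local Open Scope ring_scope.

(* R^n with the product (Borel) sigma-algebra. *)
Definition measure_rV_display : measure_display.
Proof. exact: default_measure_display. Qed.

Section measurable_rV.
Variables (R : realType) (n : nat).

Definition rV_cylinders : set (set 'rV[R]_n) :=
  [set A | exists (i : 'I_n) (B : set R),
     measurable B /\ A = [set x : 'rV[R]_n | B (x ord0 i)]].

Let rV_set0 : <<s rV_cylinders >> set0.
Proof. exact: sigma_algebra0. Qed.

Let rV_setC A : <<s rV_cylinders >> A -> <<s rV_cylinders >> (~` A).
Proof. exact: sigma_algebraC. Qed.

Let rV_bigcup (F : (set 'rV[R]_n)^nat) :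
  (forall i, <<s rV_cylinders >> (F i)) -> <<s rV_cylinders >> (\bigcup_i F i).
Proof. exact: sigma_algebra_bigcup. Qed.

HB.instance Definition _ := @isMeasurable.Build measure_rV_display
  'rV[R]_n <<s rV_cylinders >> rV_set0 rV_setC rV_bigcup.

Lemma measurable_coord (i : 'I_n) :
  measurable_fun [set: 'rV[R]_n] (fun x : 'rV[R]_n => x ord0 i).
Proof.
by move=> _ Y mY; rewrite setTI; apply: sub_sigma_algebra; exists i, Y.
Qed.

Lemma measurable_fun_rVP d (T : measurableType d) (f : T -> 'rV[R]_n) :
  (forall i, measurable_fun [set: T] (fun x => f x ord0 i)) ->
  measurable_fun [set: T] f.
Proof.
move=> mf; pose G := [set A : set 'rV[R]_n | measurable (f @^-1` A)].
have sG : sigma_algebra setT G.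
  split; first by rewrite /G /= preimage_set0.
  - move=> A GA; rewrite /G /= setTD preimage_setC; exact: measurableC.
  - by move=> F GF; rewrite /G /= preimage_bigcup; exact: bigcupT_measurable.
have subG : <<s rV_cylinders >> `<=` G.
  apply: smallest_sub => // _ [i [B [mB ->]]].
  by have := mf i measurableT B mB; rewrite setTI.
by move=> _ Y mY; rewrite setTI; exact: subG.
Qed.

End measurable_rV.

Section lebesgue_measure_rV.
Variable R : realType.

Definition consrV n (p : R * 'rV[R]_n) : 'rV[R]_n.+1 :=
  row_mx (p.1%:M : 'rV[R]_1) p.2.

Definition unconsrV n (x : 'rV[R]_n.+1) : R * 'rV[R]_n :=
  (x ord0 ord0, rsubmx (x : 'rV[R]_(1 + n))).

Lemma consrVK n : cancel (@consrV n) (@unconsrV n).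
Proof.
move=> [t x]; rewrite /unconsrV /consrV row_mxKr; congr pair.
have -> : ord0 = lshift n (ord0 : 'I_1) :> 'I_(1 + n) by exact/val_inj.
by rewrite (@row_mxEl _ 1 1 n) mxE eqxx.
Qed.

Lemma measurable_consrV n : measurable_fun [set: R * 'rV[R]_n] (@consrV n).
Proof.
apply: measurable_fun_rVP => i; rewrite /consrV.
case: (@split_ordP 1 n i) => j ->.
- rewrite [X in measurable_fun _ X](_ : _ = fst); first exact: measurable_fst.
  by apply/funext => x; rewrite (@row_mxEl _ 1 1 n) mxE !ord1 mulr1n.
- rewrite [X in measurable_fun _ X](_ : _ =
      fun x : R * 'rV[R]_n => x.2 ord0 j).
    exact: (measurableT_comp (measurable_coord j) measurable_snd).
  by apply/funext => x; rewrite (@row_mxEr _ 1 1 n).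
Qed.

Lemma measurable_unconsrV n : measurable_fun [set: 'rV[R]_n.+1] (@unconsrV n).
Proof.
apply/measurable_fun_pairP; split; first exact: measurable_coord.
apply: measurable_fun_rVP => i /=.
rewrite [X in measurable_fun _ X](_ : _ =
    fun x : 'rV[R]_n.+1 => x ord0 (rshift 1 i)); first exact: measurable_coord.
by apply/funext => x; rewrite mxE.
Qed.

Section step.
Local Open Scope ereal_scope.
Variables (n : nat) (mu : {sigma_finite_measure set 'rV[R]_n -> \bar R}).

Definition lebesgue_step : set 'rV[R]_n.+1 -> \bar R :=
  pushforward (lebesgue_measure \x mu) (@consrV n).

Let step0 : lebesgue_step set0 = 0.
Proof. by rewrite /lebesgue_step /pushforward preimage_set0 measure0. Qed.

Let step_ge0 A : 0 <= lebesgue_step A.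
Proof. by rewrite /lebesgue_step /pushforward; exact: measure_ge0. Qed.

Let mcons := @measurable_consrV n.

Let step_sigma_additive : semi_sigma_additive lebesgue_step.
Proof.
move=> F mF tF mUF; rewrite /lebesgue_step /pushforward preimage_bigcup.
apply: measure_semi_sigma_additive.
- by move=> k; rewrite -[X in measurable X]setTI; exact: mcons.
- apply/trivIsetP => /= i j _ _ ij; rewrite -preimage_setI.
  by move/trivIsetP : tF => /(_ _ _ _ _ ij) ->//; rewrite preimage_set0.
- by rewrite -preimage_bigcup -[X in measurable X]setTI; exact: mcons.
Qed.

HB.instance Definition _ := isMeasure.Build _ _ _ lebesgue_step
  step0 step_ge0 step_sigma_additive.

Let step_sigma_finite : sigma_finite setT lebesgue_step.
Proof.
have /sigma_finiteP[F [TF ndF Foo]] := sigma_finiteT (@lebesgue_measure R).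
have /sigma_finiteP[G [TG ndG Goo]] := sigma_finiteT mu.
exists (fun k => @unconsrV n @^-1` (F k `*` G k)).
  apply/esym; rewrite -subTset => x _.
  have [k _ Fk] : (\bigcup_k F k) (x ord0 ord0) by rewrite -TF.
  have [l _ Gl] : (\bigcup_k G k) (rsubmx (x : 'rV[R]_(1 + n))) by rewrite -TG.
  exists (maxn k l) => //; split => /=.
  - by move: Fk; exact/subsetPset/ndF/leq_maxl.
  - by move: Gl; exact/subsetPset/ndG/leq_maxr.
move=> k; have [mF Fk] := Foo k; have [mG Gk] := Goo k.
have mFG : measurable (F k `*` G k) by exact: measurableX.
split; first by rewrite -[X in measurable X]setTI; exact: measurable_unconsrV.
rewrite /lebesgue_step /pushforward -comp_preimage.
rewrite (_ : _ \o _ = id); last by apply/funext => x /=; rewrite consrVK.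
by rewrite preimage_id product_measure1E// lte_mul_pinfty// ge0_fin_numE.
Qed.

HB.instance Definition _ := Measure_isSigmaFinite.Build _ _ _ lebesgue_step
  step_sigma_finite.

End step.

(* Lebesgue measure on R^n, as the n-fold product of the one on R. *)
Fixpoint lebesgue_rV n : {sigma_finite_measure set 'rV[R]_n -> \bar R} :=
  match n with
  | 0 => [the {sigma_finite_measure set 'rV[R]_0 -> \bar R} of \d_(0 : 'rV[R]_0)]
  | k.+1 => [the {sigma_finite_measure set 'rV[R]_k.+1 -> \bar R}
             of lebesgue_step (lebesgue_rV k)]
  end.

End lebesgue_measure_rV.

(* A point of R^d x R is a pair (x, t); vectors of R^(d+1) have the same type,
   the second component being the t-component. *)
Notation space_time R d := ('rV[R]_d * R)%type.

Section euclidean.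
Variables (R : realType) (d : nat).

(* The library norm on 'rV[R]_d and on products is the sup norm, hence the
   explicit Euclidean products. *)
Definition dotx (u v : 'rV[R]_d) : R := \sum_(i < d) u ord0 i * v ord0 i.

Definition dotxt (u v : space_time R d) : R := dotx u.1 v.1 + u.2 * v.2.

Definition mu_xt : {measure set ('rV[R]_d * measurableTypeR R)%type -> \bar R} :=
  (lebesgue_rV R d \x lebesgue_measure)%E.

Definition gradx (f : 'rV[R]_d -> R) (x : 'rV[R]_d) : 'rV[R]_d :=
  \row_(i < d) 'D_(delta_mx ord0 i) f x.

Definition gradxt (f : space_time R d -> R) (z : space_time R d) :
    space_time R d :=
  (\row_(i < d) 'D_((delta_mx ord0 i, 0) : space_time R d) f z,
   'D_((0, 1) : space_time R d) f z).

End euclidean.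

Section smooth_functions.
Variables (R : realType) (V : normedModType R).

Definition iter_derive (vs : seq V) (f : V -> R) : V -> R :=
  foldr (fun v g => 'D_v g) f vs.

Definition smooth (f : V -> R) : Prop :=
  forall vs : seq V, continuous (iter_derive vs f) /\
    forall x v, derivable (iter_derive vs f) x v.

Definition test_function (U : set V) (f : V -> R) : Prop :=
  smooth f /\
  exists K : set V, [/\ compact K, K `<=` U & forall x, ~ K x -> f x = 0].

End smooth_functions.

Section domain.
Variables (R : realType) (d : nat).
Implicit Type Omega : set 'rV[R]_d.

Definition boundary Omega : set 'rV[R]_d := closure Omega `\` Omega°.

(* Near p, after the choice of a "vertical" unit vector e, Omega is the strict
   epigraph of a Lipschitz function gamma of the component x - (x.e) e of x
   orthogonal to e (only the values of gamma on e^\perp matter). *)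
Definition lipschitz_boundary Omega : Prop :=
  forall p, boundary Omega p ->
    exists (e : 'rV[R]_d) (gamma : 'rV[R]_d -> R) (L : R) (U : set 'rV[R]_d),
      [/\ dotx e e = 1, L.-lipschitz gamma, nbhs p U &
          forall x, U x ->
            (Omega x <-> gamma (x - dotx x e *: e) < dotx x e)].

Definition lipschitz_domain Omega : Prop :=
  [/\ open Omega, connected Omega, bounded_set Omega &
      lipschitz_boundary Omega].

Definition cylinder Omega : set (space_time R d) :=
  [set z | Omega z.1 /\ 0 < z.2].

Definition lateral_boundary Omega : set (space_time R d) :=
  [set z | boundary Omega z.1 /\ 0 < z.2].

End domain.

Section L2_Omega.
Variables (R : realType) (d : nat) (Omega : set 'rV[R]_d).

Definition normL2sq (f : 'rV[R]_d -> R) : \bar R :=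
  (\int[lebesgue_rV R d]_(x in Omega) (f x ^+ 2)%:E)%E.

Definition L2 (f : 'rV[R]_d -> R) : Prop :=
  measurable_fun Omega f /\ (normL2sq f < +oo)%E.

(* u in H^1_0(Omega) with gradient Du, as the limit in H^1 of test functions. *)
Definition H10 (u : 'rV[R]_d -> R) (Du : 'rV[R]_d -> 'rV[R]_d) : Prop :=
  [/\ measurable_fun Omega u, measurable_fun Omega Du &
    exists phi : nat -> 'rV[R]_d -> R,
    [/\ forall n, test_function Omega (phi n),
        normL2sq (phi n \- u) @[n --> \oo] --> 0%E &
        (\int[lebesgue_rV R d]_(x in Omega)
           (dotx (gradx (phi n) x - Du x) (gradx (phi n) x - Du x))%:E)%E
          @[n --> \oo] --> 0%E]].

Definition dirichlet_eigenvalue (lam : R) : Prop :=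
  exists u Du, [/\ H10 u Du, (0 < normL2sq u)%E &
    forall v Dv, H10 v Dv ->
      \int[lebesgue_rV R d]_(x in Omega) dotx (Du x) (Dv x) =
      lam * \int[lebesgue_rV R d]_(x in Omega) (u x * v x)].

(* The minimal eigenvalue of the Dirichlet Laplacian. *)
Definition lambda1 : R :=
  get [set lam | dirichlet_eigenvalue lam /\
                 forall m, dirichlet_eigenvalue m -> lam <= m].

Definition C_F : R := lambda1 `^ (- 2^-1).

End L2_Omega.

Section constants.
Variable R : realType.
Implicit Types s z : R.

Definition Gamma z : R :=
  \int[lebesgue_measure]_(t in `]0%R, +oo[) (t `^ (z - 1) * expR (- t)).

Definition C_ s : R := 2 `^ (1 - 2 * s) * (Gamma (1 - s) / Gamma s).

Definition kappa s : R := C_ s `^ (- 2^-1).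

End constants.

Section weighted.
Variables (R : realType) (d : nat) (s : R) (Omega : set 'rV[R]_d).
Local Notation Q := (cylinder Omega).
Implicit Types (w eta : space_time R d -> R).
Implicit Types (y Dw Deta : space_time R d -> space_time R d).

(* |||w|||^2 and |||y|||^2, for scalar and for vector functions. *)
Definition tnormsq w : \bar R :=
  (\int[mu_xt R d]_(z in Q) (z.2 `^ (1 - 2 * s) * w z ^+ 2)%:E)%E.

Definition tnormsqv y : \bar R :=
  (\int[mu_xt R d]_(z in Q) (z.2 `^ (1 - 2 * s) * dotxt (y z) (y z))%:E)%E.

Definition smoothV (phi : space_time R d -> R) : Prop :=
  [/\ smooth phi,
      bounded_set (closure Q `&` [set z | phi z != 0]) &
      forall z, lateral_boundary Omega z -> phi z = 0].

(* For functions in smoothV, |||phi||| <= C_F ||| grad phi ||| by the Friedrichs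
   inequality on the slices, so that a sequence whose gradients are Cauchy for
   |||.||| also converges for |||.|||; as 1/t^(1-2s) is locally integrable, the
   limit Dw of the gradients is then the distributional gradient of w. *)
Definition approxV (phi : nat -> space_time R d -> R) w Dw : Prop :=
  [/\ forall n, smoothV (phi n),
      tnormsqv (gradxt (phi n) \- Dw) @[n --> \oo] --> 0%E &
      tnormsq (phi n \- w) @[n --> \oo] --> 0%E].

(* w is in the space V and Dw is its gradient in (x, t). *)
Definition inV w Dw : Prop :=
  [/\ measurable_fun Q w, measurable_fun Q Dw & exists phi, approxV phi w Dw].

(* w0 is the trace w(., 0) of w. *)
Definition traceV w Dw (w0 : 'rV[R]_d -> R) : Prop :=
  L2 Omega w0 /\ exists phi, approxV phi w Dw /\
    normL2sq Omega (fun x => phi n (x, 0) - w0 x) @[n --> \oo] --> 0%E.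

Definition weak_solution (g : 'rV[R]_d -> R) w Dw : Prop :=
  inV w Dw /\
  forall eta Deta tr_eta, inV eta Deta -> traceV eta Deta tr_eta ->
    \int[mu_xt R d]_(z in Q)
       (z.2 `^ (1 - 2 * s) * dotxt (Dw z) (Deta z)) -
    \int[lebesgue_rV R d]_(x in Omega) (g x * tr_eta x) = 0.

Definition distr_div y (q : space_time R d -> R) : Prop :=
  forall phi, test_function Q phi ->
    \int[mu_xt R d]_(z in Q) dotxt (gradxt phi z) (y z) =
    - \int[mu_xt R d]_(z in Q) (phi z * q z).

Definition Ys y : Prop :=
  measurable_fun Q y /\
  (\int[mu_xt R d]_(z in Q)
     (z.2 `^ (2 * s - 1) * dotxt (y z) (y z))%:E < +oo)%E.

(* y is in Y^s_div with divergence q. *)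
Definition Ysdiv y (q : space_time R d -> R) : Prop :=
  [/\ Ys y, measurable_fun Q q, distr_div y q &
      (\int[mu_xt R d]_(z in Q)
         (z.2 `^ (2 * s - 1) * q z ^+ 2)%:E < +oo)%E].

(* y0 in L^2(Omega) is the weak trace of the last component of y, where q is
   the divergence of y. *)
Definition normal_trace y (q : space_time R d -> R) (y0 : 'rV[R]_d -> R) :
    Prop :=
  L2 Omega y0 /\
  forall eta Deta tr_eta, inV eta Deta -> traceV eta Deta tr_eta ->
    \int[lebesgue_rV R d]_(x in Omega) (tr_eta x * y0 x) =
    - \int[mu_xt R d]_(z in Q) (eta z * q z + dotxt (Deta z) (y z)).

(* ||g + y_{d+1}(., 0)||^2: the weak trace is unique up to null sets, so the
   infimum is over at most one value; it is +oo when there is no trace in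
   L^2(Omega). *)
Definition trace_residual_sq (g : 'rV[R]_d -> R) y q : \bar R :=
  ereal_inf [set normL2sq Omega (g \+ y0) | y0 in normal_trace y q].

(* t^a y *)
Definition tscale (a : R) y : space_time R d -> space_time R d :=
  fun z => z.2 `^ a *: y z.

End weighted.

(* Main.v *)
From HB Require Import structures.
Require Import Defs.
From mathcomp Require Import all_boot all_order all_algebra.
From mathcomp Require Import all_classical all_reals all_analysis.
From mathcomp Require Import measurable_realfun ring lra.

Set Implicit Arguments.
Unset Strict Implicit.
Unset Printing Implicit Defensive.
Import Order.TTheory GRing.Theory Num.Theory.
Import numFieldNormedType.Exports.

Local Open Scope classical_set_scope.
Local Open Scope ring_scope.

(* With e = wt - w and Y = t^(2s-1) y, expanding the square gives
     |||Dwt - Y|||^2 = |||De|||^2 + |||Y - Dw|||^2 - 2 X,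
     X = int De.(y - p) = - int e div y - int e(., 0) (g + y_{d+1}(., 0)),
   and Young's inequality reduces both estimates to
     |||e||| <= C_F |||De|||  and  ||e(., 0)||^2 <= C_F^(2s) kappa_s^2 |||De|||^2.
   These follow from the Poincare inequality on the slices {t = const}, the
   second one by integrating over x the sharp one-dimensional inequality
     C_s m^(2s) psi(0)^2 <= int t^(1-2s) (psi'^2 + m^2 psi^2),  m = C_F^-1.
   The latter needs no spectral decomposition: if a solves the Riccati equation
   of the Bessel-type operator, the integrand plus (a psi^2)' is a square.
   As C_F is defined through the minimal Dirichlet eigenvalue, the Poincare
   inequality requires that the infimum of the Rayleigh quotient is attained:
   a minimizing sequence is compact in L^2 by Rellich's theorem, and its
   gradients converge by the parallelogram identity. *)

(** Gradients and rescaled fluxes t^(2s-1) y are kept in one L^2 space with weight t^(1-2s), where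
    t^(2s-1) p is just Dw. Young's inequality is applied with the parameters a1 lambda1 and a2
    lambda1^s C_s, so that the two bounds on e leave exactly a1 and a2 times |||De|||^2. C_s is, up
    to m^(2s), the value at t = 0 of the Riccati solution: there the Bessel-type integrals become
    Gamma(1-s) and Gamma(s), and the power of 2 comes from differentiating a kernel in t^2/4.
    Elements of V are limits of smooth functions that vanish on the lateral boundary, whereas the
    Rayleigh quotient lives on functions with compact support in Omega. Cutting off small values by
    a smooth map of slope at most 1 bridges this gap: the energy does not grow and the change in L^2
    tends to 0 on a bounded set. Lebesgue measure on R^n is an iterated product, so Rellich's
    theorem and the positivity of the Rayleigh infimum are obtained by slicing in the first
    coordinate. The final bounds hold for each admissible weak trace separately; the infimum in the
    residual is taken last, and an empty set of traces gives +oo. *)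

Lemma eq_imp_le {disp} {T : porderType disp} (x y : T) : x = y -> (x <= y)%O.
Proof. by move=> ->. Qed.

(** * Borel sets and iterated integrals *)

Section open_measurability.
Context {R : realType}.

Lemma ratr_approx (x e : R) : 0 < e -> exists q : rat, `|ratr q - x| < e.
Proof.
move=> e0; have [] := @dense_rat R (ball x e).
- by exists x; exact: ballxx.
- exact: ball_open.
by move=> y [xy [q _ qy]]; exists q; rewrite qy distrC.
Qed.

Lemma open_bigcup_balls (T : pseudoMetricType R) (I : Type) (c : I -> T)
    (U : set T) : (forall x e, 0 < e -> exists i, ball (c i) e x) -> open U ->
  U = \bigcup_(p in [set p : I * nat | ball (c p.1) (p.2.+1%:R^-1) `<=` U])
        ball (c p.1) (p.2.+1%:R^-1).
Proof.
move=> cd oU; apply/seteqP; split=> [x Ux|x [p pU]]; last exact: pU.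
have /nbhs_ballP[e /= e0 eU] := open_nbhs_nbhs (conj oU Ux).
have [k _ /(_ k (leqnn k)) ke] : \forall k \near \oo, k.+1%:R^-1 < e / 2.
  near=> k; rewrite -[ltLHS]ger0_norm//; near: k.
  exact: (@cvgr0_norm_lt _ _ _ _ _ _ (@cvg_harmonic R) (e / 2) (divr_gt0 e0 _)).
have [i ci] := cd x k.+1%:R^-1 ltac:(by rewrite invr_gt0).
exists (i, k) => //= y ciy; apply: eU; rewrite [e]splitr.
by apply: (@ball_triangle _ _ (c i)); apply: le_ball (ltW ke) _ _ => //; exact: ball_sym.
Unshelve. all: by end_near. Qed.

(** A countable family of dense centres with radii 1/(k+1) gives a countable base, so only balls
    need to be measurable. The map [f] keeps the two structures apart: [T] carries the sigma-algebra
    and [X] the topology, and both uses take [f] to be the identity. *)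
Lemma open_measurable_balls d (T : measurableType d) (X : pseudoMetricType R)
    (f : T -> X) (I : countType) (c : I -> X) (U : set X) :
  (forall x e, 0 < e -> exists i, ball (c i) e x) ->
  (forall i e, measurable (f @^-1` ball (c i) e)) ->
  open U -> measurable (f @^-1` U).
Proof.
move=> cd mb oU; rewrite (open_bigcup_balls cd oU) preimage_bigcup bigcup_mkcond.
apply: countable_bigcupT_measurable => [|p]; first exact: countableP.
by case: ifP => // _; exact: mb.
Qed.

Lemma ball_rV_rat n (x : 'rV[R]_n) e : 0 < e ->
  exists q : 'rV[rat]_n, ball (map_mx ratr q : 'rV[R]_n) e x.
Proof.
move=> e0; have /choice[q qP] i : exists q, `|ratr q - x ord0 i| < e.
  exact: ratr_approx.
by exists (\row_i q i); split=> // i j; rewrite !mxE ord1; exact: qP.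
Qed.

Lemma measurable_ballR (x e : R) : measurable (ball x e).
Proof. by rewrite ball_itv; exact: measurable_itv. Qed.

Lemma measurable_ball_rV n (x : 'rV[R]_n) e : measurable (ball x e).
Proof.
(* A ball of nonpositive radius is empty, while in dimension 0 the intersection used below is the
   whole space; hence the separate case. *)
have [e0|e0] := ltP 0 e; last first.
  rewrite (_ : ball x e = set0)//; apply/seteqP; split=> // y [].
  by rewrite ltNge e0.
rewrite (_ : ball x e =
    \bigcap_(i in [set: 'I_n]) [set y : 'rV[R]_n | ball (x ord0 i) e (y ord0 i)]).
  apply: fin_bigcap_measurable => // i _; rewrite -[X in measurable X]setTI.
  by apply: (measurable_coord i measurableT); exact: measurable_ballR.
apply/seteqP; split=> [y [_ xy] i _|y xy]; first exact: xy.
by split=> // i j; rewrite ord1; exact: xy.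
Qed.

Lemma open_measurable_rV n (U : set 'rV[R]_n) : open U -> measurable U.
Proof.
apply: (@open_measurable_balls _ _ 'rV[R]_n id _ (fun q : 'rV[rat]_n => map_mx ratr q)).
  exact: ball_rV_rat.
by move=> i e; exact: measurable_ball_rV.
Qed.

Lemma open_measurable_xt d (U : set (space_time R d)) : open U ->
  measurable (U : set ('rV[R]_d * measurableTypeR R)%type).
Proof.
apply: (@open_measurable_balls _ ('rV[R]_d * measurableTypeR R)%type ('rV[R]_d * R)%type id _
  (fun q : ('rV[rat]_d * rat)%type => (map_mx ratr q.1, ratr q.2))).
  move=> [x t] e e0; have [q qP] := ball_rV_rat x e0.
  by have [r rP] := ratr_approx t e0; exists (q, r).
move=> [q r] e.
rewrite (_ : _ @^-1` _ = ball (map_mx ratr q : 'rV[R]_d) e `*` ball (ratr r : R) e) //.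
by apply: measurableX; [exact: measurable_ball_rV|exact: measurable_ballR].
Qed.

Lemma measurable_fun_opens d (T : measurableType d) (f : T -> R) :
  (forall U : set R, open U -> measurable (f @^-1` U)) ->
  measurable_fun [set: T] f.
Proof.
move=> h; apply: (measurability _ (RGenOInfty.measurableE R)).
by move=> _ [_ [x ->] <-]; rewrite setTI; apply: h; exact: rray_open.
Qed.

Lemma continuous_measurable_rV n (f : 'rV[R]_n -> R) (D : set 'rV[R]_n) :
  continuous f -> measurable_fun D f.
Proof.
move=> /continuousP cf; apply: measurable_funTS; apply: measurable_fun_opens => U oU.
by apply: open_measurable_rV; exact: cf.
Qed.

Lemma continuous_measurable_xt d (f : space_time R d -> R)
    (D : set (space_time R d)) : continuous f ->
  measurable_fun (D : set ('rV[R]_d * measurableTypeR R)%type) f.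
Proof.
move=> /continuousP cf; apply: measurable_funTS; apply: measurable_fun_opens => U oU.
by apply: open_measurable_xt; exact: cf.
Qed.

Lemma cylinderE d (Omega : set 'rV[R]_d) :
  cylinder Omega = Omega `*` `]0, +oo[%classic.
Proof.
by apply/seteqP; split=> -[x t]; rewrite /cylinder /= in_itv /= andbT.
Qed.

Lemma measurable_cylinder d (Omega : set 'rV[R]_d) : open Omega ->
  measurable (cylinder Omega : set ('rV[R]_d * measurableTypeR R)%type).
Proof.
by move=> oO; rewrite cylinderE; apply: measurableX => //; exact: open_measurable_rV.
Qed.

End open_measurability.

Section iterated_integrals.
Context {R : realType}.
Local Open Scope ereal_scope.

Lemma integral_rV_succ n (F : 'rV[R]_n.+1 -> \bar R) :
  measurable_fun [set: 'rV[R]_n.+1] F -> (forall x, 0 <= F x) ->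
  \int[lebesgue_rV R n.+1]_x F x =
  \int[lebesgue_measure]_t \int[lebesgue_rV R n]_x F (consrV (t, x)).
Proof.
move=> mF F0.
transitivity (\int[lebesgue_measure \x lebesgue_rV R n]_z F (consrV z)).
  have := @ge0_integral_pushforward _ _ (measurableTypeR R * 'rV[R]_n)%type _ _ _
    (@measurable_consrV R n)
    (lebesgue_measure \x lebesgue_rV R n)%E setT F measurableT mF (fun y _ => F0 y).
  by rewrite preimage_setT.
rewrite fubini_tonelli1//; apply: measurableT_comp => //.
exact: measurable_consrV.
Qed.

Lemma measurable_slice n (F : 'rV[R]_n.+1 -> \bar R) t :
  measurable_fun setT F -> measurable_fun setT (fun x : 'rV[R]_n => F (consrV (t, x))).
Proof.
move=> mF; apply: measurableT_comp => //.
by apply: measurableT_comp (@measurable_consrV R n) _; exact: measurable_pair1.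
Qed.

Lemma measurable_slice_integral n (F : 'rV[R]_n.+1 -> \bar R) :
  measurable_fun setT F -> (forall x, 0 <= F x) ->
  measurable_fun [set: R] (fun t => \int[lebesgue_rV R n]_x F (consrV (t, x))).
Proof.
move=> mF F0; apply: (@measurable_fun_fubini_tonelli_F _ _ _ _ _ (lebesgue_rV R n)
  (fun z => F (consrV z))) => //.
by apply: measurableT_comp => //; exact: measurable_consrV.
Qed.

Lemma integral_cylinder d (Omega : set 'rV[R]_d) (F : space_time R d -> \bar R) :
  open Omega ->
  measurable_fun (cylinder Omega : set ('rV[R]_d * measurableTypeR R)%type) F ->
  (forall z, cylinder Omega z -> 0 <= F z) ->
  \int[mu_xt R d]_(z in cylinder Omega) F z =
  \int[lebesgue_rV R d]_(x in Omega) \int[lebesgue_measure]_(t in `]0%R, +oo[) F (x, t).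
Proof.
move=> oO mF F0; have mC := measurable_cylinder oO.
rewrite integral_mkcond fubini_tonelli1; last 2 first.
- exact: (measurable_restrictT F mC).1 mF.
- by move=> z; rewrite patchE; case: ifPn => // /set_mem; exact: F0.
rewrite [RHS]integral_mkcond; apply: eq_integral => x _; rewrite patchE /fubini_F.
case: ifPn => [/set_mem xO|/negP xO].
  rewrite [RHS]integral_mkcond; apply: eq_integral => t _; rewrite !patchE.
  by rewrite cylinderE in_setX (mem_set xO).
apply: integral0_eq => t _.
rewrite patchE cylinderE in_setX; by case: ifPn => // /andP[/= /xO].
Qed.

Lemma integral_cylinder_t d (Omega : set 'rV[R]_d) (F : space_time R d -> \bar R) :
  open Omega ->
  measurable_fun (cylinder Omega : set ('rV[R]_d * measurableTypeR R)%type) F ->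
  (forall z, cylinder Omega z -> 0 <= F z) ->
  \int[mu_xt R d]_(z in cylinder Omega) F z =
  \int[lebesgue_measure]_(t in `]0%R, +oo[) \int[lebesgue_rV R d]_(x in Omega) F (x, t).
Proof.
move=> oO mF F0; have mC := measurable_cylinder oO.
rewrite integral_mkcond fubini_tonelli2; last 2 first.
- exact: (measurable_restrictT F mC).1 mF.
- by move=> z; rewrite patchE; case: ifPn => // /set_mem; exact: F0.
rewrite [RHS]integral_mkcond; apply: eq_integral => t _; rewrite patchE /fubini_G.
case: ifPn => [tO|/negP tO].
  rewrite [RHS]integral_mkcond; apply: eq_integral => x _; rewrite !patchE.
  by rewrite cylinderE in_setX tO andbT.
apply: integral0_eq => x _.
rewrite patchE cylinderE in_setX; by case: ifPn => // /andP[_ /= /tO].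
Qed.

Definition box (n : nat) (M : R) : set 'rV[R]_n :=
  [set x | forall i, (`|x ord0 i| < M)%R].

Lemma measurable_box n M : measurable (@box n M).
Proof.
rewrite (_ : box M = \bigcap_(i in [set: 'I_n]) [set y : 'rV[R]_n | (`|y ord0 i| < M)%R]).
  apply: fin_bigcap_measurable => // i _; rewrite -[X in measurable X]setTI.
  apply: (measurable_coord i measurableT (Y := [set t | (`|t| < M)%R])).
  rewrite (_ : [set t | _] = ball (0%R : R) M); first exact: measurable_ballR.
  by apply/seteqP; split => y /=; rewrite /ball /= sub0r normrN.
by apply/seteqP; split=> [y xy i _|y xy i]; exact: xy.
Qed.

Lemma lebesgue_box_lty n M : lebesgue_rV R n (@box n M) < +oo.
Proof.
elim: n => [|n IH].
  by rewrite /= diracE ltry.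
rewrite /= /lebesgue_step /pushforward.
rewrite (_ : _ @^-1` _ = ball (0%R : R) M `*` @box n M); last first.
  apply/seteqP; split=> -[t x] /=.
    move=> h; split.
      have := h (@lshift 1 n ord0).
      by rewrite /consrV (@row_mxEl _ 1 1 n) mxE eqxx mulr1n /ball /= sub0r normrN.
    by move=> i; have := h (@rshift 1 n i); rewrite /consrV (@row_mxEr _ 1 1 n).
  move=> [tM xM] i; rewrite /consrV; case: (@split_ordP 1 n i) => j ->.
    rewrite (@row_mxEl _ 1 1 n) mxE [j]ord1 eqxx mulr1n.
    by move: tM; rewrite /ball /= sub0r normrN.
  by rewrite (@row_mxEr _ 1 1 n).
rewrite product_measure1E//; [|exact: measurable_ballR|exact: measurable_box].
have [M0|M0] := leP M 0%R.
  rewrite (_ : ball _ _ = set0) ?measure0 ?mul0e//.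
  by apply/seteqP; split => // t; rewrite /ball /= => /(le_lt_trans (normr_ge0 _)); rewrite ltNge M0.
rewrite (_ : _ (ball _ _) = (M *+ 2)%:E); last exact: lebesgue_measure_ball (ltW M0).
by rewrite lte_mul_pinfty// ?lee_fin ?mulrn_wge0 ?ltW.
Qed.

End iterated_integrals.

(** * Completeness of L^2 (Riesz-Fischer) *)

Section L2_completeness.
Context d (T : measurableType d) (R : realType).
Variables (mu : {measure set T -> \bar R}) (D : set T).
Hypothesis mD : measurable D.

Lemma limn_einf_le (u : (\bar R)^nat) (e : \bar R) :
  (\forall n \near \oo, (u n <= e)%E) -> (limn_einf u <= e)%E.
Proof.
move=> ue; rewrite limn_einf_lim; apply: lime_le; first exact: is_cvg_einfs.
near=> n; apply: (@le_trans _ _ (u n)); first by apply: ereal_inf_lbound; exists n => /=.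
by near: n.
Unshelve. all: by end_near. Qed.

(* Along a subsequence with [\int (f_(k+1) - f_k)^2 <= 8^-k] the series of
   [2^k (f_(k+1) - f_k)^2] is integrable, hence finite almost everywhere, and
   [|x| <= 2^-k + 2^k x^2] makes the increments absolutely summable. *)
Lemma fast_L2_cvg (f : nat -> T -> R) :
  (forall n, measurable_fun D (f n)) ->
  (forall n, \int[mu]_(x in D) ((f n.+1 x - f n x) ^+ 2)%:E <= (8^-1 ^+ n)%:E)%E ->
  exists g : T -> R, measurable_fun D g /\
    {ae mu, forall x, D x -> f n x @[n --> \oo] --> g x}.
Proof.
move=> mf fC.
pose u n x : \bar R := (2 ^+ n * (f n.+1 x - f n x) ^+ 2)%:E.
have mu_ n : measurable_fun D (u n).
  by apply/measurable_EFinP/measurable_funM => //; apply/measurable_funX/measurable_funB.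
have u0 n x : (0 <= u n x)%E by rewrite lee_fin mulr_ge0// ?sqr_ge0// exprn_ge0.
pose h x := (\sum_(0 <= n <oo) u n x)%E.
have mh : measurable_fun D h by apply: ge0_emeasurable_sum.
have gn n : \sum_(0 <= i < n) (2^-1 : R) ^+ i <= 2.
  suff -> : \sum_(0 <= i < n) (2^-1 : R) ^+ i = 2 * (1 - 2^-1 ^+ n).
    by rewrite ger_pMr// gerBl exprn_ge0// invr_ge0.
  elim: n => [|n IH]; first by rewrite big_nil expr0 subrr mulr0.
  by rewrite big_nat_recr//= IH exprS; field.
have ih : (\int[mu]_(x in D) h x < +oo)%E.
  rewrite /h integral_nneseries//.
  apply: (@le_lt_trans _ _ (\sum_(0 <= n <oo) (2^-1 ^+ n : R)%:E)%E); last first.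
    apply: (@le_lt_trans _ _ (2 : R)%:E); last exact: ltry.
    apply: lime_le; first by apply: is_cvg_nneseries => n _ _; rewrite lee_fin exprn_ge0// invr_ge0.
    by near=> n; rewrite sumEFin lee_fin gn.
  apply: lee_nneseries => [n _ _|n _]; first exact: integral_ge0.
  rewrite /u; under eq_integral do rewrite EFinM.
  rewrite ge0_integralZl_EFin//; last 2 first.
  - by move=> x _; rewrite lee_fin sqr_ge0.
  - by apply/measurable_EFinP/measurable_funX/measurable_funB.
  (* The weight 2^n costs little against 8^-n: the product is 4^-n, below the summable 2^-n. *)
  apply: (@le_trans _ _ ((2 ^+ n)%:E * (8^-1 ^+ n)%:E)%E).
    by rewrite lee_pmul2l// lte_fin exprn_gt0.
  rewrite -EFinM lee_fin -exprMn lerXn2r// ?nnegrE ?invr_ge0 ?mulr_ge0 ?invr_ge0//.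
  by lra.
have hfin : {ae mu, forall x, D x -> (h x < +oo)%E}.
  have : mu.-integrable D h.
    apply/integrableP; split=> //.
    by under eq_integral do rewrite gee0_abs ?nneseries_ge0//.
  move=> /(integrable_ae mD); apply: filterS => x + Dx => /(_ Dx).
  by rewrite ge0_fin_numE// nneseries_ge0.
pose A := [set x | D x /\ (h x < +oo)%E].
have mA : measurable A.
  exact: (emeasurable_fun_infty_o mD mh +oo%E).
have cA x : A x -> cvgn (f ^~ x).
  move=> [Dx hx].
  suff : cvgn (series (fun n => f n.+1 x - f n x)).
    rewrite (_ : series _ = fun n => f n x - f 0%N x); last first.
      by apply/funext => n; rewrite /series /= telescope_sumr.
    move=> /cvg_ex[l fl]; apply/cvg_ex; exists (l + f 0%N x).
    rewrite (_ : f ^~ x = fun n => f n x - f 0%N x + f 0%N x).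
      by apply: cvgD => //; exact: cvg_cst.
    by apply/funext => n; rewrite subrK.
  apply: normed_cvg.
  rewrite (_ : [normed series _] = fun n => \sum_(0 <= k < n) `|f k.+1 x - f k x|)//.
  apply: nondecreasing_is_cvgn.
    by apply/nondecreasing_seqP => n; rewrite big_nat_recr//= lerDl.
  have [S hS] : exists S, h x = S%:E.
    by exists (fine (h x)); rewrite fineK// ge0_fin_numE ?nneseries_ge0.
  exists (2 + S) => _ [n _ <-].
  apply: (@le_trans _ _ (\sum_(0 <= k < n) (2^-1 ^+ k + 2 ^+ k * (f k.+1 x - f k x) ^+ 2))).
    apply: ler_sum => k _; set a := f k.+1 x - f k x.
    rewrite -(@ler_pM2l _ (2 ^+ k)) ?exprn_gt0// mulrDr -exprMn divff// expr1n.
    rewrite mulrA -expr2 -(real_normK (num_real a)) -exprMn.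
    rewrite /=; set b := 2 ^+ k * _; have : 0 <= b by rewrite mulr_ge0// exprn_ge0.
    by nra.
  rewrite big_split /= lerD ?gn//.
  rewrite -lee_fin -hS -sumEFin.
  exact: (@nneseries_lim_ge _ (u ^~ x) xpredT 0 n (fun k _ _ => u0 k x)).
(* With the value 0 off [A], [g] is on all of [D] the pointwise limit of the measurable functions
   [f n \* \1_A]. *)
pose g x := if x \in A then limn (f ^~ x) else 0.
exists g; split.
  apply: (@measurable_fun_cvg _ _ _ _ (fun n => f n \* \1_A)).
    by move=> n; apply: measurable_funM => //; exact: measurable_fun_indic.
  move=> x Dx; rewrite /g; case: ifPn => xA.
    rewrite (_ : (fun _ => _) = f ^~ x); first by apply: cA; rewrite inE in xA.
    by apply/funext => n /=; rewrite indicE xA mulr1.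
  rewrite (_ : (fun _ => _) = fun=> 0); first exact: cvg_cst.
  by apply/funext => n /=; rewrite indicE (negbTE xA) mulr0.
apply: filterS hfin => x hx Dx; have Ax : A x by split=> //; exact: hx.
by rewrite /g mem_set//; exact: cA.
Unshelve. all: by end_near. Qed.

(** Fatou's lemma upgrades the almost everywhere limit of a fast subsequence to an L^2 limit of the
    whole sequence: the integral of (f_n - g)^2 is at most the lower limit over k of the integrals
    of (f_n - f_(s k))^2, which the Cauchy property makes small. *)
Lemma L2_complete (f : nat -> T -> R) : (forall n, measurable_fun D (f n)) ->
  (forall e : R, 0 < e -> exists N, forall n m, (N <= n)%N -> (N <= m)%N ->
     (\int[mu]_(x in D) ((f n x - f m x) ^+ 2)%:E <= e%:E)%E) ->
  exists g : T -> R, measurable_fun D g /\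
    (\int[mu]_(x in D) ((f n x - g x) ^+ 2)%:E)%E @[n --> \oo] --> 0%E.
Proof.
move=> mf fC.
have /choice[N NP] k : exists N, forall n m, (N <= n)%N -> (N <= m)%N ->
    (\int[mu]_(x in D) ((f n x - f m x) ^+ 2)%:E <= (8^-1 ^+ k : R)%:E)%E.
  by apply: fC; rewrite exprn_gt0// invr_gt0.
(* The partial sums ensure that [s k] is at least [N k]; the added [k] makes [s] strictly
   increasing. *)
pose s k := (\sum_(i < k.+1) N i + k)%N.
have sS k : (s k < s k.+1)%N.
  by rewrite /s [X in (_ < X + _)%N]big_ord_recr /= addnS ltnS leq_add2r leq_addr.
have sN k : (N k <= s k)%N by rewrite /s big_ord_recr/= -addnA addnCA leq_addr.
have sk k : (k <= s k)%N by rewrite leq_addl.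
have [g [mg fg]] := @fast_L2_cvg (fun k => f (s k)) (fun k => mf _)
  (fun k => NP k _ _ (leq_trans (sN k) (ltnW (sS k))) (sN k)).
exists g; split => //.
have le_ e : 0 < e -> exists M, forall n, (M <= n)%N ->
    (\int[mu]_(x in D) ((f n x - g x) ^+ 2)%:E <= e%:E)%E.
  move=> e0; have [M MP] := fC e e0; exists M => n Mn.
  apply: (@le_trans _ _ (\int[mu]_(x in D) limn_einf (fun k => ((f n x - f (s k) x) ^+ 2)%:E))%E).
    apply: ae_ge0_le_integral => //.
    - by move=> x _; rewrite lee_fin sqr_ge0.
    - by apply/measurable_EFinP/measurable_funX/measurable_funB.
    - move=> x _; rewrite limn_einf_lim; apply: lime_ge; first exact: is_cvg_einfs.
      by near=> k; apply: le_ereal_inf_tmp => _ [j _ <-]; rewrite lee_fin sqr_ge0.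
    - rewrite (_ : (fun _ => _) = (fun x => - limn_esup (fun k => (- ((f n x - f (s k) x) ^+ 2)%:E)%E))%E).
        apply: measurableT_comp => //; apply: measurable_fun_limn_esup => k.
        apply: measurableT_comp => //.
        by apply/measurable_EFinP/measurable_funX/measurable_funB.
      apply/funext => x; rewrite -limn_einfN; congr limn_einf.
      by apply/funext => k; rewrite /comp oppeK.
    - apply: filterS fg => x fgx Dx.
      have c : ((f n x - f (s k) x) ^+ 2)%:E @[k --> \oo] --> ((f n x - g x) ^+ 2)%:E.
        apply: cvg_EFin; first by near=> k.
        by rewrite expr2; under eq_fun do rewrite expr2; apply: cvgM;
          apply: cvgB; (try exact: cvg_cst); exact: fgx.
      by rewrite (cvg_limn_einf_sup c).1.
  apply: le_trans.
    apply: fatou => //.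
      by move=> k; apply/measurable_EFinP/measurable_funX/measurable_funB.
    by move=> k x _; rewrite lee_fin sqr_ge0.
  apply: limn_einf_le; near=> k; apply: MP => //.
  by apply: leq_trans (sk k); near: k; exists M.
apply/fine_cvgP; split.
  have [M MP] := le_ 1 ltr01; exists M => // n /= Mn.
  rewrite ge0_fin_numE; last by apply: integral_ge0 => x _; rewrite lee_fin sqr_ge0.
  exact: le_lt_trans (MP n Mn) (ltry _).
apply/cvgrPdist_le => e e0; have [M MP] := le_ e e0; exists M => // n /= Mn.
have i0 : (0 <= \int[mu]_(x in D) ((f n x - g x) ^+ 2)%:E)%E.
  by apply: integral_ge0 => x _; rewrite lee_fin sqr_ge0.
rewrite sub0r normrN ger0_norm ?fine_ge0// -lee_fin fineK; first exact: MP.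
by rewrite ge0_fin_numE//; exact: le_lt_trans (MP n Mn) (ltry _).
Unshelve. all: by end_near. Qed.

End L2_completeness.

(** * Weighted L^2 spaces *)

(* A weighted L^2 space; [wb] is a form on the values and [wadm] stands for
   measurability, of which only these two stability properties matter. *)
Record wform d (T : measurableType d) (R : realType) (V : lmodType R) := WForm {
  wdom : set T;
  wdom_meas : measurable wdom;
  wrho : T -> R;
  wrho_ge0 : forall x, wdom x -> 0 <= wrho x;
  wb : V -> V -> R;
  wbC : forall u v, wb u v = wb v u;
  wbDl : forall u v w, wb (u + v) w = wb u w + wb v w;
  wbZl : forall a u v, wb (a *: u) v = a * wb u v;
  wb_ge0 : forall u, 0 <= wb u u;
  wadm : set (T -> V);
  wadm_lin : forall a f g, wadm f -> wadm g -> wadm (fun x => f x + a *: g x);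
  wadm_meas : forall f g, wadm f -> wadm g ->
    measurable_fun wdom (fun x => wrho x * wb (f x) (g x)) }.

Section quadratic_functionals.
Context d (T : measurableType d) (R : realType) (V : lmodType R).
Variables (mu : {measure set T -> \bar R}) (W : wform T V).
Implicit Types f g h : T -> V.
Local Notation D := (wdom W).
Local Notation rho := (wrho W).
Local Notation b := (wb W).

Definition wnsq f : \bar R := (\int[mu]_(x in D) (rho x * b (f x) (f x))%:E)%E.
Definition wip f g : R := \int[mu]_(x in D) (rho x * b (f x) (g x)).
Definition wfin f : Prop := wadm W f /\ (wnsq f < +oo)%E.

Lemma wnsq_ge0 f : (0 <= wnsq f)%E.
Proof.
by apply: integral_ge0 => x Dx; rewrite lee_fin mulr_ge0 ?wb_ge0 ?wrho_ge0.
Qed.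

Lemma wbDr u v w : b u (v + w) = b u v + b u w.
Proof. by rewrite wbC wbDl ![b _ u]wbC. Qed.

Lemma wbZr a u v : b u (a *: v) = a * b u v.
Proof. by rewrite wbC wbZl wbC. Qed.

Lemma wb_lin a u v : b (u + a *: v) (u + a *: v) = b u u + 2 * a * b u v + a ^+ 2 * b v v.
Proof. by rewrite wbDl !wbDr !wbZl !wbZr [b v u]wbC; ring. Qed.

Lemma wb_amgm u v : `|b u v| <= b u u + b v v.
Proof.
have := wb_ge0 W (u + 1 *: v); have := wb_ge0 W (u + (-1) *: v).
rewrite !wb_lin; have := wb_ge0 W u; have := wb_ge0 W v.
by move=> *; rewrite ler_norml; apply/andP; split; lra.
Qed.

Lemma wfin_integrable f g : wfin f -> wfin g ->
  mu.-integrable D (EFin \o (fun x => rho x * b (f x) (g x))).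
Proof.
move=> [af nf] [ag ng]; have mD := wdom_meas W.
have mff := wadm_meas af af; have mgg := wadm_meas ag ag.
have r0 u x : D x -> 0 <= rho x * b u u by move=> Dx; rewrite mulr_ge0 ?wb_ge0 ?wrho_ge0.
apply: (@le_integrable _ _ _ mu _ mD _
  (fun x => (rho x * b (f x) (f x))%:E + (rho x * b (g x) (g x))%:E)%E).
- exact/measurable_EFinP/wadm_meas.
- move=> x Dx /=; rewrite lee_fin normrM -mulrDr normrM ler_wpM2l//.
  by rewrite (@ger0_norm _ (_ + _)) ?addr_ge0 ?wb_ge0//; exact: wb_amgm.
apply/integrableP; split; first by apply: emeasurable_funD; exact/measurable_EFinP.
rewrite (eq_integral (fun x => ((rho x * b (f x) (f x))%:E + (rho x * b (g x) (g x))%:E)%E)).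
  rewrite ge0_integralD//; last 4 first.
  - by move=> x Dx; rewrite lee_fin r0.
  - exact/measurable_EFinP.
  - by move=> x Dx; rewrite lee_fin r0.
  - exact/measurable_EFinP.
  exact: lte_add_pinfty.
by move=> x /set_mem Dx; rewrite gee0_abs// adde_ge0// lee_fin r0.
Qed.

Lemma wnsqE f : wfin f -> wnsq f = (wip f f)%:E.
Proof.
move=> ff; rewrite /wip /Rintegral fineK//.
exact: (integrable_fin_num (wdom_meas W) (wfin_integrable ff ff)).
Qed.

Lemma wip_ge0 f : 0 <= wip f f.
Proof. by apply: fine_ge0; exact: wnsq_ge0. Qed.

Lemma wipC f g : wip f g = wip g f.
Proof. by apply: eq_Rintegral => x _; rewrite wbC. Qed.

Lemma wfin_lin a f g : wfin f -> wfin g -> wfin (fun x => f x + a *: g x).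
Proof.
move=> ff gf; split; first exact: wadm_lin ff.1 gf.1.
have mD := wdom_meas W; have [af nf] := ff; have [ag ng] := gf.
have r0 u x : D x -> 0 <= rho x * b u u by move=> Dx; rewrite mulr_ge0 ?wb_ge0 ?wrho_ge0.
apply: (@le_lt_trans _ _ (\int[mu]_(x in D) (2%:E * (rho x * b (f x) (f x))%:E +
    (2 * a ^+ 2)%:E * (rho x * b (g x) (g x))%:E))%E).
  apply: ge0_le_integral => //.
  - by move=> x Dx; rewrite lee_fin r0.
  - by apply/measurable_EFinP; apply: wadm_meas; exact: wadm_lin.
  - by apply: emeasurable_funD; apply: measurable_funeM; exact/measurable_EFinP/wadm_meas.
  move=> x Dx; rewrite -!EFinM -EFinD lee_fin wb_lin.
  (* Parallelogram identity: the right-hand side minus the left-hand side is the weighted square of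
     f - a g. *)
  have := wb_ge0 W (f x + (- a) *: g x); rewrite wb_lin => /(mulr_ge0 (wrho_ge0 Dx)).
  by rewrite -subr_ge0; congr (0 <= _); ring.
rewrite ge0_integralD//; last 4 first.
- by move=> x Dx; rewrite -EFinM lee_fin mulr_ge0// r0.
- by apply: measurable_funeM; exact/measurable_EFinP/wadm_meas.
- by move=> x Dx; rewrite -EFinM lee_fin mulr_ge0// ?r0// mulr_ge0// sqr_ge0.
- by apply: measurable_funeM; exact/measurable_EFinP/wadm_meas.
rewrite !ge0_integralZl_EFin//; last 5 first.
- by move=> x Dx; rewrite lee_fin r0.
- exact/measurable_EFinP/wadm_meas.
- by rewrite mulr_ge0// sqr_ge0.
- by move=> x Dx; rewrite lee_fin r0.
- exact/measurable_EFinP/wadm_meas.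
apply: lte_add_pinfty; apply: lte_mul_pinfty => //.
by rewrite lee_fin mulr_ge0// sqr_ge0.
Qed.

Lemma wip_linl a f g h : wfin f -> wfin g -> wfin h ->
  wip (fun x => f x + a *: g x) h = wip f h + a * wip g h.
Proof.
move=> ff gf hf; have mD := wdom_meas W.
rewrite /wip -RintegralZl//; last exact: wfin_integrable.
rewrite -RintegralD//; last 2 first.
- exact: wfin_integrable.
- have := integrableZl mD a (wfin_integrable gf hf).
  by apply: eq_integrable.
by apply: eq_Rintegral => x _; rewrite wbDl wbZl mulrDr mulrCA.
Qed.

Lemma wip_sq a f g : wfin f -> wfin g ->
  wip (fun x => f x + a *: g x) (fun x => f x + a *: g x) =
  wip f f + 2 * a * wip f g + a ^+ 2 * wip g g.
Proof.
move=> ff gf; have lf := wfin_lin a ff gf.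
pose L := fun x => f x + a *: g x.
have -> : wip L L = wip f L + a * wip g L by exact: wip_linl.
rewrite (wipC f L) (wipC g L) (wip_linl a ff gf ff) (wip_linl a ff gf gf) (wipC g f).
by ring.
Qed.

(** Both signs come from positivity of the squares of f + g/c and f - g/c, multiplied by c. In this
    scaled form it serves both as Young's inequality in the final estimate and as a substitute for
    the triangle inequality of the norm. *)
Lemma wip_amgm c f g : 0 < c -> wfin f -> wfin g ->
  2 * `|wip f g| <= c * wip f f + c^-1 * wip g g.
Proof.
move=> c0 ff gf.
have h a : a ^+ 2 = 1 -> - (2 * a * wip f g) <= c * wip f f + c^-1 * wip g g.
  move=> a2; have := wip_ge0 (fun x => f x + (a / c) *: g x); rewrite wip_sq//.
  rewrite exprMn a2 mul1r => /(mulr_ge0 (ltW c0)).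
  set F := wip f f; set X := wip f g; set Y := wip g g.
  have -> : c * (F + 2 * (a / c) * X + c^-1 ^+ 2 * Y) = c * F + 2 * a * X + c^-1 * Y.
    by field; rewrite gt_eqF.
  by lra.
have [g0|g0] := leP 0 (wip f g).
  by have := h (-1); rewrite sqrrN expr1n => /(_ erefl); rewrite ger0_norm//; lra.
by have := h 1; rewrite expr1n => /(_ erefl); rewrite ltr0_norm//; lra.
Qed.

(** Writing u_n = f + (u_n - f), the squared norm of u_n differs from that of f by a mixed term and
    by the squared distance; Young's inequality with a small fixed parameter on f controls the mixed
    term. Every inequality proved for smooth functions passes to its closure through this lemma. *)
Lemma wfin_cvg (u : nat -> T -> V) f : (forall n, wfin (u n)) -> wadm W f ->
  wnsq (fun x => u n x - f x) @[n --> \oo] --> 0%E ->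
  wfin f /\ wip (u n) (u n) @[n --> \oo] --> wip f f.
Proof.
move=> uf af /fine_cvgP[[N _ Nfin] uc].
have ad n : wadm W (fun x => u n x - f x).
  have := wadm_lin (-1) (uf n).1 af.
  by under eq_fun do rewrite scaleN1r.
have wf n : (N <= n)%N -> wfin (fun x => u n x - f x).
  by move=> Nn; split=> //; have := Nfin n Nn; rewrite ge0_fin_numE// wnsq_ge0.
have ff : wfin f.
  have := wfin_lin (-1) (uf N) (wf N (leqnn N)).
  by rewrite (_ : (fun _ => _) = f)//; apply/funext => x; rewrite scaleN1r opprB addrC subrK.
split=> //; apply/cvgrPdist_le => e e0.
have F0 : 0 <= wip f f := wip_ge0 f.
(* This makes c times the square of f at most e/2; the summand 1 covers f = 0. The threshold chosen
   next leaves the other e/2 for (1 + 1/c) times the squared distance. *)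
pose c := e / (2 * (wip f f + 1)).
have c0 : 0 < c by rewrite divr_gt0// mulr_gt0//; lra.
move/cvgrPdist_le : uc => /(_ (e / (2 * (1 + c^-1)))).
case; first by rewrite divr_gt0// mulr_gt0// addr_gt0// invr_gt0.
move=> M _ MP; exists (maxn N M) => // n /=; rewrite geq_max => /andP[Nn Mn].
have := MP n Mn; rewrite /= sub0r normrN wnsqE/=; last exact: wf.
rewrite ger0_norm ?wip_ge0// => h1.
have -> : wip (u n) (u n) = wip f f + 2 * wip f (fun x => u n x - f x) +
    wip (fun x => u n x - f x) (fun x => u n x - f x).
  have := @wip_sq 1 f (fun x => u n x - f x) ff (wf n Nn).
  rewrite expr1n mulr1 mul1r => <-.
  by congr wip; apply/funext => x; rewrite scale1r addrC subrK.
set H := wip (fun x => _) _ in h1 *; have H0 : 0 <= H := wip_ge0 _.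
have := wip_amgm c0 ff (wf n Nn); rewrite -/H; set X := wip f _ => amgm.
have h2 : (1 + c^-1) * H <= e / 2.
  apply: (@le_trans _ _ ((1 + c^-1) * (e / (2 * (1 + c^-1))))).
    by rewrite ler_pM2l// addr_gt0// invr_gt0.
  by apply: eq_imp_le; field; rewrite gt_eqF//= gt_eqF// addr_gt0.
have h3 : c * wip f f <= e / 2.
  rewrite /c mulrAC ler_pdivrMr ?mulr_gt0 ?ltr_wpDl//.
  by rewrite (_ : e / 2 * (2 * (wip f f + 1)) = e * wip f f + e); [lra|field].
have -> : wip f f - (wip f f + 2 * X + H) = - (2 * X + H) by ring.
rewrite normrN; apply: (le_trans (ler_normD _ _)); rewrite normrM (ger0_norm H0) ger0_norm//.
by move: h2; rewrite mulrDl mul1r; lra.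
Qed.

Lemma wnsq_cvg_lin a (u v : nat -> T -> V) f g :
  (forall n, wadm W (u n)) -> (forall n, wadm W (v n)) -> wadm W f -> wadm W g ->
  wnsq (fun x => u n x - f x) @[n --> \oo] --> 0%E ->
  wnsq (fun x => v n x - g x) @[n --> \oo] --> 0%E ->
  wnsq (fun x => (u n x + a *: v n x) - (f x + a *: g x)) @[n --> \oo] --> 0%E.
Proof.
move=> uf vf af ag /fine_cvgP[ufin uc] /fine_cvgP[vfin vc].
have sB h k : wadm W h -> wadm W k -> wadm W (fun x => h x - k x).
  by move=> hh kk; have := wadm_lin (-1) hh kk; under eq_fun do rewrite scaleN1r.
have wn n : wnsq (fun x => u n x - f x) \is a fin_num ->
    wnsq (fun x => v n x - g x) \is a fin_num ->
    wfin (fun x => u n x - f x) /\ wfin (fun x => v n x - g x).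
  rewrite !ge0_fin_numE ?wnsq_ge0// => h1 h2.
  by split; split=> //; exact: sB.
have E n : (fun x => (u n x + a *: v n x) - (f x + a *: g x)) =
    (fun x => (u n x - f x) + a *: (v n x - g x)).
  by apply/funext => x; rewrite scalerBr opprD addrACA.
pose w n := fun x => (u n x + a *: v n x) - (f x + a *: g x).
have B n : wnsq (fun x => u n x - f x) \is a fin_num ->
    wnsq (fun x => v n x - g x) \is a fin_num ->
    (0 <= wnsq (w n) <= (2 * fine (wnsq (fun x => u n x - f x)%R) +
      2 * a ^+ 2 * fine (wnsq (fun x => v n x - g x)%R))%:E)%E.
  move=> h1 h2; have [f1 f2] := wn n h1 h2; rewrite wnsq_ge0 /= /w E.
  rewrite wnsqE; last exact: wfin_lin.
  rewrite !wnsqE//= lee_fin wip_sq//.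
  have := wip_ge0 (fun x => (u n x - f x) + (- a) *: (v n x - g x)).
  by rewrite wip_sq// -subr_ge0; rewrite -[in X in _ -> X]subr_ge0 subr0; congr (0 <= _); ring.
apply: (squeeze_cvge _ (cvg_cst 0%E) (h := fun n => (2 * fine (wnsq (fun x => u n x - f x)) +
      2 * a ^+ 2 * fine (wnsq (fun x => v n x - g x)))%:E)).
  near=> n; apply: B; near: n; first exact: ufin.
  exact: vfin.
apply: cvg_EFin; first by near=> n.
rewrite [X in _ --> X](_ : _ = 2 * fine 0 + 2 * a ^+ 2 * fine 0); last by rewrite /= !mulr0 addr0.
by apply: cvgD; apply: cvgMr.
Unshelve. all: by end_near. Qed.

End quadratic_functionals.

Section weighted_instances.
Context d (T : measurableType d) (R : realType) (D : set T) (mD : measurable D).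
Variables (rho : T -> R) (mrho : measurable_fun D rho).
Hypothesis rho0 : forall x, D x -> 0 <= rho x.

Lemma dotxC n (u v : 'rV[R]_n) : dotx u v = dotx v u.
Proof. by apply: eq_bigr => i _; rewrite mulrC. Qed.

Lemma dotxDl n (u v w : 'rV[R]_n) : dotx (u + v) w = dotx u w + dotx v w.
Proof. by rewrite -big_split; apply: eq_bigr => i _; rewrite mxE mulrDl. Qed.

Lemma dotxZl n a (u v : 'rV[R]_n) : dotx (a *: u) v = a * dotx u v.
Proof. by rewrite mulr_sumr; apply: eq_bigr => i _; rewrite mxE mulrA. Qed.

Lemma dotx_ge0 n (u : 'rV[R]_n) : 0 <= dotx u u.
Proof. by apply: sumr_ge0 => i _; rewrite -expr2 sqr_ge0. Qed.

Lemma measurable_coord_fun n (f : T -> 'rV[R]_n) (i : 'I_n) :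
  measurable_fun D f -> measurable_fun D (fun x => f x ord0 i).
Proof. by move=> mf; exact: (measurableT_comp (measurable_coord i)). Qed.

Lemma measurable_rVP n (f : T -> 'rV[R]_n) :
  (forall i, measurable_fun D (fun x => f x ord0 i)) -> measurable_fun D f.
Proof.
move=> mf; apply/(measurable_restrictT f mD); apply: measurable_fun_rVP => i.
have /(measurable_restrictT _ mD) := mf i; congr measurable_fun.
by apply/funext => x; rewrite !patchE; case: ifPn => // _; rewrite mxE.
Qed.

Lemma measurable_rV_lin n a (f g : T -> 'rV[R]_n) : measurable_fun D f ->
  measurable_fun D g -> measurable_fun D (fun x => f x + a *: g x).
Proof.
move=> mf mg; apply: measurable_rVP => i; under eq_fun do rewrite !mxE.
by apply: measurable_funD; [|apply: measurable_funM => //]; exact: measurable_coord_fun.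
Qed.

Lemma measurable_dotx n (f g : T -> 'rV[R]_n) : measurable_fun D f ->
  measurable_fun D g -> measurable_fun D (fun x => dotx (f x) (g x)).
Proof.
move=> mf mg; apply: measurable_sum => i.
by apply: measurable_funM; exact: measurable_coord_fun.
Qed.

Definition wformR : wform T R^o.
refine (@WForm _ T R R^o D mD rho rho0 (fun u v => u * v : R) _ _ _ _
  [set f | measurable_fun D (f : T -> R)] _ _).
- by move=> u v; rewrite mulrC.
- by move=> u v w; rewrite mulrDl.
- by move=> a u v; rewrite -mulrA.
- by move=> u; rewrite -expr2 sqr_ge0.
- by move=> a f g mf mg; apply: measurable_funD => //; exact: measurable_funM.
- by move=> f g mf mg; apply: measurable_funM => //; exact: measurable_funM.
Defined.

Definition wformX n : wform T 'rV[R]_n.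
refine (@WForm _ T R 'rV[R]_n D mD rho rho0 (@dotx R n) (@dotxC n) (@dotxDl n)
  (@dotxZl n) (@dotx_ge0 n) [set f | measurable_fun D f] _ _).
- by move=> a f g; exact: measurable_rV_lin.
- by move=> f g mf mg; apply: measurable_funM => //; exact: measurable_dotx.
Defined.

(** Admissibility is componentwise, which reduces the closure properties to the row-vector and
    scalar cases; [measurable_pair_adm] and [measurable_pair_of_adm] translate to and from
    measurability of the pair. *)
Definition wformXT n : wform T (space_time R n).
refine (@WForm _ T R (space_time R n) D mD rho rho0 (@dotxt R n) _ _ _ _
  [set f | measurable_fun D (fun x => (f x).1) /\ measurable_fun D (fun x => (f x).2)] _ _).
- by move=> u v; rewrite /dotxt dotxC mulrC.
- by move=> u v w; rewrite /dotxt dotxDl mulrDl addrACA.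
- by move=> a u v; rewrite /dotxt dotxZl mulrDr mulrA.
- by move=> u; rewrite addr_ge0 ?dotx_ge0// -expr2 sqr_ge0.
- move=> a f g [mf1 mf2] [mg1 mg2]; split; first exact: measurable_rV_lin.
  by apply: measurable_funD => //; exact: measurable_funM.
- move=> f g [mf1 mf2] [mg1 mg2]; apply: measurable_funM => //.
  by apply: measurable_funD; [exact: measurable_dotx|exact: measurable_funM].
Defined.

End weighted_instances.

(** * Smooth functions *)

Section smooth_closure.
Context {R : realType}.

(** A coinduction principle: smoothness speaks of all iterated directional derivatives, so it
    suffices to exhibit a class of continuous, derivable functions that is stable under every
    directional derivative. Each closure property below is reduced to the choice of such a class. *)
Lemma smooth_class (V : normedModType R) (C : set (V -> R)) :
  (forall f, C f -> [/\ continuous f, forall x v, derivable f x v &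
    forall v, C ('D_v f)]) -> forall f, C f -> smooth f.
Proof.
move=> H f Cf vs; have : C (iter_derive vs f).
  by elim: vs => //= v vs IH; have [_ _] := H _ IH; exact.
by move=> /H[].
Qed.

Lemma smooth_continuous (V : normedModType R) (f : V -> R) : smooth f -> continuous f.
Proof. by move=> /(_ [::])[]. Qed.

Lemma smooth_derivable (V : normedModType R) (f : V -> R) x v :
  smooth f -> derivable f x v.
Proof. by move=> /(_ [::])[_]. Qed.

Lemma smooth_derive (V : normedModType R) (f : V -> R) v : smooth f -> smooth ('D_v f).
Proof.
move=> sf vs; have -> : iter_derive vs ('D_v f) = iter_derive (rcons vs v) f.
  by rewrite /iter_derive foldr_rcons.
exact: sf.
Qed.

Lemma smooth_cst (V : normedModType R) (c : R) : smooth (fun _ : V => c).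
Proof.
apply: (@smooth_class _ [set f | exists c, f = cst c]); last by exists c.
move=> _ [k ->]; split; first by move=> x; exact: cvg_cst.
  by move=> x v; exact: derivable_cst.
by move=> v; exists 0; apply/funext => x; rewrite derive_cst.
Qed.

Lemma derive_lin (V : normedModType R) (f g : V -> R) a v x :
  derivable f x v -> derivable g x v ->
  'D_v (fun x => f x + a * g x) x = 'D_v f x + a * 'D_v g x.
Proof.
move=> df dg; have -> : (fun x => f x + a * g x) = f + a \*: g by [].
have daf : derivable (a \*: g) x v by exact: derivableZ.
by rewrite (deriveD df daf) (deriveZ a dg).
Qed.

Lemma smooth_lin (V : normedModType R) (f g : V -> R) a : smooth f -> smooth g ->
  smooth (fun x => f x + a * g x).
Proof.
move=> sf sg; apply: (@smooth_class _
  [set h | exists f g, [/\ smooth f, smooth g & h = fun x => f x + a * g x]]); last by exists f, g.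
move=> _ [p [q [sp sq ->]]]; split.
- move=> x; apply: cvgD; first exact: smooth_continuous.
  by apply: cvgMr; exact: smooth_continuous.
- move=> x v; have -> : (fun x => p x + a * q x) = p + a \*: q by [].
  by apply: derivableD; [|apply: derivableZ]; exact: smooth_derivable.
- move=> v; exists ('D_v p), ('D_v q); split; [exact: smooth_derive..|].
  by apply/funext => x; rewrite derive_lin//; exact: smooth_derivable.
Qed.

Section affine_substitution.
Context (V W : normedModType R) (A : W -> V) (l : W -> V).
Hypothesis Al : forall h (v x : W), A (h *: v + x) = h *: l v + A x.
Hypothesis cA : continuous A.

Let affine_quotient (f : V -> R) x v :
  (fun h : R => h^-1 *: (((f \o A) \o shift x) (h *: v) - (f \o A) x)) =
  (fun h : R => h^-1 *: ((f \o shift (A x)) (h *: l v) - f (A x))).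
Proof. by apply/funext => h; rewrite /= Al. Qed.

Lemma derivable_affine (f : V -> R) x v :
  derivable f (A x) (l v) -> derivable (f \o A) x v.
Proof. by rewrite /derivable affine_quotient. Qed.

(** For an affine map the difference quotients along [v] and along [l v] coincide for every
    increment, so the identity follows before any limit is taken. *)
Lemma derive_affine (f : V -> R) x v : 'D_v (f \o A) x = 'D_(l v) f (A x).
Proof. by rewrite /derive affine_quotient. Qed.

Lemma smooth_affine (f : V -> R) : smooth f -> smooth (f \o A).
Proof.
move=> sf; apply: (@smooth_class _ [set h | exists2 g, smooth g & h = g \o A]); last by exists f.
move=> _ [g sg ->]; split.
- by move=> x; apply: continuous_comp; [exact: cA|exact: smooth_continuous].
- by move=> x v; apply: derivable_affine; exact: smooth_derivable.
- move=> v; exists ('D_(l v) g); first exact: smooth_derive.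
  by apply/funext => x; exact: derive_affine.
Qed.

End affine_substitution.

Section chain_rule.
Context (V : normedModType R) (F F' : R -> R) (phi : V -> R).
Hypothesis dF : forall x : R, is_derive x 1 F (F' x).

Let line_derive (f : V -> R) x v : (fun h : R => h^-1 *: ((f \o shift x) (h *: v) - f x)) =
  (fun h : R => h^-1 *: (((fun h => f (h *: v + x)) \o shift 0) (h *: 1) - f (0 *: v + x))).
Proof.
by apply/funext => h; rewrite /= scale0r add0r addr0 /GRing.scale /= mulr1.
Qed.

Lemma derivable_line (f : V -> R) x v :
  derivable f x v = derivable (fun h : R => f (h *: v + x)) 0 1.
Proof. by rewrite /derivable line_derive. Qed.

Lemma derive_line (f : V -> R) x v :
  'D_v f x = 'D_1 (fun h : R => f (h *: v + x)) 0.
Proof. by rewrite /derive line_derive. Qed.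

(** Only directional derivability of [phi] is given. Restricting to the line through [x] in
    direction [v] turns the claim into the chain rule in one variable. *)
Lemma is_derive_chain x v : derivable phi x v ->
  is_derive x v (F \o phi) (F' (phi x) * 'D_v phi x).
Proof.
rewrite derivable_line => /derivableP dp.
have dphi0 : is_derive (phi (0 *: v + x)) 1 F (F' (phi x)).
  by rewrite scale0r add0r.
have := @is_derive1_comp _ F (fun h : R => phi (h *: v + x)) 0 _ _ dphi0 dp.
rewrite -derive_line => -[h1 h2]; split.
  by rewrite derivable_line.
by rewrite derive_line.
Qed.

End chain_rule.

Lemma is_derive_continuous (f f' : R -> R) :
  (forall x : R, is_derive x 1 f (f' x)) -> continuous f.
Proof.
move=> df x; apply: differentiable_continuous; apply/derivable1_diffP.
by have [] := df x.
Qed.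

Section composition.
Context (V : normedModType R) (F : nat -> R -> R) (phi : V -> R).
Hypothesis dF : forall k (x : R), is_derive x 1 (F k) (F k.+1 x).
Hypothesis sphi : smooth phi.

(** The invariant class for compositions. [F] lists the successive derivatives of [F 0], so the
    directional derivative of [F k \o phi] is the product of [F k.+1 \o phi] and a smooth function;
    closing under sums and products makes the class stable under differentiation. *)
Inductive comp_class : (V -> R) -> Prop :=
| comp_smooth g : smooth g -> comp_class g
| comp_F k : comp_class (F k \o phi)
| comp_add f g : comp_class f -> comp_class g -> comp_class (f + g)
| comp_mul f g : comp_class f -> comp_class g -> comp_class (f * g).

Lemma smooth_comp k : smooth (F k \o phi).
Proof.
apply: (@smooth_class _ comp_class); last exact: comp_F.
move=> f; elim=> {f}.
- move=> g sg; split; first exact: smooth_continuous.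
    by move=> x v; exact: smooth_derivable.
  by move=> v; apply: comp_smooth; exact: smooth_derive.
- move=> j; split.
  + move=> x; apply: continuous_comp; first exact: smooth_continuous.
    exact: (is_derive_continuous (dF j)).
  + by move=> x v; have [] := is_derive_chain (dF j) (@smooth_derivable _ phi x v sphi).
  + move=> v; have -> : 'D_v (F j \o phi) = (F j.+1 \o phi) * 'D_v phi; last first.
      by apply: comp_mul; [exact: comp_F|apply: comp_smooth; exact: smooth_derive].
    by apply/funext => x; have [_ ->] := is_derive_chain (dF j) (@smooth_derivable _ phi x v sphi).
- move=> f g Cf [cf df Df] Cg [cg dg Dg]; split.
  + by move=> x; apply: cvgD; [exact: cf|exact: cg].
  + by move=> x v; exact: derivableD.
  + move=> v; have -> : 'D_v (f + g) = 'D_v f + 'D_v g; last exact: comp_add.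
    by apply/funext => x; rewrite deriveD.
- move=> f g Cf [cf df Df] Cg [cg dg Dg]; split.
  + by move=> x; apply: cvgM; [exact: cf|exact: cg].
  + by move=> x v; exact: derivableM.
  + move=> v; have -> : 'D_v (f * g) = f * 'D_v g + g * 'D_v f; last first.
      by apply: comp_add; apply: comp_mul.
    by apply/funext => x; rewrite deriveM.
Qed.

End composition.

Section zero_extension.
Context (V : normedModType R) (Omega : set V).
Hypothesis oO : open Omega.

Definition zero_ext (f : V -> R) (x : V) : R := if x \in Omega then f x else 0.

Let vanishing (f : V -> R) :=
  forall p, closure Omega p -> ~ Omega p -> \forall x \near p, f x = 0.

Lemma zero_ext_inside f p : Omega p -> \forall x \near p, zero_ext f x = f x.
Proof.
move=> Op; have : nbhs p Omega by exact: open_nbhs_nbhs.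
by apply: filterS => x Ox; rewrite /zero_ext mem_set.
Qed.

Lemma zero_ext_outside f p : vanishing f -> ~ Omega p ->
  \forall x \near p, zero_ext f x = 0.
Proof.
move=> vf Op; have [cp|ncp] := pselect (closure Omega p).
  by apply: filterS (vf p cp Op) => x; rewrite /zero_ext => ->; rewrite if_same.
have : nbhs p (~` closure Omega).
  by apply: open_nbhs_nbhs; split => //; apply: closed_openC; exact: closed_closure.
apply: filterS => x ncx; rewrite /zero_ext memNset// => Ox.
by apply: ncx; exact: subset_closure.
Qed.

Lemma derive_zero_ext f v : vanishing f -> 'D_v (zero_ext f) = zero_ext ('D_v f).
Proof.
move=> vf; apply/funext => x; rewrite {2}/zero_ext; case: ifPn => [/set_mem Ox|nOx].
  by apply: near_eq_derive; exact: zero_ext_inside.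
transitivity ('D_v (fun _ : V => 0 : R) x); last by rewrite derive_cst.
apply: near_eq_derive.
by apply: zero_ext_outside => // /mem_set; exact/negP.
Qed.

(** Near each point the extension agrees with a smooth function: with [f] at points of the open set,
    with 0 elsewhere, by [vanishing] at boundary points and because a neighbourhood misses Omega off
    its closure. The property [vanishing] is inherited by derivatives, which makes the class
    stable. *)
Lemma smooth_zero_ext f : smooth f -> vanishing f -> smooth (zero_ext f).
Proof.
move=> sf vf; apply: (@smooth_class _
  [set h | exists g, [/\ smooth g, vanishing g & h = zero_ext g]]); last by exists f.
move=> _ [g [sg vg ->]]; split.
- move=> x; have [Ox|nOx] := pselect (Omega x).
    rewrite /continuous_at {2}/zero_ext mem_set//.
    have c : g y @[y --> x] --> g x by exact: (smooth_continuous sg).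
    apply: cvg_trans c; apply: near_eq_cvg.
    by apply: filterS (zero_ext_inside g Ox) => y ->.
  rewrite /continuous_at {2}/zero_ext memNset//.
  have c : (fun _ : V => 0 : R) y @[y --> x] --> (0 : R) by exact: cvg_cst.
  apply: cvg_trans c; apply: near_eq_cvg.
  by apply: filterS (zero_ext_outside vg nOx) => y ->.
- move=> x v; have [Ox|nOx] := pselect (Omega x).
    apply: near_eq_derivable (@smooth_derivable _ g x v sg).
    by apply: filterS (zero_ext_inside g Ox) => y ->.
  apply: near_eq_derivable (@derivable_cst R V R (0 : R) x v).
  by apply: filterS (zero_ext_outside vg nOx) => y ->.
- move=> v; exists ('D_v g); split; [exact: smooth_derive| |exact: derive_zero_ext].
  move=> p cp nOp; have := vg p cp nOp.
  (* Vanishing near p means vanishing near each point close to p, hence the derivatives vanish at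
     those points. *)
  move=> /near_join; apply: filterS => x gx0.
  by rewrite (near_eq_derive v gx0) derive_cst.
Qed.

End zero_extension.

End smooth_closure.

Lemma is_derive_congr {R : realType} (f g : R -> R) (x l m : R) :
  is_derive x 1 f l -> f =1 g -> l = m -> is_derive x 1 g m.
Proof. by move=> H /funext <- <-. Qed.

(** * Flat functions and a smooth truncation of the line *)

Section flat_functions.
Context {R : realType}.
Variable del : R.
Hypothesis del0 : 0 < del.

Definition flat (p : {poly R}) (x : R) : R :=
  if 0 < x then p.[x^-1] * expR (- del * x^-1) else 0.

(** With u = 1/x one has d/dx = -u^2 d/du, so differentiating p(u) exp(-del u) replaces p by del u^2
    p - u^2 p'. All derivatives of a flat function are thus flat functions of other polynomials. *)
Definition flat_next (p : {poly R}) : {poly R} := del *: ('X^2 * p) - 'X^2 * p^`().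

Lemma expR_pow_bound n (u : R) : 0 <= u ->
  u ^+ n * expR (- del * u) <= n`!%:R / del ^+ n.
Proof.
move=> u0; have du0 : 0 <= del * u by rewrite mulr_ge0// ltW.
have : (del * u) ^+ n / n`!%:R <= expR (del * u).
  case: n => [|n]; first by rewrite expr0 fact0 divr1 (le_trans _ (expR_ge1Dx _))// lerDl.
  by apply: le_trans (expR_ge1Dxn n du0); rewrite lerDr.
rewrite ler_pdivrMr ?ltr0n ?fact_gt0// exprMn mulNr expRN => h.
by rewrite ler_pdivrMr ?expR_gt0// mulrAC ler_pdivlMr ?exprn_gt0// mulrC [X in _ <= X]mulrC.
Qed.

Lemma expR_poly_bound (q : {poly R}) :
  exists2 C, 0 <= C & forall u, 0 <= u -> `|q.[u]| * expR (- del * u) <= C.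
Proof.
pose M n : R := n`!%:R / del ^+ n.
have M0 n : 0 <= M n by rewrite divr_ge0// exprn_ge0// ltW.
exists (\sum_(i < size q) `|q`_i| * M i); first by apply: sumr_ge0 => i _; rewrite mulr_ge0.
move=> u u0; rewrite horner_coef.
apply: (@le_trans _ _ ((\sum_(i < size q) `|q`_i| * u ^+ i) * expR (- del * u))).
  rewrite ler_wpM2r ?expR_ge0//; apply: le_trans (ler_norm_sum _ _ _) _.
  by apply: ler_sum => i _; rewrite normrM (@ger0_norm _ (u ^+ _)) ?exprn_ge0.
rewrite mulr_suml; apply: ler_sum => i _; rewrite -mulrA ler_wpM2l//.
exact: expR_pow_bound.
Qed.

Lemma is_derive_flat_pos (p : {poly R}) (x : R) : 0 < x ->
  is_derive x 1 (fun x => p.[x^-1] * expR (- del * x^-1))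
    ((flat_next p).[x^-1] * expR (- del * x^-1)).
Proof.
move=> x0; have xn0 : x != 0 by rewrite gt_eqF.
have dV : is_derive x 1 (fun y : R => y^-1) (- x ^- 2).
  by have := @is_deriveV R id x 1 1 xn0 _; rewrite /GRing.scale /= mulr1; apply; exact: is_derive_id.
have dp : is_derive x 1 (fun y => p.[y^-1]) (p^`().[x^-1] * - x ^- 2).
  exact: (@is_derive1_comp _ (horner p) (fun y => y^-1)).
have de : is_derive x 1 (fun y => expR (- del * y^-1)) (expR (- del * x^-1) * (- del * - x ^- 2)).
  apply: (@is_derive1_comp _ expR (fun y => - del * y^-1)).
apply: (is_derive_congr (is_deriveM dp de)) => //; rewrite /flat_next /GRing.scale /= !hornerE /=.
by field.
Qed.

Lemma is_derive_flat (p : {poly R}) (x : R) :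
  is_derive x 1 (flat p) (flat (flat_next p) x).
Proof.
have [x0|x0|<-] := ltgtP 0 x.
- rewrite {2}/flat x0; apply: (near_eq_is_derive _ (is_derive_flat_pos p x0)).
  by near=> y; rewrite /flat; have -> : 0 < y by near: y; exact: lt_nbhsr.
- rewrite {2}/flat ltNge (ltW x0) /=; apply: (near_eq_is_derive (f := cst 0)).
    near=> y; rewrite /flat ltNge (_ : y <= 0)//.
    by near: y; exact: lt_le_nbhsl.
(* At 0 the difference quotient equals h times (1/h)^2 p(1/h) exp(-del/h) for h > 0; the bound for
   the polynomial X^2 p makes it at most h C. *)
have [C C0 HC] := expR_poly_bound ('X^2 * p).
have c : (fun h : R => h^-1 *: ((flat p \o shift 0) (h *: 1) - flat p 0)) @ 0^' --> (0 : R).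
  apply/cvgrPdist_le => e e0; near=> h.
  rewrite /= /flat ltxx subr0 addr0 sub0r normrN /GRing.scale /= mulr1.
  case: ifPn => [h0|]; last by rewrite mulr0 normr0 ltW.
  have := HC h^-1; rewrite invr_ge0 (ltW h0) => /(_ isT).
  rewrite !hornerE !normrM (@ger0_norm _ h^-1) ?invr_ge0 ?(ltW h0)//.
  rewrite (@ger0_norm _ (expR _)) ?expR_ge0// => hC.
  apply: (@le_trans _ _ (h * C)).
    rewrite -ler_pdivrMl//; apply: le_trans hC; apply: eq_imp_le.
    by rewrite !mulrA.
  apply: (@le_trans _ _ (h * (C + 1))); first by rewrite ler_wpM2l ?(ltW h0)// lerDl.
  rewrite -ler_pdivlMr ?ltr_wpDl//; apply: ltW; apply: le_lt_trans (ler_norm h) _.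
  near: h; apply: dnbhs0_lt; rewrite divr_gt0// ltr_wpDl//.
rewrite {2}/flat ltxx; split; first by apply: cvgP c.
exact: cvg_lim c.
Unshelve. all: by end_near. Qed.

(** The function x exp(-del/x), continued by 0 to x <= 0, and its derivatives. The factor x is not a
    polynomial in 1/x, so order 0 is treated apart; the first derivative (1 + del/x) exp(-del/x) is
    already flat. *)
Definition flat_id (k : nat) : R -> R :=
  if k is k'.+1 then flat (iter k' flat_next (1 + del *: 'X)) else fun x => x * flat 1 x.

Lemma is_derive_flat_id k (x : R) : is_derive x 1 (flat_id k) (flat_id k.+1 x).
Proof.
case: k => [|k]; last by exact: is_derive_flat.
apply: (is_derive_congr (is_deriveM (@is_derive_id R R x 1) (is_derive_flat 1 x))) => //.
rewrite /flat_id /GRing.scale /= /flat /flat_next.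
case: ifPn => x0; last by rewrite mulr0 mul0r addr0.
by rewrite derivC mulr0 subr0 !hornerE /=; field; rewrite gt_eqF.
Qed.

Lemma flat_id_le0 k x : x <= 0 -> flat_id k x = 0.
Proof. by rewrite leNgt /flat_id /flat => /negbTE; case: k => [|k] ->; rewrite ?mulr0. Qed.

Lemma flat_id1_bound x : 0 <= flat_id 1 x <= 1.
Proof.
rewrite /flat_id /= /flat; case: ifPn => [x0|_]; last by rewrite lexx ler01.
rewrite !hornerE /= mulNr expRN; have dx : 0 <= del * x^-1 by rewrite divr_ge0 ?(ltW x0)// ltW.
rewrite divr_ge0 ?addr_ge0 ?expR_ge0//= ler_pdivrMr ?expR_gt0// mul1r.
exact: expR_ge1Dx.
Qed.

Lemma flat_id0_bound x : 0 < x -> x - del <= flat_id 0 x <= x.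
Proof.
move=> x0; rewrite /flat_id /flat x0 !hornerE /= ?mul1r ?mulr1; apply/andP; split.
  apply: (@le_trans _ _ (x * (1 - del * x^-1))).
    by rewrite mulrBr mulr1 mulrCA divff ?gt_eqF// mulr1.
  by rewrite ler_pM2l// -mulNr expR_ge1Dx.
rewrite ger_pMr// -expR0 ler_expR mulNr oppr_le0 divr_ge0 ?(ltW x0)//.
exact: ltW.
Qed.

End flat_functions.

Section truncation.
Context {R : realType}.
Variable eps : R.
Hypothesis eps0 : 0 < eps.

(* [trunc k] is the k-th derivative of a C^oo approximation of the identity which
   vanishes on [-eps, eps] and has slope in [0, 1]. *)
Definition trunc (k : nat) (r : R) : R :=
  flat_id eps k (r - eps) - (-1) ^+ k * flat_id eps k (- r - eps).

Lemma is_derive_trunc k (r : R) : is_derive r 1 (trunc k) (trunc k.+1 r).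
Proof.
have d1 : is_derive r 1 (fun r => r - eps) 1 by apply: is_derive_eq; rewrite subr0.
have d2 : is_derive r 1 (fun r => - r - eps) (-1) by apply: is_derive_eq; rewrite subr0.
have D1 := @is_derive1_comp _ (flat_id eps k) (fun r => r - eps) r _ _
  (is_derive_flat_id eps0 k (r - eps)) d1.
have D2 := @is_derive1_comp _ (flat_id eps k) (fun r => - r - eps) r _ _
  (is_derive_flat_id eps0 k (- r - eps)) d2.
apply: (is_derive_congr (is_deriveB D1 (is_deriveZ ((-1) ^+ k) D2))) => //.
by rewrite /trunc /GRing.scale /= exprS; ring.
Qed.

Lemma trunc_small k r : `|r| <= eps -> trunc k r = 0.
Proof.
rewrite ler_norml => /andP[h1 h2]; rewrite /trunc !flat_id_le0 ?mulr0 ?subr0//; lra.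
Qed.

Lemma trunc1_bound r : `|trunc 1 r| <= 1.
Proof.
rewrite /trunc expr1 mulN1r opprK.
have e0 := eps0.
have /andP[a0 a1] := flat_id1_bound eps0 (r - eps).
have /andP[b0 b1] := flat_id1_bound eps0 (- r - eps).
have [r0|r0] := lerP r 0.
  have -> : flat_id eps 1 (r - eps) = 0 by apply: flat_id_le0; lra.
  by rewrite add0r ger0_norm.
have -> : flat_id eps 1 (- r - eps) = 0 by apply: flat_id_le0; lra.
by rewrite addr0 ger0_norm.
Qed.

(** One [eps] is the shift of the argument, the other is the distance of x exp(-eps/x) from x. *)
Lemma trunc_dist r : `|trunc 0 r - r| <= 2 * eps.
Proof.
have h x : 0 <= x -> `|flat_id eps 0 (x - eps) - x| <= 2 * eps.
  move=> x0; have [xe|xe] := leP (x - eps) 0.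
    by rewrite flat_id_le0// sub0r normrN ger0_norm//; lra.
  by have /andP[] := flat_id0_bound eps0 xe; rewrite ler_norml => *; apply/andP; split; lra.
have e0 := eps0; rewrite /trunc expr0 mul1r; have [r0|r0] := lerP 0 r.
  by rewrite (@flat_id_le0 _ eps 0 (- r - eps)) ?subr0; [exact: h|lra].
rewrite (@flat_id_le0 _ eps 0 (r - eps)) ?sub0r; last lra.
by rewrite -opprD normrN -{2}(opprK r); apply: h; lra.
Qed.

End truncation.

(** * Bessel functions and the one-dimensional trace inequality *)

Section one_dimensional_integrals.
Context {R : realType}.
Local Notation mu := (@lebesgue_measure R).

Lemma FTC_segment (f F : R -> R) (a b : R) : a < b ->
  (forall x, a <= x <= b -> is_derive x 1 F (f x)) ->
  (forall x, a <= x <= b -> {for x, continuous f}) ->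
  (\int[mu]_(x in `[a, b]) (f x)%:E = (F b - F a)%:E)%E.
Proof.
move=> ab dF cf.
have cF x : a <= x <= b -> F y @[y --> x] --> F x.
  move=> xab; apply: differentiable_continuous; apply/derivable1_diffP.
  by have [] := dF x xab.
rewrite EFinB; apply: continuous_FTC2 => //.
- by apply: continuous_in_subspaceT => x /set_mem /=; rewrite in_itv /= => /cf.
- split.
  + move=> x; rewrite in_itv /= => /andP[ax xb].
    have hx : a <= x <= b by rewrite (ltW ax) (ltW xb).
    by have [] := dF x hx.
  + by apply: cvg_at_right_filter; apply: cF; rewrite lexx ltW.
  + by apply: cvg_at_left_filter; apply: cF; rewrite lexx ltW.
- move=> x; rewrite in_itv /= => /andP[ax xb]; rewrite derive1E.
  have hx : a <= x <= b by rewrite (ltW ax) (ltW xb).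
  by have [_ ->] := dF x hx.
Qed.

Lemma integral_exhaust_le (F : nat -> set R) (f : R -> \bar R) (C : \bar R) :
  {homo F : n m / (n <= m)%N >-> (n <= m)%O} -> (forall n, measurable (F n)) ->
  measurable_fun (\bigcup_n F n) f -> (forall x, (\bigcup_n F n) x -> 0 <= f x)%E ->
  (forall n, \int[mu]_(x in F n) f x <= C)%E ->
  (\int[mu]_(x in \bigcup_n F n) f x <= C)%E.
Proof.
move=> ndF mF mf f0 fC.
have mfF i : measurable_fun (F i) f.
  by apply: measurable_funS mf; [exact: bigcupT_measurable|exact: bigcup_sup].
have c := @ge0_nondecreasing_set_cvg_integral _ (measurableTypeR R) _ F f mu ndF mF
  mfF (fun i x Fx => f0 x (ex_intro2 _ _ i I Fx)).
rewrite -(cvg_lim _ c)//; apply: lime_le; first by apply/cvg_ex; eexists; exact: c.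
exact: nearW.
Qed.

Lemma measurable_powR_pos (a : R) (D : set R) : measurable_fun D (fun x => x `^ a).
Proof. by apply: measurable_funTS; exact: measurable_powR. Qed.

Lemma powR_continuous_pos (a x : R) : 0 < x -> {for x, continuous (fun y => y `^ a)}.
Proof.
move=> x0; apply: differentiable_continuous; apply/derivable1_diffP.
by have [] := is_derive1_powR a x0.
Qed.

Lemma bigcup_itv_inv (T : R) : 0 < T ->
  \bigcup_n `[T / n.+2%:R, T]%classic = `]0, T]%classic.
Proof.
move=> T0; apply/seteqP; split=> [x [n _]|x] /=; rewrite !in_itv /=.
  by move=> /andP[nx ->]; rewrite andbT; apply: lt_le_trans nx; rewrite divr_gt0.
move=> /andP[x0 xT]; have [n Tn] : exists n, T / x < n.+2%:R.
  have := archi_boundP (divr_ge0 (ltW T0) (ltW x0)); set N := Num.bound _ => h.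
  by exists N; apply: lt_trans h _; rewrite ltr_nat.
exists n => //=; rewrite in_itv /= xT andbT ler_pdivrMr// mulrC -ler_pdivrMr//.
exact: ltW.
Qed.

Lemma itv_inv_ndecr (T : R) : 0 < T ->
  {homo (fun n : nat => `[T / n.+2%:R, T]%classic : set R) : n m / (n <= m)%N >-> (n <= m)%O}.
Proof.
move=> T0 n m nm; apply/subsetPset => x /=; rewrite !in_itv /= => /andP[h ->].
rewrite andbT; apply: le_trans h; rewrite ler_pM2l// lef_pV2 ?posrE//.
by rewrite ler_nat !ltnS.
Qed.

Lemma integral_powR0_le (a T : R) : -1 < a -> 0 < T ->
  (\int[mu]_(x in `]0%R, T]) (x `^ a)%:E <= (T `^ (a + 1) / (a + 1))%:E)%E.
Proof.
move=> a1 T0; have a0 : 0 < a + 1 by lra.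
rewrite -bigcup_itv_inv//; apply: integral_exhaust_le.
- exact: itv_inv_ndecr.
- by move=> n; exact: measurable_itv.
- by apply/measurable_EFinP; exact: measurable_powR_pos.
- by move=> x _; rewrite lee_fin powR_ge0.
move=> n; have Tn0 : 0 < T / n.+2%:R by rewrite divr_gt0.
rewrite [leLHS](_ : _ = (T `^ (a + 1) / (a + 1) - (T / n.+2%:R) `^ (a + 1) / (a + 1))%:E).
  by rewrite lee_fin gerBl divr_ge0 ?powR_ge0// ltW.
apply: (@FTC_segment _ (fun x => x `^ (a + 1) / (a + 1))).
- by rewrite ltr_pdivrMr// ltr_pMr// ltr1n.
- move=> x /andP[ex _]; have x0 : 0 < x by exact: lt_le_trans ex.
  apply: (is_derive_congr (is_deriveZ (a + 1)^-1 (is_derive1_powR (a + 1) x0))).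
    by move=> y; rewrite /= /GRing.scale /= mulrC.
  by rewrite /GRing.scale /= mulrA mulVf ?gt_eqF// mul1r addrK.
- by move=> x /andP[ex _]; apply: powR_continuous_pos; exact: lt_le_trans ex.
Qed.

(** For c = 0 this is the integrand of Gamma(p+1); for c = t^2/4 it is the integrand in the
    classical integral representation of the modified Bessel function K. *)
Definition gamma_kernel (p c r : R) : R := r `^ p * expR (- r) * expR (- c * r^-1).

Lemma gamma_kernel_ge0 p c r : 0 <= gamma_kernel p c r.
Proof. by rewrite !mulr_ge0 ?powR_ge0 ?expR_ge0. Qed.

Lemma gamma_kernel_continuous p c r : 0 < r -> {for r, continuous (gamma_kernel p c)}.
Proof.
move=> r0; apply: cvgM; first apply: cvgM.
- exact: powR_continuous_pos.
- by apply: continuous_comp; [exact: opp_continuous|exact: continuous_expR].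
- apply: continuous_comp; last exact: continuous_expR.
  by apply: cvgMr; apply: cvgV; [rewrite gt_eqF|exact: cvg_id].
Qed.

Lemma measurable_gamma_kernel p c (D : set R) : D `<=` `]0, +oo[%classic -> measurable D ->
  measurable_fun D (gamma_kernel p c).
Proof.
move=> D0 mD; apply: (measurable_funS _ D0) => //.
apply: open_continuous_measurable_fun; first exact: rray_open.
by move=> x /set_mem /=; rewrite in_itv /= andbT; exact: gamma_kernel_continuous.
Qed.

Lemma integral_expRN_le : (\int[mu]_(x in `[1%R, +oo[) (expR (- x))%:E <= 1%:E)%E.
Proof.
rewrite (_ : [set` `[1%R, +oo[] = \bigcup_n `[1, n.+2%:R]%classic); last first.
  apply/seteqP; split=> [x|x [n _]] /=; rewrite !in_itv /= ?andbT; last by move=> /andP[].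
  move=> x1; have := archi_boundP (le_trans ler01 x1); set N := Num.bound _ => h.
  exists N => //=; rewrite in_itv /= x1 /=; apply: le_trans (ltW h) _.
  by rewrite ler_nat -addn2 leq_addr.
apply: integral_exhaust_le.
- move=> n m nm; apply/subsetPset => x /=; rewrite !in_itv /= => /andP[-> h] /=.
  by apply: le_trans h _; rewrite ler_nat !ltnS.
- by move=> n; exact: measurable_itv.
- by apply/measurable_EFinP; apply: measurableT_comp => //; exact: measurable_funTS.
- by move=> x _; rewrite lee_fin expR_ge0.
move=> n; rewrite [leLHS](_ : _ = (- expR (- n.+2%:R) - - expR (- 1))%:E).
  rewrite lee_fin opprK addrC; apply: (@le_trans _ _ (expR (-1))).
    by rewrite gerBl expR_ge0.
  by rewrite -[leRHS]expR0 ler_expR oppr_le0 ler01.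
apply: (@FTC_segment _ (fun x => - expR (- x))).
- by rewrite ltr1n.
- move=> x _.
  have dN : is_derive x 1 (fun x : R => - x) (-1) by apply: is_derive_eq.
  apply: (is_derive_congr (is_deriveN (@is_derive1_comp _ expR -%R x _ _ _ dN))) => //.
  by rewrite mulrN mulr1 opprK.
- move=> x _; apply: continuous_comp; [exact: opp_continuous|exact: continuous_expR].
Qed.

(** On ]0, 1] the kernel is dominated by r^p, integrable as p > -1; beyond 1 it is dominated by
    exp(-r), since r^p <= 1 for p <= 0. *)
Lemma integrable_gamma_kernel p c : -1 < p <= 0 -> 0 <= c ->
  mu.-integrable `]0, +oo[ (EFin \o gamma_kernel p c).
Proof.
move=> /andP[p1 p0] c0; apply/integrableP; split.
  by apply/measurable_EFinP; exact: measurable_gamma_kernel.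
have mk := @measurable_gamma_kernel p c.
under eq_integral do rewrite /= ger0_norm ?gamma_kernel_ge0//.
have U : `]0, +oo[%classic = `]0, 1]%classic `|` `]1, +oo[%classic :> set R.
  apply/seteqP; split=> x /=; rewrite !in_itv /= ?andbT.
    by move=> x0; have [x1|x1] := leP x 1; [left; rewrite x0|right].
  by case=> [/andP[]//|x1]; exact: lt_trans x1.
rewrite U ge0_integral_setU//; last 3 first.
- by apply/measurable_EFinP; rewrite -U; apply: mk.
- by move=> x _; rewrite lee_fin gamma_kernel_ge0.
- by apply/disj_setPS => x /= [] /=; rewrite !in_itv /= andbT => /andP[_ x1]; rewrite ltNge x1.
have ec x : 0 < x -> expR (- c * x^-1) <= 1.
  by move=> x0; rewrite -expR0 ler_expR mulNr oppr_le0 divr_ge0// ltW.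
apply: lte_add_pinfty.
  apply: le_lt_trans (le_lt_trans (integral_powR0_le p1 ltr01) (ltry _)).
  apply: ge0_le_integral => //.
  - by move=> x _; rewrite lee_fin gamma_kernel_ge0.
  - apply/measurable_EFinP; apply: mk => // x /=; rewrite !in_itv /= andbT.
    by move=> /andP[].
  - by apply/measurable_EFinP; exact: measurable_powR_pos.
  move=> x /=; rewrite in_itv /= => /andP[x0 _]; rewrite lee_fin /gamma_kernel -mulrA.
  apply: ler_piMr; first exact: powR_ge0.
  apply: mulr_ile1; [exact: expR_ge0|exact: expR_ge0| |exact: ec].
  by rewrite -expR0 ler_expR oppr_le0 ltW.
apply: le_lt_trans (le_lt_trans integral_expRN_le (ltry _)).
have m1 (D : set R) : measurable_fun D (fun x : R => (expR (- x))%:E).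
  by apply/measurable_EFinP; apply: measurableT_comp => //; exact: measurable_funTS.
apply: (@le_trans _ _ (\int[mu]_(x in `]1%R, +oo[) (expR (- x))%:E)%E); last first.
  apply: ge0_subset_integral => //; first exact: m1.
  by move=> x /=; rewrite !in_itv /= !andbT; exact: ltW.
apply: ge0_le_integral => //.
- by move=> x _; rewrite lee_fin gamma_kernel_ge0.
- apply/measurable_EFinP; apply: mk => // x /=; rewrite !in_itv /= !andbT.
  by exact: lt_trans.
- exact: m1.
move=> x /=; rewrite in_itv /= andbT => x1; rewrite lee_fin /gamma_kernel.
have x0 : 0 < x by exact: lt_trans x1.
rewrite mulrAC; apply: ler_piMl; first exact: expR_ge0.
apply: mulr_ile1; [exact: powR_ge0|exact: expR_ge0| |exact: ec].
by rewrite -(powRr0 x) ler_powR// ltW.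
Qed.

(* The substitution r = c / r'. *)
Lemma gamma_kernel_inversion p c : 0 < c ->
  (\int[mu]_(x in `]0%R, +oo[) (gamma_kernel p c x)%:E =
   (c `^ (p + 1))%:E * \int[mu]_(x in `]0%R, +oo[) (gamma_kernel (- p - 2) c x)%:E)%E.
Proof.
move=> c0.
have exhaust (b : R) : 0 < b ->
    \bigcup_n `[b / n.+2%:R, b * n.+2%:R]%classic = `]0, +oo[%classic :> set R.
  move=> b0; apply/seteqP; split=> [x [n _]|x] /=; rewrite !in_itv /= ?andbT.
    by move=> /andP[h _]; apply: lt_le_trans h; rewrite divr_gt0.
  move=> x0.
  have h1 := archi_boundP (divr_ge0 (ltW b0) (ltW x0)).
  have h2 := archi_boundP (divr_ge0 (ltW x0) (ltW b0)).
  set N1 := Num.bound _ in h1; set N2 := Num.bound _ in h2.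
  exists (N1 + N2)%N => //=; rewrite in_itv /=; apply/andP; split.
    rewrite ler_pdivrMr// mulrC -ler_pdivrMr//; apply: le_trans (ltW h1) _.
    by rewrite ler_nat -addn2 -addnA leq_addr.
  rewrite -ler_pdivrMl// mulrC; apply: le_trans (ltW h2) _.
  by rewrite ler_nat -addn2 addnAC leq_addl.
have ndec (b : R) : 0 < b -> {homo (fun n : nat => `[b / n.+2%:R, b * n.+2%:R]%classic : set R) :
    n m / (n <= m)%N >-> (n <= m)%O}.
  move=> b0 n m nm; apply/subsetPset => x /=; rewrite !in_itv /= => /andP[h1 h2].
  apply/andP; split.
    by apply: le_trans h1; rewrite ler_pM2l// lef_pV2 ?posrE// ler_nat !ltnS.
  by apply: le_trans h2 _; rewrite ler_pM2l// ler_nat !ltnS.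
have cvgs b q : 0 < b ->
    (\int[mu]_(x in `[(b / n.+2%:R)%R, (b * n.+2%:R)%R]) (gamma_kernel q c x)%:E)%E @[n --> \oo] -->
    (\int[mu]_(x in `]0%R, +oo[) (gamma_kernel q c x)%:E)%E.
  move=> b0; rewrite -(exhaust b b0).
  apply: (@ge0_nondecreasing_set_cvg_integral _ (measurableTypeR R) _ _ _ mu (ndec b b0)).
  - by move=> n; exact: measurable_itv.
  - move=> n; apply/measurable_EFinP; apply: measurable_gamma_kernel => // x /=.
    by rewrite !in_itv /= andbT => /andP[h _]; apply: lt_le_trans h; rewrite divr_gt0.
  - by move=> n x _; rewrite lee_fin gamma_kernel_ge0.
(* The map r -> c/r sends [1/N, N] onto [c/N, c N]. Exhausting the half-line by windows around c on
   the left and around 1 on the right makes the identity exact for each N, before passing to the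
   limit. *)
have L := cvgs c p c0; have {cvgs} M := cvgs 1 (- p - 2) ltr01.
have {}M := cvgeZl (y := (c `^ (p + 1))%:E) isT M.
suff E : (fun n : nat => \int[mu]_(x in `[(c / n.+2%:R)%R, (c * n.+2%:R)%R]) (gamma_kernel p c x)%:E)%E =
    (fun n : nat => (c `^ (p + 1))%:E *
      \int[mu]_(x in `[(1 / n.+2%:R)%R, (1 * n.+2%:R)%R]) (gamma_kernel (- p - 2) c x)%:E)%E.
  by rewrite -(cvg_lim (@ereal_hausdorff R) L) -(cvg_lim (@ereal_hausdorff R) M) E.
apply/funext => n; rewrite !mul1r; set N : R := n.+2%:R.
have N0 : 0 < N by rewrite ltr0n.
have N1 : N^-1 < N by apply: (@lt_trans _ _ 1); rewrite ?invf_lt1 ?ltr1n.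
pose G := fun r : R => c * r^-1.
have dG (r : R) : 0 < r -> is_derive r 1 G (- (c * r ^- 2)).
  move=> r0.
  have dV : is_derive r 1 (fun y : R => y^-1) (- r ^- 2).
    have := @is_deriveV R id r 1 1; rewrite gt_eqF// /GRing.scale /= mulr1; apply => //.
  apply: (is_derive_congr (is_deriveZ c dV)) => //.
  by rewrite /GRing.scale /= mulrN.
have dG1 (r : R) : 0 < r -> derive1 G r = - (c * r ^- 2).
  by move=> r0; rewrite derive1E; have [_ ->] := dG r r0.
have cG2 (r : R) : 0 < r -> {for r, continuous (fun r : R => - (c * r ^- 2))}.
  move=> r0; apply: cvgN; apply: cvgMr; apply: cvgV; first by rewrite expf_neq0// gt_eqF.
  by apply: exprn_continuous.
have cdG (r : R) : 0 < r -> derive1 G x @[x --> r] --> - (c * r ^- 2).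
  move=> r0; apply: cvg_trans (cG2 r r0); apply: near_eq_cvg.
  by near=> x; rewrite dG1//; near: x; exact: lt_nbhsr.
have GN : G N = c / N by [].
have GNV : G N^-1 = c * N by rewrite /G invrK.
rewrite -GN -GNV integration_by_substitution_decreasing.
- rewrite -ge0_integralZl_EFin ?powR_ge0//; last 2 first.
  + by move=> x _; rewrite lee_fin gamma_kernel_ge0.
  + apply/measurable_EFinP; apply: measurable_gamma_kernel => // x /=.
    by rewrite !in_itv /= andbT => /andP[h _]; apply: lt_le_trans h; rewrite invr_gt0.
  apply: eq_integral => x /set_mem /=; rewrite in_itv /= => /andP[h _].
  have x0 : 0 < x by apply: lt_le_trans h; rewrite invr_gt0.
  rewrite -EFinM; congr EFin.
  transitivity (gamma_kernel p c (c * x^-1) * - derive1 G x); first by [].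
  rewrite dG1// opprK /gamma_kernel.
  have e1 : - c * (c * x^-1)^-1 = - x by field; rewrite !gt_eqF.
  have e2 : (c * x^-1) `^ p * (c * x ^- 2) = c `^ (p + 1) * x `^ (- p - 2).
    have cE : c = expR (ln c) by rewrite lnK ?posrE.
    have xE : x = expR (ln x) by rewrite lnK ?posrE.
    rewrite cE xE -expRM_natl -!expRN -!expRD -!expRM -!expRD.
    by congr expR; ring.
  rewrite e1 -(mulNr c) 2!(mulrA (c `^ _)) -e2.
  by ring.
- exact: ltW.
- move=> x y; rewrite !in_itv /= => /andP[hx _] /andP[hy _] xy.
  have Ni : 0 < N^-1 by rewrite invr_gt0.
  by rewrite /G ltr_pM2l// ltf_pV2 ?posrE// (lt_le_trans Ni).
- move=> x; rewrite in_itv /= => /andP[hx _].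
  have x0 : 0 < x by apply: lt_trans hx; rewrite invr_gt0.
  by rewrite /continuous_at dG1//; exact: cdG.
- apply/cvg_ex; eexists; apply: cvg_at_right_filter; apply: cdG; rewrite invr_gt0//.
- apply/cvg_ex; eexists; apply: cvg_at_left_filter; exact: cdG.
- have cG (r : R) : 0 < r -> G x @[x --> r] --> G r.
    move=> r0; apply: differentiable_continuous; apply/derivable1_diffP.
    by have [] := dG r r0.
  split.
  + move=> x; rewrite in_itv /= => /andP[hx _].
    have x0 : 0 < x by apply: lt_trans hx; rewrite invr_gt0.
    by have [] := dG x x0.
  + by apply: cvg_at_right_filter; apply: cG; rewrite invr_gt0.
  + by apply: cvg_at_left_filter; exact: cG.
- apply: continuous_in_subspaceT => x /set_mem /=; rewrite in_itv /= => /andP[h _].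
  apply: gamma_kernel_continuous; apply: lt_le_trans h.
  by rewrite GN divr_gt0.
Unshelve. all: by end_near. Qed.

(* Up to the factor 2 (t / 2)^(-z), the modified Bessel function K_z. *)
Definition bessel (z t : R) : R := \int[mu]_(r in `]0, +oo[) gamma_kernel (z - 1) (t ^+ 2 / 4) r.

Lemma sqr4_ge0 (t : R) : 0 <= t ^+ 2 / 4.
Proof. by rewrite divr_ge0// sqr_ge0. Qed.

Lemma bessel0 (z : R) : bessel z 0 = Gamma z.
Proof.
apply: eq_Rintegral => r _; rewrite /gamma_kernel expr0n mul0r oppr0 mul0r expR0.
by rewrite mulr1.
Qed.

Lemma integrable_bessel (z t : R) : 0 < z < 1 ->
  mu.-integrable `]0, +oo[ (EFin \o gamma_kernel (z - 1) (t ^+ 2 / 4)).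
Proof.
by move=> /andP[z0 z1]; apply: integrable_gamma_kernel; [lra|exact: sqr4_ge0].
Qed.

Lemma bessel_gt0 (z t : R) : 0 < z < 1 -> 0 < bessel z t.
Proof.
move=> z01; have ib := integrable_bessel t z01; have /andP[z0 z1] := z01.
(* A lower bound of the kernel on [1, 2], an interval of length 1: each of the three factors is
   replaced by its minimum there or by a smaller value. *)
pose m : R := 2 `^ (z - 1) * expR (- 2) * expR (- (t ^+ 2 / 4)).
have m0 : 0 < m by rewrite !mulr_gt0 ?powR_gt0 ?expR_gt0.
apply: (lt_le_trans m0); rewrite -lee_fin /bessel /Rintegral fineK; last first.
  exact: integrable_fin_num ib.
have s12 : (`[1, 2]%classic : set R) `<=` `]0, +oo[%classic.
  by move=> x /=; rewrite !in_itv /= andbT => /andP[x1 _]; exact: lt_le_trans x1.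
apply: (@le_trans _ _ (\int[mu]_(r in `[1%R, 2%R]) (gamma_kernel (z - 1) (t ^+ 2 / 4) r)%:E)%E); last first.
  apply: ge0_subset_integral => //.
    by apply/measurable_EFinP; exact: measurable_gamma_kernel.
  by move=> x _; rewrite lee_fin gamma_kernel_ge0.
apply: (@le_trans _ _ (\int[mu]_(r in `[1%R, 2%R]) m%:E)%E).
  rewrite integral_cst//= lebesgue_measure_itv /= lte_fin ltr1n.
  by rewrite -EFinB -EFinM lee_fin (_ : 2 - 1 = 1 :> R) ?mulr1//; ring.
apply: ge0_le_integral => //.
- by move=> x _; rewrite lee_fin ltW.
- by apply/measurable_EFinP; exact: measurable_gamma_kernel.
move=> x /=; rewrite in_itv /= => /andP[x1 x2]; rewrite lee_fin /m /gamma_kernel.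
have x0 : 0 < x by exact: lt_le_trans x1.
apply: ler_pM; rewrite ?mulr_ge0 ?powR_ge0 ?expR_ge0//.
  apply: ler_pM; rewrite ?powR_ge0 ?expR_ge0//; last by rewrite ler_expR lerN2.
  have -> : z - 1 = - (1 - z) by ring.
  rewrite !powRN lef_pV2 ?posrE ?powR_gt0//.
  by apply: ge0_ler_powR => //; rewrite ?nnegrE ?(ltW x0)//; lra.
rewrite ler_expR mulNr lerN2; apply: ler_piMr; first exact: sqr4_ge0.
by rewrite invf_le1.
Qed.

(** The Gamma integrand (c = 0) dominates all the kernels. Continuity includes t = 0, where the
    Riccati solution will be evaluated. *)
Lemma bessel_continuous (z : R) : 0 < z < 1 -> continuous (bessel z).
Proof.
move=> z01 t.
have h := @continuity_under_integral R _ (measurableTypeR R) mu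
  (fun t r => gamma_kernel (z - 1) (t ^+ 2 / 4) r) `]0, +oo[%classic
  (measurable_itv _) (t - 1) (t + 1) (fun x _ => integrable_bessel x z01) _
  (gamma_kernel (z - 1) 0) _ _.
apply: h; last by rewrite inE /= in_itv /=; apply/andP; split; lra.
- apply: aeW => r /=; rewrite in_itv /= andbT => r0 x _.
  apply: cvgMr; apply: continuous_comp; last exact: continuous_expR.
  apply: cvgMl; apply: cvgN; apply: cvgMl; exact: exprn_continuous.
- have /andP[z0 z1] := z01; apply: integrable_gamma_kernel => //; lra.
- move=> x _; apply: aeW => r /=; rewrite in_itv /= andbT => r0.
  rewrite ger0_norm ?gamma_kernel_ge0// /gamma_kernel ler_wpM2l ?mulr_ge0 ?powR_ge0 ?expR_ge0//.
  rewrite ler_expR oppr0 mul0r mulNr oppr_le0 mulr_ge0 ?sqr4_ge0// invr_ge0 ltW//.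
Qed.

(** Differentiating under the integral produces the factor -(t/2)/r, which lowers the exponent from
    z-1 to z-2. This may fail to be integrable for c = 0, but for c = t^2/4 the inversion r -> c/r
    turns it into the exponent -z, that is into [bessel (1 - z)], with constant (t/2)(t^2/4)^(z-1) =
    2^(1-2z) t^(2z-1). *)
Lemma is_derive_bessel (z t : R) : 0 < z < 1 -> 0 < t ->
  is_derive t 1 (bessel z) (- (2 `^ (1 - 2 * z) * t `^ (2 * z - 1) * bessel (1 - z) t)).
Proof.
move=> z01 t0; have /andP[z0 z1] := z01.
pose f := fun t r : R => gamma_kernel (z - 1) (t ^+ 2 / 4) r.
have df (x r : R) : 0 < r ->
    is_derive x 1 (f ^~ r) (f x r * (- (x / 2) * r^-1)).
  move=> r0.
  have d1 : is_derive x 1 (fun x : R => - (x ^+ 2 / 4) * r^-1) (- (x / 2) * r^-1).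
    by apply: is_derive_eq; rewrite /GRing.scale /=; field; rewrite gt_eqF.
  have d2 := @is_derive1_comp _ expR (fun x : R => - (x ^+ 2 / 4) * r^-1) x _ _
    (is_derive_expR _) d1.
  apply: (is_derive_congr (is_deriveZ (r `^ (z - 1) * expR (- r)) d2)) => //.
  by rewrite /GRing.scale /= /f /gamma_kernel !mulrA.
have p1 (x r : R) : 0 < r -> partial1of2 f x r = f x r * (- (x / 2) * r^-1).
  by move=> r0; rewrite partial1of2E; have [_ ->] := df x r r0.
(* For x in ]t/2, 2t[ the factor x/2 is at most t. With u = x^2/(4r) the bound u exp(-u) <= 1 gives
   exp(-u)/r <= 4/x^2 <= 16/t^2. So [K] times the Gamma integrand dominates the derivative uniformly
   in x. *)
pose K : R := t * (16 / t ^+ 2).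
have mI : measurable (`]0, +oo[%classic : set (measurableTypeR R)) by exact: measurable_itv.
have tI : `](t / 2), (2 * t)[%classic t by rewrite /= in_itv /=; apply/andP; split; lra.
have iG : mu.-integrable `]0, +oo[ (EFin \o (fun r => K * gamma_kernel (z - 1) 0 r)).
  apply: (integrableZl mI K (f := EFin \o gamma_kernel (z - 1) 0)).
  by apply: integrable_gamma_kernel => //; lra.
have G0 r : 0 <= K * gamma_kernel (z - 1) 0 r.
  by rewrite mulr_ge0 ?gamma_kernel_ge0// mulr_ge0 ?(ltW t0)// divr_ge0// sqr_ge0.
have Gub (x r : R) : `](t / 2), (2 * t)[%classic x -> `]0, +oo[%classic r ->
    `|partial1of2 f x r| <= K * gamma_kernel (z - 1) 0 r.
  rewrite /= !in_itv /= andbT => /andP[xl xu] r0; rewrite p1//.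
  have x0 : 0 < x by lra.
  rewrite mulNr mulrN normrN ger0_norm; last first.
    by rewrite mulr_ge0 ?gamma_kernel_ge0// mulr_ge0 ?invr_ge0 ?(ltW r0)// divr_ge0// ltW.
  have c0 : 0 < x ^+ 2 / 4 by rewrite divr_gt0// exprn_gt0.
  have E : expR (- (x ^+ 2 / 4) * r^-1) * r^-1 <= 16 / t ^+ 2.
    rewrite mulNr expRN mulrC ler_pdivrMr ?expR_gt0//.
    apply: (@le_trans _ _ (16 / t ^+ 2 * (x ^+ 2 / 4 * r^-1))); last first.
      rewrite ler_wpM2l ?divr_ge0 ?sqr_ge0//.
      by apply: le_trans (expR_ge1Dx _); rewrite lerDr.
    rewrite mulrA ler_peMl ?invr_ge0 ?(ltW r0)//.
    rewrite (_ : 16 / t ^+ 2 * (x ^+ 2 / 4) = (2 * x / t) ^+ 2); last by field; rewrite gt_eqF.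
    by rewrite exprn_ege1// ler_pdivlMr// mul1r; lra.
  rewrite /f /gamma_kernel oppr0 mul0r expR0 mulr1.
  rewrite (_ : _ * (x / 2 * r^-1) = (x / 2) * (expR (- (x ^+ 2 / 4) * r^-1) * r^-1) *
     (r `^ (z - 1) * expR (- r))); last by ring.
  rewrite ler_wpM2r ?mulr_ge0 ?powR_ge0 ?expR_ge0//.
  apply: ler_pM => //; rewrite ?divr_ge0 ?(ltW x0)//; last by lra.
  exact: ltW.
have dfd (x r : R) : `](t / 2), (2 * t)[%classic x -> `]0, +oo[%classic r -> derivable (f ^~ r) x 1.
  by move=> _; rewrite /= in_itv /= andbT => r0; have [] := df x r r0.
have D1 := @derivable_under_integral R _ (measurableTypeR R) mu f _ mI t _ _ tI
  (fun x _ => integrable_bessel x z01) dfd _ G0 iG Gub.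
have D2 := @differentiation_under_integral R _ (measurableTypeR R) mu f _ mI t _ _ tI
  (fun x _ => integrable_bessel x z01) dfd _ G0 iG Gub.
split => //; rewrite -derive1E D2.
pose c := t ^+ 2 / 4; have c0 : 0 < c by rewrite divr_gt0// exprn_gt0.
have ib1 : mu.-integrable `]0, +oo[ (EFin \o gamma_kernel (1 - z - 1) c).
  by apply: integrable_bessel; lra.
have E1 : (\int[mu]_(x in `]0%R, +oo[) (gamma_kernel (z - 2) c x)%:E =
    (c `^ (z - 1))%:E * \int[mu]_(x in `]0%R, +oo[) (gamma_kernel (1 - z - 1) c x)%:E)%E.
  rewrite gamma_kernel_inversion//.
  have -> : z - 2 + 1 = z - 1 by ring.
  by have -> : - (z - 2) - 2 = 1 - z - 1 by ring.
have i2 : mu.-integrable `]0, +oo[ (EFin \o gamma_kernel (z - 2) c).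
  apply/integrableP; split; first by apply/measurable_EFinP; exact: measurable_gamma_kernel.
  under eq_integral do rewrite /= ger0_norm ?gamma_kernel_ge0//.
  rewrite E1; have [_] := integrableP _ _ _ ib1.
  under eq_integral do rewrite /= ger0_norm ?gamma_kernel_ge0//.
  by move=> h; rewrite lte_mul_pinfty// ?lee_fin ?powR_ge0.
transitivity (\int[mu]_(r in `]0, +oo[) (- (t / 2) * gamma_kernel (z - 2) c r)).
  apply: eq_Rintegral => r; rewrite inE /= in_itv /= andbT => r0; rewrite p1//.
  rewrite /f /gamma_kernel -/c.
  have -> : r `^ (z - 2) = r `^ (z - 1) * r^-1.
    have rE : r = expR (ln r) by rewrite lnK ?posrE.
    by rewrite rE -expRN -!expRM -expRD; congr expR; ring.
  by ring.
rewrite RintegralZl//.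
have -> : \int[mu]_(r in `]0, +oo[) gamma_kernel (z - 2) c r = c `^ (z - 1) * bessel (1 - z) t.
  by rewrite /Rintegral E1 fineM//; exact: integrable_fin_num ib1.
rewrite mulNr mulrA; congr (- (_ * _)).
rewrite /c (_ : 4 = 2 * 2 :> R); last by ring.
suff H (b : R) : 0 < b -> t / b * (t ^+ 2 / (b * b)) `^ (z - 1) = b `^ (1 - 2 * z) * t `^ (2 * z - 1).
  exact: H.
move=> b0.
have tE : t = expR (ln t) by rewrite lnK ?posrE.
have E2 : b = expR (ln b) by rewrite lnK ?posrE.
by rewrite tE E2 -expRM_natl -!expRD -!expRN -!expRD -!expRM -!expRD; congr expR; ring.
Qed.

End one_dimensional_integrals.

Lemma continuous_sqr (R : realType) (T : topologicalType) (f : T -> R) (x : T) :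
  {for x, continuous f} -> {for x, continuous (fun x => f x ^+ 2)}.
Proof.
move=> cf; rewrite (_ : (fun x => _) = (fun x => f x * f x)); first exact: cvgM.
by apply/funext => y; rewrite expr2.
Qed.

Section one_dimensional_trace.
Context {R : realType}.
Local Notation mu := (@lebesgue_measure R).
Variables (s m : R).
Hypothesis s01 : 0 < s < 1.
Hypothesis m0 : 0 < m.

Let s01' : 0 < 1 - s < 1.
Proof. by move: s01; lra. Qed.

(* [riccati t] is -t^(1-2s) K'(t) / K(t) for the decaying solution K of
   (t^(1-2s) K')' = m^2 t^(1-2s) K. *)
Definition riccati (t : R) : R :=
  m `^ (2 * s) * 2 `^ (1 - 2 * s) * (bessel (1 - s) (m * t) / bessel s (m * t)).

(** At the origin the quotient of Bessel integrals becomes Gamma(1-s)/Gamma(s), which is how the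
    constant C_s arises. *)
Lemma riccati0 : riccati 0 = m `^ (2 * s) * C_ s.
Proof. by rewrite /riccati /C_ mulr0 !bessel0 -mulrA. Qed.

Lemma riccati_continuous : continuous riccati.
Proof.
have c z : 0 < z < 1 -> continuous (fun t => bessel z (m * t)).
  move=> z01 t; apply: continuous_comp; last exact: bessel_continuous.
  by apply: cvgMr; exact: cvg_id.
move=> t; apply: cvgMr; apply: cvgM; first exact: c.
by apply: cvgV; [rewrite gt_eqF// bessel_gt0|exact: c].
Qed.

(** Differentiation exchanges the indices s and 1-s up to a power of t, so the quotient rule
    expresses the derivative of the ratio through the ratio itself: one term is its square, the
    other is free of it. *)
Lemma is_derive_riccati (t : R) : 0 < t ->
  is_derive t 1 riccati (t `^ (2 * s - 1) * riccati t ^+ 2 - m ^+ 2 * t `^ (1 - 2 * s)).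
Proof.
move=> t0; have mt0 : 0 < m * t by rewrite mulr_gt0.
have dm : is_derive t 1 (fun t : R => m * t) m.
  by apply: is_derive_eq; rewrite /GRing.scale /= mulr1.
have d1 := @is_derive1_comp _ (bessel (1 - s)) (fun t => m * t) t _ _
  (is_derive_bessel s01' mt0) dm.
have d2 := @is_derive1_comp _ (bessel s) (fun t => m * t) t _ _
  (is_derive_bessel s01 mt0) dm.
have b0 := bessel_gt0 (m * t) s01.
have bn0 : (bessel s \o (fun t => m * t)) t != 0 by rewrite /= gt_eqF.
have d3 := is_deriveV bn0 d2.
apply: (is_derive_congr (is_deriveZ (m `^ (2 * s) * 2 `^ (1 - 2 * s)) (is_deriveM d1 d3))) => //.
rewrite /riccati /GRing.scale /=.
set B := bessel s (m * t) in b0 *.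
have -> : 1 - (1 - s) = s by ring.
rewrite -/B; set A := bessel (1 - s) (m * t).
have E (b : R) : 0 < b -> [/\ b `^ (1 - 2 * (1 - s)) = (b `^ (1 - 2 * s))^-1 &
     b `^ (2 * (1 - s) - 1) = b `^ (1 - 2 * s)].
  move=> b0'; split; last by congr (_ `^ _); ring.
  by rewrite -powRN; congr (_ `^ _); ring.
have [-> _] := E 2 ltac:(by []).
have [_ ->] := E (m * t) mt0.
have -> : (m * t) `^ (2 * s - 1) = ((m * t) `^ (1 - 2 * s))^-1.
  by rewrite -powRN; congr (_ `^ _); ring.
have -> : t `^ (2 * s - 1) = (t `^ (1 - 2 * s))^-1.
  by rewrite -powRN; congr (_ `^ _); ring.
rewrite powRM ?(ltW m0) ?(ltW t0)//.
have -> : m `^ (2 * s) = m / m `^ (1 - 2 * s).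
  have mE : m = expR (ln m) by rewrite lnK ?posrE.
  by rewrite mE -!expRM -expRN -expRD; congr expR; ring.
have p1 : 0 < m `^ (1 - 2 * s) by exact: powR_gt0.
have p2 : 0 < t `^ (1 - 2 * s) by exact: powR_gt0.
have p3 : 0 < (2 : R) `^ (1 - 2 * s) by exact: powR_gt0.
by field; rewrite !gt_eqF.
Qed.

Lemma weighted_trace_1D (psi psi' : R -> R) (T : R) : 0 < T ->
  (forall t : R, is_derive t 1 psi (psi' t)) -> continuous psi' ->
  (forall t, T <= t -> psi t = 0) ->
  ((m `^ (2 * s) * C_ s * psi 0 ^+ 2)%:E <=
   \int[mu]_(t in `]0%R, +oo[) (t `^ (1 - 2 * s) * (psi' t ^+ 2 + m ^+ 2 * psi t ^+ 2))%:E)%E.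
Proof.
move=> T0 dpsi cpsi' psi0.
have cpsi := is_derive_continuous dpsi.
pose G t := t `^ (1 - 2 * s) * (psi' t ^+ 2 + m ^+ 2 * psi t ^+ 2).
have G0 t : 0 <= G t by rewrite mulr_ge0 ?powR_ge0// addr_ge0 ?sqr_ge0// mulr_ge0 ?sqr_ge0.
have mG : measurable_fun (`]0, +oo[%classic : set R) G.
  apply: measurable_funM; first exact: measurable_powR_pos.
  apply: measurable_funD; [|apply: measurable_funM => //]; apply: measurable_funX;
    by apply: measurable_funTS; exact: continuous_measurable_fun.
set I := (X in (_ <= X)%E).
(* The powers of t may be singular at 0, so the fundamental theorem of calculus is applied on
   [e, T], where psi(T) = 0 kills the upper boundary term. Continuity of [riccati] at 0 allows e to
   tend to 0 at the end. *)
have key e : 0 < e < T -> ((riccati e * psi e ^+ 2)%:E <= I)%E.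
  move=> /andP[e0 eT].
  pose f t := (t `^ (2 * s - 1) * riccati t ^+ 2 - m ^+ 2 * t `^ (1 - 2 * s)) * psi t ^+ 2
    + 2 * riccati t * psi t * psi' t.
  pose F t := - (riccati t * psi t ^+ 2).
  have pos t : e <= t <= T -> 0 < t by move=> /andP[et _]; exact: lt_le_trans et.
  have dF t : e <= t <= T -> is_derive t 1 F (- f t).
    move=> /pos t0.
    have d1 := is_derive_riccati t0.
    have d2 := is_deriveM (dpsi t) (dpsi t).
    apply: (is_derive_congr (is_deriveN (is_deriveM d1 d2))).
      by move=> x; rewrite /F expr2.
    have -> : (psi * psi) t = psi t ^+ 2 by rewrite expr2.
    by rewrite /f /GRing.scale /=; ring.
  have cf t : e <= t <= T -> {for t, continuous (fun t => - f t)}.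
    move=> /pos t0.
    have c1 : {for t, continuous riccati} by exact: riccati_continuous.
    have c2 : {for t, continuous psi} := cpsi t.
    have c3 : {for t, continuous psi'} := cpsi' t.
    have c4 := continuous_sqr c1; have c5 := continuous_sqr c2.
    have c6 := @powR_continuous_pos R (2 * s - 1) t t0.
    have c7 := @powR_continuous_pos R (1 - 2 * s) t t0.
    apply: cvgN; apply: cvgD; last by apply: cvgM => //; apply: cvgM => //; apply: cvgMr.
    apply: cvgM; last exact: c5.
    by apply: cvgB; [apply: cvgM|apply: cvgMr].
  have ftc := FTC_segment eT dF cf.
  have -> : (riccati e * psi e ^+ 2)%:E = (F T - F e)%:E.
    have -> : F T = 0 by rewrite /F psi0// expr0n mulr0 oppr0.
    by rewrite sub0r /F opprK.
  have sub : (`[e, T] : set R) `<=` `]0, +oo[%classic.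
    by move=> x /= /pos; rewrite in_itv /= andbT.
  rewrite -ftc; apply: (@le_trans _ _ (\int[mu]_(t in `[e, T]) (G t)%:E)%E); last first.
    apply: ge0_subset_integral => //; first exact/measurable_EFinP.
    by move=> x _; rewrite lee_fin.
  have cG : {within `[e, T], continuous G}.
    apply: continuous_in_subspaceT => t /set_mem /= /pos t0.
    apply: cvgM; first exact: powR_continuous_pos.
    have c1 := continuous_sqr (cpsi t); have c2 := continuous_sqr (cpsi' t).
    by apply: cvgD; [exact: c2|apply: cvgMr; exact: c1].
  have cf' : {within `[e, T], continuous (fun t => - f t)}.
    by apply: continuous_in_subspaceT => t /set_mem /= h; exact: cf.
  apply: le_integral => //.
  - exact: continuous_compact_integrable (@segment_compact _ _ _) cf'.
  - exact: continuous_compact_integrable (@segment_compact _ _ _) cG.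
  move=> t /set_mem /= /pos t0; rewrite lee_fin /f /G.
  (* Completing the square: t^(1-2s) (psi' + t^(2s-1) a psi)^2 equals the integrand [G] plus the
     derivative of a psi^2, where a is [riccati]. *)
  have := sqr_ge0 (psi' t + t `^ (2 * s - 1) * riccati t * psi t).
  have p2 : 0 < t `^ (1 - 2 * s) by exact: powR_gt0.
  have -> : t `^ (2 * s - 1) = (t `^ (1 - 2 * s))^-1.
    by rewrite -powRN; congr (_ `^ _); ring.
  move=> /(mulr_ge0 (ltW p2)); rewrite -subr_ge0 => h.
  rewrite -subr_ge0; apply: le_trans h _; apply: eq_imp_le.
  by rewrite subr0; field; rewrite gt_eqF.
have [->|Ifin] := eqVneq I +oo%E; first exact: leey.
have I0 : (0 <= I)%E by apply: integral_ge0 => t _; rewrite lee_fin G0.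
have If : I \is a fin_num by rewrite ge0_fin_numE// ltey.
rewrite -(fineK If) lee_fin -riccati0.
have c : riccati e * psi e ^+ 2 @[e --> 0^'+] --> riccati 0 * psi 0 ^+ 2.
  apply: cvg_at_right_filter; apply: cvgM; first exact: riccati_continuous.
  exact: (continuous_sqr (cpsi 0)).
rewrite -(cvg_lim (@Rhausdorff R) c); apply: limr_le; first by apply/cvg_ex; eexists; exact: c.
near=> e; rewrite -lee_fin fineK//; apply: key; apply/andP; split; near: e.
  exact: nbhs_right_gt.
exact: nbhs_right_lt.
Unshelve. all: by end_near. Qed.

End one_dimensional_trace.

(** * Rellich's theorem *)

Section slices.
Context {R : realType}.

Lemma consrV_l n (z : R * 'rV[R]_n) i (k : 'I_1) : consrV z i (lshift n k) = z.1.
Proof. by rewrite /consrV (@row_mxEl _ 1 1 n) mxE !ord1 eqxx. Qed.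

Lemma consrV_r n (z : R * 'rV[R]_n) i k : consrV z i (rshift 1 k) = z.2 ord0 k.
Proof. by rewrite /consrV (@row_mxEr _ 1 1 n) ord1. Qed.

Lemma ball_consrV n (t t' : R) (x y : 'rV[R]_n) e : ball t e t' -> ball x e y ->
  ball (consrV (t, x)) e (consrV (t', y)).
Proof.
move=> tt [e0 xy]; split=> // i j; case: (@split_ordP 1 n j) => k ->.
  by rewrite !consrV_l.
by rewrite !consrV_r; exact: xy.
Qed.

Lemma consrV_continuous_l n (x : 'rV[R]_n) : continuous (fun t : R => consrV (t, x)).
Proof.
move=> t P /nbhs_ballP[e /= e0 eP]; apply/nbhs_ballP; exists e => // t' tt.
by apply: eP; apply: ball_consrV => //; exact: ballxx.
Qed.

Lemma consrV_continuous_r n (t : R) : continuous (fun x : 'rV[R]_n => consrV (t, x)).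
Proof.
move=> x P /nbhs_ballP[e /= e0 eP]; apply/nbhs_ballP; exists e => // y xy.
by apply: eP; apply: ball_consrV => //; exact: ballxx.
Qed.

Lemma consrV_lin_l n (x : 'rV[R]_n) (h v t : R) :
  consrV (h *: v + t, x) = h *: consrV (v, 0) + consrV (t, x).
Proof.
apply/rowP => j; case: (@split_ordP 1 n j) => k ->;
  rewrite [RHS]mxE [X in _ = X + _]mxE.
  by rewrite !consrV_l.
by rewrite !consrV_r /= mxE mulr0 add0r.
Qed.

Lemma consrV_lin_r n (t h : R) (v x : 'rV[R]_n) :
  consrV (t, h *: v + x) = h *: consrV (0, v) + consrV (t, x).
Proof.
apply/rowP => j; case: (@split_ordP 1 n j) => k ->;
  rewrite [RHS]mxE [X in _ = X + _]mxE.
  by rewrite !consrV_l mulr0 add0r.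
by rewrite !consrV_r /= !mxE.
Qed.

Lemma consrV_delta0 n : consrV (1, 0 : 'rV[R]_n) = delta_mx ord0 ord0.
Proof.
apply/rowP => j; rewrite [RHS]mxE; case: (@split_ordP 1 n j) => k ->.
  by rewrite consrV_l [k]ord1 -(inj_eq val_inj).
by rewrite consrV_r /= mxE.
Qed.

Lemma consrV_delta n (i : 'I_n) :
  consrV (0, delta_mx ord0 i) = delta_mx ord0 (lift ord0 i) :> 'rV[R]_n.+1.
Proof.
apply/rowP => j; rewrite [RHS]mxE; case: (@split_ordP 1 n j) => k ->.
  by rewrite consrV_l /= -(inj_eq val_inj) /= ord1.
by rewrite consrV_r /= mxE -!(inj_eq val_inj) /= eqSS.
Qed.

Lemma smooth_slice n (f : 'rV[R]_n.+1 -> R) t : smooth f ->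
  smooth (fun x : 'rV[R]_n => f (consrV (t, x))).
Proof.
exact: (@smooth_affine R 'rV[R]_n.+1 'rV[R]_n (fun x => consrV (t, x)) (fun v => consrV (0, v))
  (@consrV_lin_r n t) (@consrV_continuous_r n t) f).
Qed.

Lemma smooth_line n (f : 'rV[R]_n.+1 -> R) (x : 'rV[R]_n) : smooth f ->
  smooth (fun t : R => f (consrV (t, x))).
Proof.
exact: (@smooth_affine R 'rV[R]_n.+1 R (fun t => consrV (t, x)) (fun v => consrV (v, 0))
  (@consrV_lin_l n x) (@consrV_continuous_l n x) f).
Qed.

Lemma derive_line_consrV n (f : 'rV[R]_n.+1 -> R) (x : 'rV[R]_n) (t : R) :
  'D_1 (fun t : R => f (consrV (t, x))) t = gradx f (consrV (t, x)) ord0 ord0.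
Proof.
by rewrite mxE -consrV_delta0; exact: (@derive_affine R 'rV[R]_n.+1 R (fun t => consrV (t, x)) (fun v => consrV (v, 0))
  (@consrV_lin_l n x) f).
Qed.

Lemma gradx_slice n (f : 'rV[R]_n.+1 -> R) t (x : 'rV[R]_n) i :
  gradx (fun x : 'rV[R]_n => f (consrV (t, x))) x ord0 i =
  gradx f (consrV (t, x)) ord0 (lift ord0 i).
Proof.
by rewrite !mxE -consrV_delta; exact: (@derive_affine R 'rV[R]_n.+1 'rV[R]_n (fun x => consrV (t, x)) (fun v => consrV (0, v))
  (@consrV_lin_r n t) f).
Qed.

Lemma dotx_gradx_slice n (f : 'rV[R]_n.+1 -> R) t (x : 'rV[R]_n) :
  dotx (gradx f (consrV (t, x))) (gradx f (consrV (t, x))) =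
  gradx f (consrV (t, x)) ord0 ord0 ^+ 2 +
  dotx (gradx (fun x : 'rV[R]_n => f (consrV (t, x))) x)
       (gradx (fun x : 'rV[R]_n => f (consrV (t, x))) x).
Proof.
by rewrite /dotx big_ord_recl -expr2; congr (_ + _); apply: eq_bigr => i _; rewrite gradx_slice.
Qed.

Lemma gradx_continuous n (f : 'rV[R]_n -> R) i : smooth f ->
  continuous (fun x => gradx f x ord0 i).
Proof.
move=> /(smooth_derive (delta_mx ord0 i)) /smooth_continuous.
suff -> : (fun x => gradx f x ord0 i) = 'D_(delta_mx ord0 i) f by [].
by apply/funext => x; rewrite mxE.
Qed.

Lemma measurable_gradx n (f : 'rV[R]_n -> R) D : measurable D -> smooth f ->
  measurable_fun D (gradx f).
Proof.
by move=> mD sf; apply: measurable_rVP => // i; apply: continuous_measurable_rV; exact: gradx_continuous.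
Qed.

(** This is the Cauchy-Schwarz bound for the increment, obtained from the pointwise inequality u'^2
    >= 2 q u' - q^2 with q the mean slope: integrating the right-hand side gives q^2 (t - t'). *)
Lemma line_increment (u u' : R -> R) (t t' h : R) :
  (forall r : R, is_derive r 1 u (u' r)) -> continuous u' -> `|t - t'| <= h ->
  (((u t - u t') ^+ 2)%:E <= h%:E * \int[lebesgue_measure]_r (u' r ^+ 2)%:E)%E.
Proof.
move=> du cu'.
wlog lt : t t' / t' < t.
  move=> H; have [tt|tt|->] := ltgtP t t' => hh.
  - by rewrite -sqrrN opprB; apply: H => //; rewrite distrC.
  - exact: H.
  rewrite subrr expr0n /=; apply: mule_ge0; last by apply: integral_ge0 => r _; rewrite lee_fin sqr_ge0.
  by rewrite lee_fin (le_trans _ hh).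
rewrite ger0_norm; last by rewrite subr_ge0 ltW.
move=> tth.
have L0 : 0 < t - t' by rewrite subr_gt0.
pose q := (u t - u t') / (t - t').
have ftc := @FTC_segment R (fun r => 2 * q * u' r - q ^+ 2) (fun r => 2 * q * u r - q ^+ 2 * r) t' t lt.
have E : (((u t - u t') ^+ 2 / (t - t'))%:E <= \int[lebesgue_measure]_r (u' r ^+ 2)%:E)%E.
  have cq (x : R) : {for x, continuous (fun r => 2 * q * u' r - q ^+ 2)}.
    by apply: cvgB; [apply: cvgMr; exact: cu'|exact: cvg_cst].
  have dq (x : R) : is_derive x 1 (fun r : R => 2 * q * u r - q ^+ 2 * r) (2 * q * u' x - q ^+ 2).
    have d1 := is_deriveZ (2 * q) (du x).
    have d2 : is_derive x 1 (fun r : R => q ^+ 2 * r) (q ^+ 2).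
      by apply: is_derive_eq; rewrite /GRing.scale /= mulr1.
    by apply: (is_derive_congr (is_deriveB d1 d2)).
  have -> : ((u t - u t') ^+ 2 / (t - t'))%:E =
      (\int[lebesgue_measure]_(r in `[t', t]) (2 * q * u' r - q ^+ 2)%:E)%E.
    have -> := ftc (fun x _ => dq x) (fun x _ => cq x).
    by congr EFin; rewrite /q; field; rewrite gt_eqF.
  apply: (@le_trans _ _ (\int[lebesgue_measure]_(r in `[t', t]) (u' r ^+ 2)%:E)%E); last first.
    apply: ge0_subset_integral => //; last by move=> x _; rewrite lee_fin sqr_ge0.
    by apply/measurable_EFinP/measurable_funX; exact: continuous_measurable_fun.
  apply: le_integral => //.
  - apply: continuous_compact_integrable; first exact: segment_compact.
    by apply: continuous_subspaceT => x; exact: cq.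
  - apply: continuous_compact_integrable; first exact: segment_compact.
    by apply: continuous_subspaceT => x; exact: (continuous_sqr (cu' x)).
  by move=> x _; rewrite lee_fin; have := sqr_ge0 (u' x - q); rewrite sqrrB; lra.
apply: (@le_trans _ _ ((t - t')%:E * ((u t - u t') ^+ 2 / (t - t'))%:E)%E).
  by rewrite -EFinM lee_fin mulrC divfK// gt_eqF.
apply: (@le_trans _ _ ((t - t')%:E * \int[lebesgue_measure]_r (u' r ^+ 2)%:E)%E).
  by rewrite lee_pmul2l// lte_fin.
rewrite lee_wpmul2r ?lee_fin//; apply: integral_ge0 => r _; rewrite lee_fin sqr_ge0//.
Qed.

Lemma integral_itv_support (M : R) (F : R -> \bar R) :
  (forall t, M <= `|t| -> F t = 0%E) ->
  (\int[lebesgue_measure]_t F t = \int[lebesgue_measure]_(t in `](- M)%R, M[) F t)%E.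
Proof.
move=> F0; rewrite [RHS]integral_mkcond; apply: eq_integral => t _.
rewrite patchE; case: ifPn => // tM; apply: F0.
by rewrite leNgt; apply: contra tM => tM; rewrite mem_set//= in_itv/= -ltr_norml.
Qed.

End slices.

Section precompactness.
Context {R : realType}.

Definition H1sq n (f : 'rV[R]_n -> R) : \bar R :=
  (\int[lebesgue_rV R n]_x (f x ^+ 2 + dotx (gradx f x) (gradx f x))%:E)%E.

Definition dirichlet_energy n (f : 'rV[R]_n -> R) : \bar R :=
  (\int[lebesgue_rV R n]_x (dotx (gradx f x) (gradx f x))%:E)%E.

Definition H1_bounded n (M B : R) (f : 'rV[R]_n -> R) : Prop :=
  [/\ smooth f, (forall (x : 'rV[R]_n) i, M <= `|x ord0 i| -> f x = 0) & (H1sq f <= B%:E)%E].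

Lemma H1_density_ge0 n (f : 'rV[R]_n -> R) x : 0 <= f x ^+ 2 + dotx (gradx f x) (gradx f x).
Proof. by rewrite addr_ge0 ?sqr_ge0 ?dotx_ge0. Qed.

Lemma measurable_H1_density n (f : 'rV[R]_n -> R) D : measurable D -> smooth f ->
  measurable_fun D (fun x => f x ^+ 2 + dotx (gradx f x) (gradx f x)).
Proof.
move=> mD sf; apply: measurable_funD.
  by apply: measurable_funX; apply: continuous_measurable_rV; exact: smooth_continuous.
by apply: measurable_dotx; exact: measurable_gradx.
Qed.

(** The H^1 density of the slices, written as one function on the whole space so that measurability
    in the first variable follows from Tonelli's theorem. *)
Definition tail_density n (f : 'rV[R]_n.+1 -> R) (z : 'rV[R]_n.+1) : R :=
  f z ^+ 2 + \sum_(i < n) gradx f z ord0 (lift ord0 i) ^+ 2.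

Lemma tail_density_ge0 n (f : 'rV[R]_n.+1 -> R) z : 0 <= tail_density f z.
Proof. by rewrite addr_ge0 ?sqr_ge0// sumr_ge0// => i _; rewrite sqr_ge0. Qed.

Lemma measurable_tail_density n (f : 'rV[R]_n.+1 -> R) : smooth f ->
  measurable_fun setT (fun z => (tail_density f z)%:E).
Proof.
move=> sf; apply/measurable_EFinP; apply: measurable_funD.
  by apply: measurable_funX; apply: continuous_measurable_rV; exact: smooth_continuous.
apply: measurable_sum => i; apply: measurable_funX; apply: continuous_measurable_rV.
exact: gradx_continuous.
Qed.

Lemma H1sq_sliceE n (f : 'rV[R]_n.+1 -> R) (t : R) :
  H1sq (fun x : 'rV[R]_n => f (consrV (t, x))) =
  (\int[lebesgue_rV R n]_x (tail_density f (consrV (t, x)))%:E)%E.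
Proof.
apply: eq_integral => x _; congr (_ + _)%:E.
by apply: eq_bigr => i _; rewrite gradx_slice expr2.
Qed.

Lemma measurable_H1sq_slice n (f : 'rV[R]_n.+1 -> R) D : smooth f -> measurable D ->
  measurable_fun (D : set R) (fun t : R => H1sq (fun x : 'rV[R]_n => f (consrV (t, x)))).
Proof.
move=> sf mD; apply: measurable_funTS; under eq_fun do rewrite H1sq_sliceE.
apply: (@measurable_slice_integral R n (fun z => (tail_density f z)%:E)).
  exact: measurable_tail_density.
by move=> z; rewrite lee_fin tail_density_ge0.
Qed.

Lemma H1sq_ge0 n (f : 'rV[R]_n -> R) : (0 <= H1sq f)%E.
Proof. by apply: integral_ge0 => x _; rewrite lee_fin H1_density_ge0. Qed.

Lemma H1sq_slices n (f : 'rV[R]_n.+1 -> R) : smooth f ->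
  (\int[lebesgue_measure]_t H1sq (fun x : 'rV[R]_n => f (consrV (t, x))) <= H1sq f)%E.
Proof.
move=> sf.
have mf : measurable_fun setT (fun x => (f x ^+ 2 + dotx (gradx f x) (gradx f x))%:E).
  by apply/measurable_EFinP; exact: measurable_H1_density.
rewrite {2}/H1sq integral_rV_succ//; last by move=> x; rewrite lee_fin H1_density_ge0.
apply: ge0_le_integral => //.
- by move=> t _; exact: H1sq_ge0.
- exact: measurable_H1sq_slice.
- by apply: (measurable_slice_integral mf) => x; rewrite lee_fin H1_density_ge0.
move=> t _; apply: ge0_le_integral => //.
- by move=> x _; rewrite lee_fin H1_density_ge0.
- by apply/measurable_EFinP; apply: measurable_H1_density => //; exact: smooth_slice.
- exact: (measurable_slice t mf).
by move=> x _; rewrite lee_fin lerD2l dotx_gradx_slice lerDr sqr_ge0.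
Qed.

(* Chebyshev's inequality in the first variable. *)
Lemma good_slice n (M B a h : R) (f : 'rV[R]_n.+1 -> R) : 0 < B -> 0 < h ->
  H1_bounded M B f ->
  exists2 t, a <= t <= a + h &
    H1_bounded M (2 * B / h) (fun x : 'rV[R]_n => f (consrV (t, x))).
Proof.
move=> B0 h0 [sf f0 fB]; apply: contrapT => H.
have lb t : a <= t <= a + h -> ((2 * B / h)%:E <= H1sq (fun x : 'rV[R]_n => f (consrV (t, x))))%E.
  move=> at_; rewrite leNgt; apply/negP => hlt; apply: H; exists t => //; split.
  - exact: smooth_slice.
  - by move=> x i Mx; apply: (f0 _ (rshift 1 i)); rewrite consrV_r.
  - exact: ltW.
have := le_trans (H1sq_slices sf) fB; apply/negP; rewrite -ltNge.
apply: (@lt_le_trans _ _ (2 * B)%:E); first by rewrite lte_fin; lra.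
apply: (@le_trans _ _ (\int[lebesgue_measure]_(t in `[a, (a + h)%R]) (2 * B / h)%:E)%E).
  rewrite integral_cst//= lebesgue_measure_itv /= lte_fin ltrDl h0.
  by rewrite -EFinB -EFinM lee_fin addrC addKr divfK// gt_eqF.
apply: (@le_trans _ _ (\int[lebesgue_measure]_(t in `[a, (a + h)%R])
    H1sq (fun x : 'rV[R]_n => f (consrV (t, x))))%E).
  apply: ge0_le_integral => //.
  - by move=> t _; rewrite lee_fin divr_ge0 ?(ltW h0)// mulr_ge0// ltW.
  - exact: measurable_H1sq_slice.
apply: ge0_subset_integral => //; first exact: measurable_H1sq_slice.
by move=> t _; exact: H1sq_ge0.
Qed.

Lemma slice_increment n (f : 'rV[R]_n.+1 -> R) (t t' h : R) : smooth f ->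
  `|t - t'| <= h ->
  (\int[lebesgue_rV R n]_x ((f (consrV (t, x)) - f (consrV (t', x))) ^+ 2)%:E
   <= h%:E * dirichlet_energy f)%E.
Proof.
move=> sf tt; have h0 : 0 <= h := le_trans (normr_ge0 _) tt.
pose G (z : 'rV[R]_n.+1) := (gradx f z ord0 ord0 ^+ 2)%:E.
have G0 z : (0 <= G z)%E by rewrite lee_fin sqr_ge0.
have mG : measurable_fun setT G.
  apply/measurable_EFinP/measurable_funX; apply: continuous_measurable_rV.
  exact: gradx_continuous.
have mGc : measurable_fun [set: (measurableTypeR R * 'rV[R]_n)%type] (G \o @consrV R n).
  by apply: measurableT_comp => //; exact: measurable_consrV.
have cs (r : R) : continuous (fun x : 'rV[R]_n => f (consrV (r, x))).
  exact: smooth_continuous (smooth_slice r sf).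
have mI : measurable_fun setT (fun x : 'rV[R]_n => \int[lebesgue_measure]_r G (consrV (r, x)))%E.
  exact: (@measurable_fun_fubini_tonelli_G _ _ _ _ _ lebesgue_measure (G \o @consrV R n) mGc (fun z => G0 _)).
apply: (@le_trans _ _ (\int[lebesgue_rV R n]_x (h%:E * \int[lebesgue_measure]_r G (consrV (r, x))))%E).
  apply: ge0_le_integral => //.
  - by move=> x _; rewrite lee_fin sqr_ge0.
  - apply/measurable_EFinP/measurable_funX/measurable_funB; exact: continuous_measurable_rV.
  - exact: measurable_funeM.
  move=> x _; pose u r := f (consrV (r, x)).
  have su : smooth u by exact: smooth_line.
  have du (r : R) : is_derive r 1 u (gradx f (consrV (r, x)) ord0 ord0).
    by split; [exact: smooth_derivable|exact: derive_line_consrV].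
  have cu : continuous (fun r : R => gradx f (consrV (r, x)) ord0 ord0).
    have := smooth_continuous (smooth_derive (1 : R) su).
    suff -> : 'D_1 u = (fun r : R => gradx f (consrV (r, x)) ord0 ord0) by [].
    by apply/funext => r; exact: derive_line_consrV.
  exact: line_increment du cu tt.
rewrite ge0_integralZl//; last by move=> x _; apply: integral_ge0.
apply: lee_wpmul2l; first by rewrite lee_fin.
have FT := @fubini_tonelli _ _ _ _ R lebesgue_measure (lebesgue_rV R n) (G \o @consrV R n) mGc (fun z => G0 _).
rewrite (_ : (\int[lebesgue_rV R n]_x _)%E = (\int[lebesgue_measure]_r \int[lebesgue_rV R n]_x G (consrV (r, x)))%E);
  last exact: esym FT.
have mf : measurable_fun setT (fun x => (dotx (gradx f x) (gradx f x))%:E).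
  by apply/measurable_EFinP/measurable_dotx => //; exact: measurable_gradx.
rewrite /dirichlet_energy integral_rV_succ//; last by move=> x; rewrite lee_fin dotx_ge0.
apply: ge0_le_integral => //.
- by move=> r _; apply: integral_ge0.
- exact: (measurable_slice_integral mG).
- by apply: (measurable_slice_integral mf) => x; rewrite lee_fin dotx_ge0.
move=> r _; apply: ge0_le_integral => //.
- exact: (measurable_slice r mG).
- exact: (measurable_slice r mf).
by move=> x _; rewrite lee_fin dotx_gradx_slice lerDl dotx_ge0.
Qed.

Lemma dirichlet_energy_le_H1sq n (f : 'rV[R]_n -> R) : smooth f ->
  (dirichlet_energy f <= H1sq f)%E.
Proof.
move=> sf; apply: ge0_le_integral => //.
- by move=> x _; rewrite lee_fin dotx_ge0.
- by apply/measurable_EFinP/measurable_dotx => //; exact: measurable_gradx.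
- by apply/measurable_EFinP; exact: measurable_H1_density.
by move=> x _; rewrite lee_fin lerDr sqr_ge0.
Qed.

(** The slice at t = -M vanishes, so [slice_increment] from there bounds each slice by 2M times the
    energy; integrating over an interval of length 2M gives 4 M^2. *)
Lemma poincare_box n (M : R) (f : 'rV[R]_n.+1 -> R) : 0 < M -> smooth f ->
  (forall (x : 'rV[R]_n.+1) i, M <= `|x ord0 i| -> f x = 0) ->
  (\int[lebesgue_rV R n.+1]_x (f x ^+ 2)%:E <= (4 * M ^+ 2)%:E * dirichlet_energy f)%E.
Proof.
move=> M0 sf f0.
have m2 : measurable_fun setT (fun z => (f z ^+ 2)%:E).
  by apply/measurable_EFinP/measurable_funX; apply: continuous_measurable_rV; exact: smooth_continuous.
have E0 : (0 <= dirichlet_energy f)%E by apply: integral_ge0 => x _; rewrite lee_fin dotx_ge0.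
have p2 z : (0 <= (f z ^+ 2)%:E)%E by rewrite lee_fin sqr_ge0.
have out (t : R) (x : 'rV[R]_n) : M <= `|t| -> f (consrV (t, x)) = 0.
  by move=> Mt; apply: (f0 _ (@lshift 1 n ord0)); rewrite consrV_l.
rewrite integral_rV_succ//.
have mI : measurable_fun [set: R] (fun t : R => \int[lebesgue_rV R n]_x (f (consrV (t, x)) ^+ 2)%:E)%E.
  exact: (measurable_slice_integral m2).
rewrite (integral_itv_support (M := M)); last first.
  by move=> t Mt; rewrite integral0_eq// => x _; rewrite out ?expr0n.
apply: (@le_trans _ _ (\int[lebesgue_measure]_(t in `](- M)%R, M[) ((2 * M)%:E * dirichlet_energy f))%E).
  apply: ge0_le_integral => //.
  - by move=> t _; apply: integral_ge0.
  - exact: measurable_funTS.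
  move=> t /=; rewrite in_itv/= => /andP[tM1 tM2].
  have := @slice_increment n f t (- M) (2 * M) sf.
  rewrite opprK ger0_norm; last by lra.
  move=> /(_ ltac:(lra)); apply: le_trans; apply: eq_imp_le.
  by apply: eq_integral => x _; rewrite (@out (- M)) ?subr0// normrN ger0_norm// ltW.
rewrite integral_cst//= lebesgue_measure_itv /= lte_fin gtrN// -EFinB muleAC -EFinM.
by rewrite (_ : 2 * M * (M - - M) = 4 * M ^+ 2)//; ring.
Qed.

End precompactness.

Section compactness.
Context {R : realType}.

(** Total boundedness is expressed by a colouring with finitely many colours whose classes have
    small diameter. No centres have to be chosen, and finitely many colours combine into one through
    a finite function type, as the induction for Rellich's theorem requires. *)
Lemma real_coloring (b e : R) : 0 < e -> exists (I : finType) (c : R -> I),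
  forall x y, `|x| <= b -> `|y| <= b -> c x = c y -> `|x - y| <= e.
Proof.
move=> e0; pose N := Num.truncn ((b + b) / e).
exists 'I_N.+1, (fun x => inord (Num.truncn ((x + b) / e))) => x y.
wlog xy : x y / x <= y.
  move=> H xb yb cxy; have [xy|/ltW xy] := leP x y; first exact: H.
  by rewrite distrC; apply: H.
have lt z : `|z| <= b -> 0 <= (z + b) / e /\ (Num.truncn ((z + b) / e) < N.+1)%N.
  rewrite ler_norml => /andP[bz zb]; split; first by rewrite divr_ge0 ?(ltW e0)//; lra.
  by rewrite ltnS le_truncn// ler_pM2r ?invr_gt0// lerD2r.
move=> /lt[x0 xN] /lt[y0 yN] /(congr1 val); rewrite /= !inordK// => E.
have /andP[h1 _] := truncn_itv x0; have /andP[_ h2] := truncn_itv y0.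
rewrite -E in h2; rewrite distrC ger0_norm ?subr_ge0//.
have : (y + b) / e - (x + b) / e <= 1.
  by rewrite -natr1 in h2; lra.
by rewrite -mulrBl ler_pdivrMr// mul1r; lra.
Qed.

Lemma integral_sq_le3 n (f a b g : 'rV[R]_n -> R) (A B C : R) :
  continuous f -> continuous a -> continuous b -> continuous g ->
  (\int[lebesgue_rV R n]_x ((f x - a x) ^+ 2)%:E <= A%:E)%E ->
  (\int[lebesgue_rV R n]_x ((a x - b x) ^+ 2)%:E <= B%:E)%E ->
  (\int[lebesgue_rV R n]_x ((b x - g x) ^+ 2)%:E <= C%:E)%E ->
  (\int[lebesgue_rV R n]_x ((f x - g x) ^+ 2)%:E <= (3 * (A + B + C))%:E)%E.
Proof.
move=> cf ca cb cg fa ab bg.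
have m2 (u v : 'rV[R]_n -> R) : continuous u -> continuous v ->
    measurable_fun setT (fun x => ((u x - v x) ^+ 2)%:E).
  by move=> cu cv; apply/measurable_EFinP/measurable_funX/measurable_funB; exact: continuous_measurable_rV.
have p2 (u v : 'rV[R]_n -> R) x : setT x -> (0 <= ((u x - v x) ^+ 2)%:E)%E.
  by move=> _; rewrite lee_fin sqr_ge0.
apply: (@le_trans _ _ (\int[lebesgue_rV R n]_x (3%:E * (((f x - a x) ^+ 2)%:E +
   ((a x - b x) ^+ 2)%:E + ((b x - g x) ^+ 2)%:E)))%E).
  apply: ge0_le_integral => //; [exact: p2|exact: m2| |].
    by apply: measurable_funeM; apply: emeasurable_funD; [apply: emeasurable_funD|]; exact: m2.
  move=> x _; rewrite -!EFinD -EFinM lee_fin.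
  have -> : f x - g x = (f x - a x) + (a x - b x) + (b x - g x) by ring.
  set p := f x - a x; set q := a x - b x; set r := b x - g x.
  have := sqr_ge0 (p - q); have := sqr_ge0 (q - r); have := sqr_ge0 (p - r).
  by rewrite -[_ <= 3 * _]subr_ge0 => h1 h2 h3; have := addr_ge0 h1 (addr_ge0 h2 h3); congr (0 <= _); ring.
rewrite ge0_integralZl//; last 2 first.
- by apply: emeasurable_funD; [apply: emeasurable_funD|]; exact: m2.
- by move=> x _; rewrite -!EFinD lee_fin !addr_ge0// sqr_ge0.
rewrite ge0_integralD//; last 4 first.
- by move=> x _; rewrite -!EFinD lee_fin !addr_ge0// sqr_ge0.
- by apply: emeasurable_funD; exact: m2.
- exact: p2.
- exact: m2.
rewrite ge0_integralD//; [|exact: p2|exact: m2|exact: p2|exact: m2].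
by rewrite EFinM lee_pmul2l// !EFinD leeD// leeD.
Qed.

(* Rellich's theorem as total boundedness, by induction on the dimension: the
   colour of f records the colours of one slice of small H^1 norm in each of
   finitely many short intervals of the first variable. *)
Lemma H1_precompact n (M B e : R) : 0 < M -> 0 < B -> 0 < e ->
  exists (I : finType) (c : ('rV[R]_n -> R) -> I),
    forall f g, H1_bounded M B f -> H1_bounded M B g -> c f = c g ->
    (\int[lebesgue_rV R n]_x ((f x - g x) ^+ 2)%:E <= e%:E)%E.
Proof.
move=> M0; elim: n B e => [|n IH] B e B0 e0.
  have se0 : 0 < Num.sqrt e by rewrite sqrtr_gt0.
  (* In dimension 0 the measure is a Dirac mass, so f(0)^2 <= B and |f(0)| <= B + 1; colouring the
     value at 0 suffices. *)
  have [I [c cP]] := real_coloring (B + 1) se0.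
  have val f : H1_bounded M B f -> `|f (0 : 'rV[R]_0)| <= B + 1.
    move=> [sf _]; rewrite /H1sq /= integral_dirac//; last first.
      by apply/measurable_EFinP; exact: (@measurable_H1_density _ 0).
    rewrite diracT mul1e lee_fin => h.
    have {h} h : f 0 ^+ 2 <= B by rewrite (le_trans _ h)// lerDl dotx_ge0.
    rewrite -[leLHS]ger0_norm// -ler_sqr ?nnegrE//; last by lra.
    by rewrite ger0_norm// real_normK ?num_real//; nra.
  exists I, (fun f => c (f 0)) => f g fB gB /cP h.
  have [sf _ _] := fB; have [sg _ _] := gB.
  rewrite /= integral_dirac//; last first.
    apply/measurable_EFinP/measurable_funX/measurable_funB;
      by apply: (@continuous_measurable_rV R 0); exact: smooth_continuous.
  rewrite diracT mul1e lee_fin -real_normK ?num_real//.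
  by rewrite -(@sqr_sqrtr _ e) ?(ltW e0)// ler_sqr ?nnegrE ?sqrtr_ge0//; apply: h; exact: val.
(* The interval [-M, M] is cut into [k] pieces of length [h], with [k] so large that 24 M B h <= e.
   For t in a piece, going from f to g through two chosen slices costs 3 (h B + e/(12 M) + h B) <=
   e/(2M), and integrating over |t| < M yields e. *)
pose k := (Num.truncn (48 * M ^+ 2 * B / e)).+1; pose h := 2 * M / k%:R.
have k0 : (0 : R) < k%:R by rewrite ltr0n.
have h0 : 0 < h by rewrite divr_gt0// mulr_gt0.
have hB : 24 * M * B * h <= e.
  have /andP[_] : (Num.truncn (48 * M ^+ 2 * B / e))%:R <= 48 * M ^+ 2 * B / e < k%:R.
    by apply: truncn_itv; rewrite divr_ge0 ?(ltW e0)// !mulr_ge0 ?sqr_ge0// ltW.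
  rewrite ltr_pdivrMr// => /ltW.
  rewrite [X in _ <= X -> _]mulrC -ler_pdivrMr//; congr (_ <= _).
  by rewrite /h; field; rewrite gt_eqF.
have B'0 : 0 < 2 * B / h by rewrite divr_gt0// mulr_gt0.
have e'0 : 0 < e / (12 * M) by rewrite divr_gt0// mulr_gt0.
have [I [c cP]] := IH _ _ B'0 e'0.
(* [tau] selects for each function and piece a slice of small H^1 norm; outside the H^1 ball its
   value 0 is arbitrary. *)
have /choice[tau tauP] (p : ('rV[R]_n.+1 -> R) * 'I_k) : exists t : R, H1_bounded M B p.1 ->
    - M + p.2%:R * h <= t <= - M + p.2%:R * h + h /\
    H1_bounded M (2 * B / h) (fun x : 'rV[R]_n => p.1 (consrV (t, x))).
  have [fB|] := pselect (H1_bounded M B p.1); last by move=> nB; exists 0.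
  by have [t h1 h2] := @good_slice _ n M B (- M + p.2%:R * h) h p.1 B0 h0 fB; exists t.
exists {ffun 'I_k -> I}, (fun f => [ffun j => c (fun x => f (consrV (tau (f, j), x)))]).
move=> f g fB gB /ffunP cfg; have [sf f0 fH] := fB; have [sg g0 gH] := gB.
have m2 : measurable_fun setT (fun z => ((f z - g z) ^+ 2)%:E).
  by apply/measurable_EFinP/measurable_funX/measurable_funB;
    apply: continuous_measurable_rV; exact: smooth_continuous.
have p2 z : (0 <= ((f z - g z) ^+ 2)%:E)%E by rewrite lee_fin sqr_ge0.
rewrite integral_rV_succ//.
have bnd (t : R) : `|t| < M ->
    (\int[lebesgue_rV R n]_x ((f (consrV (t, x)) - g (consrV (t, x))) ^+ 2)%:E <=
     (e / (2 * M))%:E)%E.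
  rewrite ltr_norml => /andP[tM1 tM2].
  have th0 : 0 <= (t + M) / h by rewrite divr_ge0 ?(ltW h0)//; lra.
  have /andP[t1 t2] := truncn_itv th0.
  have jk : (Num.truncn ((t + M) / h) < k)%N.
    rewrite truncn_lt_nat// ltr_pdivrMr// /h mulrCA mulfV ?gt_eqF// mulr1; lra.
  pose j := Ordinal jk.
  rewrite ler_pdivlMr// in t1; rewrite ltr_pdivrMr// -natr1 mulrDl mul1r in t2.
  have close u : H1_bounded M B u -> `|t - tau (u, j)| <= h.
    by move=> /(tauP (u, j))[/andP[/= u1 u2] _]; rewrite ler_norml; apply/andP; split; lra.
  have [_ /= fj] := tauP (f, j) fB; have [_ /= gj] := tauP (g, j) gB.
  have := cfg j; rewrite !ffunE => /(cP _ _ fj gj) mid.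
  have ct u r : H1_bounded M B u -> continuous (fun x : 'rV[R]_n => u (consrV (r, x))).
    by move=> [su _ _]; exact: smooth_continuous (smooth_slice r su).
  have inc u (v r : R) : H1_bounded M B u -> `|v - r| <= h ->
    (\int[lebesgue_rV R n]_x ((u (consrV (v, x)) - u (consrV (r, x))) ^+ 2)%:E <=
     (h * B)%:E)%E.
    move=> [su _ uB] vr; apply: (le_trans (slice_increment su vr)).
    rewrite (EFinM h B); apply: lee_wpmul2l; first by rewrite lee_fin ltW.
    exact: le_trans (dirichlet_energy_le_H1sq su) uB.
  apply: le_trans (integral_sq_le3 (ct f t fB) (ct f (tau (f, j)) fB) (ct g (tau (g, j)) gB)
    (ct g t gB) (inc f _ _ fB (close f fB)) mid (inc g _ _ gB _)) _.
    by rewrite distrC; exact: close.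
  rewrite lee_fin.
  have -> : e / (2 * M) = e / (4 * M) + 3 * (e / (12 * M)) by field; rewrite gt_eqF.
  have : 6 * h * B <= e / (4 * M) by rewrite ler_pdivlMr ?mulr_gt0//; lra.
  lra.
have mI : measurable_fun [set: R] (fun t : R =>
    \int[lebesgue_rV R n]_x ((f (consrV (t, x)) - g (consrV (t, x))) ^+ 2)%:E)%E.
  exact: (measurable_slice_integral m2).
rewrite (integral_itv_support (M := M)); last first.
  move=> t Mt; rewrite integral0_eq// => x _.
  have z : M <= `|consrV (t, x) ord0 (@lshift 1 n ord0)| by rewrite consrV_l.
  by rewrite (f0 _ _ z) (g0 _ _ z) subrr expr0n.
apply: (@le_trans _ _ (\int[lebesgue_measure]_(t in `](- M)%R, M[) (e / (2 * M))%:E)%E).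
  apply: ge0_le_integral => //.
  - by move=> t _; apply: integral_ge0.
  - exact: measurable_funTS.
  - by move=> t /=; rewrite in_itv/= -ltr_norml => /bnd.
rewrite integral_cst//= lebesgue_measure_itv /= lte_fin gtrN// -EFinB -EFinM lee_fin.
by rewrite (_ : e / (2 * M) * (M - - M) = e)//; field; rewrite gt_eqF.
Qed.

Lemma ultra_color (F : set_system nat) (I : finType) (c : nat -> I) : UltraFilter F ->
  exists i, F [set n | c n = i].
Proof.
move=> UF; apply: contrapT => H.
have : \forall n \near F, forall i, c n <> i.
  apply: filter_forall => i; have [h|//] := in_ultra_setVsetC [set n | c n = i] UF.
  by exfalso; apply: H; exists i.
by move=> /filter_ex[n /(_ (c n))].
Qed.

(** An ultrafilter finer than the filter at infinity selects at every scale 1/(i+1) one colour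
    class, and finitely many selected classes always meet beyond any index. Choosing [k i] in the
    first i+1 classes replaces a diagonal extraction; [k] is not claimed to be monotone. *)
Lemma cauchy_subsequence (T : Type) (d : T -> T -> \bar R) (u : nat -> T) :
  (forall e : R, 0 < e -> exists (I : finType) (c : T -> I),
     forall n m, c (u n) = c (u m) -> (d (u n) (u m) <= e%:E)%E) ->
  exists k : nat -> nat, (forall i, (i <= k i)%N) /\
    forall e : R, 0 < e -> exists N, forall i j, (N <= i)%N -> (N <= j)%N ->
      (d (u (k i)) (u (k j)) <= e%:E)%E.
Proof.
move=> tb; have [F [UF oF]] := @ultraFilterLemma nat \oo _.
have cl (i : nat) : exists A, F A /\
    forall n m, A n -> A m -> (d (u n) (u m) <= (i.+1%:R^-1 : R)%:E)%E.
  have [I [c cP]] := tb (i.+1%:R^-1 : R) ltac:(by rewrite invr_gt0).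
  have [x Fx] := ultra_color (c \o u) UF.
  by exists [set n | c (u n) = x]; split => // n m /= nx mx; apply: cP; rewrite nx mx.
have [A AP] := choice cl.
have ex i : exists n, (i <= n)%N /\ forall j, (j <= i)%N -> A j n.
  have : \forall n \near F, forall j : 'I_i.+1, A j n.
    by apply: filter_forall => j; exact: (AP j).1.
  have : F [set n | (i <= n)%N] by apply: oF; exact: nbhs_infty_ge.
  move=> /filterI h /h /filter_ex[n [ni Aj]]; exists n; split=> // j ji.
  by have := Aj (Ordinal (ji : (j < i.+1)%N)).
have [k kP] := choice ex; exists k; split=> [i|e e0]; first exact: (kP i).1.
have [N] := ltr_add_invr e0; rewrite add0r => Ne; exists N => i j Ni Nj.
apply: (@le_trans _ _ (N.+1%:R^-1 : R)%:E); last by rewrite lee_fin ltW.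
by apply: (AP N).2; [exact: (kP i).2|exact: (kP j).2].
Qed.

End compactness.

(** * The minimal Dirichlet eigenvalue and the Poincare inequality *)

Section test_functions.
Context {R : realType}.

Lemma coord_le_norm n (x : 'rV[R]_n) i : `|x ord0 i| <= `|x|.
Proof. by rewrite [leRHS]/Num.norm /= mx_normrE; exact: (le_bigmax _ _ (ord0, i)). Qed.

Lemma bounded_box n (A : set 'rV[R]_n) : bounded_set A -> exists2 M, 0 < M & A `<=` box M.
Proof.
move=> /pinfty_ex_gt0[M M0 AM]; exists (M + 1); first by rewrite addr_gt0.
move=> x Ax i; rewrite (le_lt_trans (coord_le_norm x i))// (le_lt_trans (AM x Ax))//.
by rewrite ltrDl.
Qed.

Lemma integral_compact_support_lty n (K D : set 'rV[R]_n) (F : 'rV[R]_n -> R) :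
  measurable D -> compact K -> continuous F -> (forall x, 0 <= F x) ->
  (forall x, ~ K x -> F x = 0) -> (\int[lebesgue_rV R n]_(x in D) (F x)%:E < +oo)%E.
Proof.
move=> mD cK cF F0 FK.
have mF : measurable_fun setT (EFin \o F).
  by apply/measurable_EFinP; exact: continuous_measurable_rV.
have [M M0 KM] := bounded_box (compact_bounded cK).
have /compact_bounded /pinfty_ex_gt0[C C0 FC] : compact (F @` K).
  by apply: continuous_compact => //; exact: continuous_subspaceT.
have FC' x : F x <= C.
  have [Kx|/FK ->] := pselect (K x); last exact: ltW.
  by apply: le_trans (ler_norm _) _; apply: FC; exists x.
apply: (@le_lt_trans _ _ (\int[lebesgue_rV R n]_(x in setT) (F x)%:E)%E).
  by apply: ge0_subset_integral => // x _; rewrite lee_fin.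
apply: (@le_lt_trans _ _ (\int[lebesgue_rV R n]_(x in box M) C%:E)%E).
  rewrite [leRHS]integral_mkcond; apply: ge0_le_integral => //.
  - by move=> x _; rewrite lee_fin.
  - by apply: (measurable_restrictT _ _).1 => //; exact: measurable_box.
  move=> x _; rewrite patchE; case: ifPn => [_|xM]; first by rewrite lee_fin.
  rewrite FK// => /KM xM'; by rewrite mem_set in xM.
rewrite integral_cst; last exact: measurable_box.
by rewrite lte_mul_pinfty ?lee_fin ?(ltW C0)//; exact: lebesgue_box_lty.
Qed.

Lemma test_function_lin (V : normedModType R) (U : set V) (f g : V -> R) a :
  test_function U f -> test_function U g -> test_function U (fun x => f x + a * g x).
Proof.
move=> [sf [K [cK KU fK]]] [sg [L [cL LU gL]]]; split; first exact: smooth_lin.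
exists (K `|` L); split; [exact: compactU|by move=> x [/KU|/LU]|].
by move=> x nKL; rewrite fK ?gL ?mulr0 ?addr0// => ?; apply: nKL; [right|left].
Qed.

Lemma gradx_lin n (f g : 'rV[R]_n -> R) a x : smooth f -> smooth g ->
  gradx (fun x => f x + a * g x) x = gradx f x + a *: gradx g x.
Proof.
move=> sf sg; apply/rowP => i; rewrite !mxE derive_lin//; exact: smooth_derivable.
Qed.

Lemma gradx_compact_support n (K : set 'rV[R]_n) (f : 'rV[R]_n -> R) x : compact K ->
  (forall x, ~ K x -> f x = 0) -> ~ K x -> gradx f x = 0.
Proof.
move=> cK fK nKx; apply/rowP => i; rewrite !mxE.
transitivity ('D_(delta_mx ord0 i) (fun _ : 'rV[R]_n => 0 : R) x); last by rewrite derive_cst.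
apply: near_eq_derive; have : nbhs x (~` K).
  apply: open_nbhs_nbhs; split => //; apply: closed_openC; exact: compact_closed.
by apply: filterS => y /fK.
Qed.

Lemma dotx0 n (v : 'rV[R]_n) : dotx 0 v = 0.
Proof. by rewrite /dotx big1// => i _; rewrite mxE mul0r. Qed.

Lemma dotx_sq_continuous n (f : 'rV[R]_n -> R) : smooth f ->
  continuous (fun x => dotx (gradx f x) (gradx f x)).
Proof.
move=> sf; suff : forall s : seq 'I_n,
    continuous (fun x => \sum_(i <- s) gradx f x ord0 i * gradx f x ord0 i) by exact.
elim=> [|i s IH] x.
  by under eq_fun do rewrite big_nil; exact: cst_continuous.
under eq_fun do rewrite big_cons; have c := @gradx_continuous R n f i sf x.
exact: (cvgD (cvgM c c) (IH x)).
Qed.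

Lemma integral_supported n (D : set 'rV[R]_n) (F : 'rV[R]_n -> R) : measurable D ->
  (forall x, ~ D x -> F x = 0) ->
  (\int[lebesgue_rV R n]_(x in D) (F x)%:E = \int[lebesgue_rV R n]_x (F x)%:E)%E.
Proof.
move=> mD FD; rewrite integral_mkcond; apply: eq_integral => x _.
by rewrite patchE; case: ifPn => // /negP nD; rewrite FD// => Dx; apply: nD; rewrite mem_set.
Qed.

Lemma lebesgue_ball_gt0 n (x : 'rV[R]_n) r : 0 < r -> (0 < lebesgue_rV R n (ball x r))%E.
Proof.
move=> r0; elim: n x => [|n IH] x.
  by rewrite /= diracE mem_set ?lte01//; split=> // i [].
rewrite /= /lebesgue_step /pushforward.
pose y : 'rV[R]_n := \row_i x ord0 (@rshift 1 n i).
rewrite (_ : _ @^-1` _ = ball (x ord0 (@lshift 1 n ord0)) r `*` ball y r); last first.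
  apply/seteqP; split=> -[t z] /=.
    move=> [_ h]; split; first by have := h ord0 (@lshift 1 n ord0); rewrite consrV_l.
    by split=> // i j; have := h ord0 (@rshift 1 n j); rewrite consrV_r [i]ord1 mxE.
  move=> [xt [_ yz]]; split=> // i j; rewrite [i]ord1; case: (@split_ordP 1 n j) => k ->.
    by rewrite consrV_l [k]ord1.
  by rewrite consrV_r; have := yz ord0 k; rewrite mxE.
rewrite product_measure1E//; [|exact: measurable_ballR|exact: measurable_ball_rV].
rewrite [X in (_ < X * _)%E](_ : _ = (r *+ 2)%:E); last exact: lebesgue_measure_ball (ltW r0).
by rewrite mule_gt0 ?IH// lte_fin mulrn_wgt0.
Qed.

Lemma integral_sq_gt0 n (f : 'rV[R]_n -> R) x0 : continuous f -> f x0 != 0 ->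
  (0 < \int[lebesgue_rV R n]_x (f x ^+ 2)%:E)%E.
Proof.
move=> cf f0; have f20 : 0 < f x0 ^+ 2 by rewrite exprn_even_gt0.
have c2 : {for x0, continuous (fun x => f x ^+ 2)} by exact: (continuous_sqr (cf x0)).
have : nbhs x0 [set x | f x0 ^+ 2 / 2 < f x ^+ 2].
  apply: (c2 [set y | f x0 ^+ 2 / 2 < y]).
  by apply: open_nbhs_nbhs; split; [exact: open_gt|rewrite /= ltr_pdivrMr//; lra].
move=> /nbhs_ballP[r /= r0 rP].
apply: (@lt_le_trans _ _ (\int[lebesgue_rV R n]_(x in ball x0 r) (f x0 ^+ 2 / 2)%:E)%E).
  rewrite integral_cst; last exact: measurable_ball_rV.
  by rewrite mule_gt0 ?lebesgue_ball_gt0// lte_fin divr_gt0.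
have m2 : measurable_fun setT (fun x => (f x ^+ 2)%:E).
  by apply/measurable_EFinP/measurable_funX; exact: continuous_measurable_rV.
apply: (@le_trans _ _ (\int[lebesgue_rV R n]_(x in ball x0 r) (f x ^+ 2)%:E)%E).
  apply: ge0_le_integral => //.
  - exact: measurable_ball_rV.
  - by move=> x _; rewrite lee_fin divr_ge0// ltW.
  - exact: measurable_funTS.
  - by move=> x /rP /ltW; rewrite lee_fin.
apply: ge0_subset_integral => //; first exact: measurable_ball_rV.
by move=> x _; rewrite lee_fin sqr_ge0.
Qed.

End test_functions.

Section bump.
Context {R : realType} {d : nat}.

(** The square with its successive derivatives, in the sequence form expected by [smooth_comp]. *)
Definition sqr_derivs (k : nat) (r : R) : R :=
  match k with 0 => r ^+ 2 | 1 => 2 * r | 2 => 2 | _ => 0 end.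

Lemma is_derive_sqr_derivs k (r : R) : is_derive r 1 (sqr_derivs k) (sqr_derivs k.+1 r).
Proof.
case: k => [|[|[|k]]] /=.
- by apply: is_derive_eq; rewrite /GRing.scale /= !mulr1 mulr_natl.
- by apply: is_derive_eq; rewrite /GRing.scale /= mulr1.
- exact: is_derive_cst.
- exact: is_derive_cst.
Qed.

Lemma smooth_coord (x0 : 'rV[R]_d) i : smooth (fun x : 'rV[R]_d => x ord0 i - x0 ord0 i).
Proof.
apply: (@smooth_class _ _ [set f | (exists c, f = fun x : 'rV[R]_d => x ord0 i - c) \/ exists c, f = cst c]);
  last by left; exists (x0 ord0 i).
have cc (c : R) : continuous (fun x : 'rV[R]_d => x ord0 i - c).
  move=> x; suff c1 : (fun x : 'rV[R]_d => x ord0 i) y @[y --> x] --> x ord0 i.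
    exact: cvgB c1 (cvg_cst c).
  move=> P /nbhs_ballP[e /= e0 eP]; apply/nbhs_ballP; exists e => // y [_ xy].
  exact: eP (xy ord0 i).
have dq x v c : (fun h : R => h^-1 *: (((fun x : 'rV[R]_d => x ord0 i - c) \o shift x) (h *: v) - (x ord0 i - c)))
   @ 0^' --> v ord0 i.
  apply: (@cvg_trans _ ((fun _ : R => v ord0 i) @ 0^')); last exact: cvg_cst.
  apply: near_eq_cvg; near=> h; have h0 : h != 0 by near: h; exact: nbhs_dnbhs_neq.
  rewrite /= !mxE /GRing.scale /=; field; exact: h0.
move=> f [[c ->]|[c ->]]; split.
- exact: cc.
- by move=> x v; apply/cvg_ex; exists (v ord0 i); exact: dq.
- move=> v; right; exists (v ord0 i); apply/funext => x.
  by apply: cvg_lim => //; exact: dq.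
- exact: cst_continuous.
- by move=> x v; exact: derivable_cst.
- by move=> v; right; exists 0; apply/funext => x; rewrite derive_cst.
Unshelve. all: by end_near. Qed.

Lemma smooth_sqdist (x0 : 'rV[R]_d) : smooth (fun x : 'rV[R]_d => \sum_(i < d) (x ord0 i - x0 ord0 i) ^+ 2).
Proof.
have : forall s : seq 'I_d, smooth (fun x : 'rV[R]_d => \sum_(i <- s) (x ord0 i - x0 ord0 i) ^+ 2).
  elim=> [|i s IH]; first by under eq_fun do rewrite big_nil; exact: smooth_cst.
  under eq_fun do rewrite big_cons -[X in _ + X]mul1r.
  apply: smooth_lin => //.
  exact: (@smooth_comp R _ sqr_derivs _ is_derive_sqr_derivs (smooth_coord x0 i) 0).
exact.
Qed.

(** The flat function is composed with (r/2)^2 minus the squared Euclidean distance, which is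
    smooth, unlike the library's sup norm. The support lies in a closed Euclidean ball of radius
    r/2, inside the sup-norm ball of radius r. *)
Lemma bump_function (Omega : set 'rV[R]_d) (x0 : 'rV[R]_d) : open Omega -> Omega x0 ->
  exists2 phi, test_function Omega phi & 0 < phi x0.
Proof.
move=> oO Ox0; have /nbhs_ballP[r /= r0 rO] : nbhs x0 Omega by exact: open_nbhs_nbhs.
pose q (x : 'rV[R]_d) := \sum_(i < d) (x ord0 i - x0 ord0 i) ^+ 2.
pose K := [set x | q x <= (r / 2) ^+ 2].
have sq : smooth q := smooth_sqdist x0.
have Kr x : K x -> forall i, `|x ord0 i - x0 ord0 i| <= r / 2.
  move=> Kx i; rewrite -ler_sqr ?nnegrE//; last by rewrite divr_ge0// ltW.
  rewrite real_normK ?num_real// (le_trans _ Kx)// /q (bigD1 i)//= lerDl.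
  by rewrite sumr_ge0// => j _; rewrite sqr_ge0.
have cK : compact K.
  apply: bounded_closed_compact; last first.
    rewrite (_ : K = q @^-1` [set y | y <= (r / 2) ^+ 2])//.
    by apply: closed_comp; [move=> y _; exact: smooth_continuous|exact: closed_le].
  exists (`|x0| + r / 2); split; first by rewrite num_real.
  move=> M MM x Kx; rewrite /= (le_trans _ (ltW MM))//.
  rewrite [leLHS]/Num.norm /= mx_normrE; apply/bigmax_leP; split.
    by rewrite addr_ge0// divr_ge0// ltW.
  move=> [i j] _ /=; rewrite [i]ord1 -[x ord0 j](subrK (x0 ord0 j)) addrC.
  by rewrite (le_trans (ler_normD _ _))// lerD ?Kr//; exact: coord_le_norm.
have sw : smooth (fun x => (r / 2) ^+ 2 + (-1) * q x) by apply: smooth_lin => //; exact: smooth_cst.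
have sphi := @smooth_comp R _ (flat_id 1) _ (is_derive_flat_id (ltr01)) sw 0.
exists (flat_id 1 0 \o (fun x => (r / 2) ^+ 2 + (-1) * q x)); last first.
  rewrite /= (_ : q x0 = 0); last by rewrite /q big1// => i _; rewrite subrr expr0n.
  rewrite mulr0 addr0 /flat_id /flat; have h : 0 < (r / 2) ^+ 2 by rewrite exprn_gt0// divr_gt0.
  by rewrite h mulr_gt0// hornerE mul1r expR_gt0.
split; first exact: sphi.
exists K; split => //.
  - move=> x Kx; apply: rO; split=> // i j; rewrite [i]ord1 /ball /= distrC.
    by rewrite (le_lt_trans (Kr x Kx j))// ltr_pdivrMr// ltr_pMr// ltr1n.
- by move=> x /negP; rewrite -ltNge => qx; apply: (flat_id_le0 1); lra.
Qed.

End bump.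

Lemma L2_complete_rV d (T : measurableType d) (R : realType) (mu : {measure set T -> \bar R})
    (D : set T) n (F : nat -> T -> 'rV[R]_n) : measurable D ->
  (forall k, measurable_fun D (F k)) ->
  (forall e : R, 0 < e -> exists N, forall k m, (N <= k)%N -> (N <= m)%N ->
     (\int[mu]_(x in D) (dotx (F k x - F m x) (F k x - F m x))%:E <= e%:E)%E) ->
  exists G : T -> 'rV[R]_n, measurable_fun D G /\
    (\int[mu]_(x in D) (dotx (F k x - G x) (F k x - G x))%:E)%E @[k --> \oo] --> 0%E.
Proof.
move=> mD mF CF.
have mFi i k : measurable_fun D (fun x => F k x ord0 i) by exact: measurable_coord_fun.
have mlin k (G : T -> 'rV[R]_n) : measurable_fun D G -> measurable_fun D (fun x => F k x - G x).
  move=> mG; have := measurable_rV_lin mD (-1) (mF k) mG.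
  by under eq_fun do rewrite scaleN1r.
have /choice[g gP] (i : 'I_n) : exists g : T -> R, measurable_fun D g /\
    (\int[mu]_(x in D) ((F k x ord0 i - g x) ^+ 2)%:E)%E @[k --> \oo] --> 0%E.
  apply: L2_complete => // e /CF[N NP]; exists N => k m Nk Nm.
  apply: le_trans (NP k m Nk Nm); apply: ge0_le_integral => //.
  - by move=> x _; rewrite lee_fin sqr_ge0.
  - by apply/measurable_EFinP/measurable_funX/measurable_funB.
  - by apply/measurable_EFinP/measurable_dotx; apply: mlin.
  move=> x _; rewrite lee_fin /dotx (bigD1 i)//= !mxE -expr2 lerDl sumr_ge0// => j _.
  by rewrite -expr2 sqr_ge0.
have mg : measurable_fun D (fun x => \row_i g i x).
  by apply: measurable_rVP => // i; under eq_fun do rewrite mxE; exact: (gP i).1.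
exists (fun x => \row_i g i x); split => //.
have E k : (\int[mu]_(x in D) (dotx (F k x - \row_i g i x) (F k x - \row_i g i x))%:E)%E =
    (\sum_(i < n) \int[mu]_(x in D) ((F k x ord0 i - g i x) ^+ 2)%:E)%E.
  rewrite -ge0_integral_sum//.
  - by apply: eq_integral => x _; rewrite sumEFin; congr EFin; apply: eq_bigr => i _; rewrite !mxE -expr2.
  - by move=> i; apply/measurable_EFinP/measurable_funX/measurable_funB => //; exact: (gP i).1.
  - by move=> i x _; rewrite lee_fin sqr_ge0.
under eq_cvg do rewrite E.
suff : (\sum_(i < n) \int[mu]_(x in D) ((F k x ord0 i - g i x) ^+ 2)%:E)%E @[k --> \oo]
    --> (\sum_(i < n) (0 : \bar R))%E by rewrite big1.
apply: cvg_nnesum => i _; last exact: (gP i).2.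
by apply: nearW => k; apply: integral_ge0 => x _; rewrite lee_fin sqr_ge0.
Qed.

Definition wformR1 d (T : measurableType d) (R : realType) (D : set T) (mD : measurable D) :
    wform T R^o := wformR mD (measurable_cst (1 : R)) (fun _ _ => ler01).
Definition wformX1 d (T : measurableType d) (R : realType) (D : set T) (mD : measurable D) n :
    wform T 'rV[R]_n := wformX mD (measurable_cst (1 : R)) (fun _ _ => ler01) n.

(** Writing a f as f + (a-1) f reduces scaling to the linear combinations already treated. *)
Lemma wipZ d (T : measurableType d) (R : realType) (V : lmodType R)
    (mu : {measure set T -> \bar R}) (W : wform T V) a f : wfin mu W f ->
  wfin mu W (fun x => a *: f x) /\
  wip mu W (fun x => a *: f x) (fun x => a *: f x) = a ^+ 2 * wip mu W f f.
Proof.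
move=> ff; have E : (fun x => f x + (a - 1) *: f x) = (fun x => a *: f x).
  by apply/funext => x; rewrite scalerBl scale1r addrC subrK.
split; first by rewrite -E; exact: wfin_lin.
by rewrite -E wip_sq//; ring.
Qed.

Section dirichlet.
Context {R : realType} {d : nat} (Omega : set 'rV[R]_d).
Hypotheses (oO : open Omega) (bO : bounded_set Omega).
Let mO : measurable Omega := open_measurable_rV oO.
Local Notation mu := (lebesgue_rV R d).
Local Notation W := (wformR1 R mO).
Local Notation WX := (wformX1 R mO d).
Local Notation nsq f := (wip mu W f f).
Local Notation esq F := (wip mu WX F F).

Lemma normL2sq_wnsq (f : 'rV[R]_d -> R) : normL2sq Omega f = wnsq mu W f.
Proof. by apply: eq_integral => x _ /=; rewrite mul1r expr2. Qed.

Lemma energy_wnsq (F : 'rV[R]_d -> 'rV[R]_d) :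
  (\int[mu]_(x in Omega) (dotx (F x) (F x))%:E)%E = wnsq mu WX F.
Proof. by apply: eq_integral => x _ /=; rewrite mul1r. Qed.

Lemma test_function_wfin phi : test_function Omega phi ->
  wfin mu W phi /\ wfin mu WX (gradx phi).
Proof.
move=> [sp [K [cK KO phiK]]].
have cp : continuous (phi : 'rV[R]_d -> R) by exact: smooth_continuous.
split; split.
- by apply: continuous_measurable_rV; exact: smooth_continuous.
- rewrite -normL2sq_wnsq; apply: (integral_compact_support_lty mO cK).
  + by move=> x; exact: (continuous_sqr (cp x)).
  + by move=> x; exact: sqr_ge0.
  + by move=> x /phiK ->; rewrite expr0n.
- exact: measurable_gradx.
- rewrite -energy_wnsq; apply: (integral_compact_support_lty mO cK).
  + exact: dotx_sq_continuous.
  + by move=> x; exact: dotx_ge0.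
  + by move=> x nKx; rewrite (gradx_compact_support cK phiK nKx) dotx0.
Qed.

Lemma test_function_outside phi x : test_function Omega phi -> ~ Omega x ->
  phi x = 0 /\ gradx phi x = 0.
Proof.
move=> [sp [K [cK KO phiK]]] nOx; have nKx : ~ K x by move=> /KO.
by split; [exact: phiK|exact: gradx_compact_support nKx].
Qed.

Lemma test_function_energy phi : test_function Omega phi ->
  dirichlet_energy phi = (esq (gradx phi))%:E.
Proof.
move=> tp; rewrite -wnsqE; last exact: (test_function_wfin tp).2.
rewrite -energy_wnsq integral_supported// => x nOx.
by rewrite (test_function_outside tp nOx).2 dotx0.
Qed.

Lemma test_function_nsq phi : test_function Omega phi ->
  (\int[mu]_x (phi x ^+ 2)%:E)%E = (nsq phi)%:E.
Proof.
move=> tp; rewrite -wnsqE; last exact: (test_function_wfin tp).1.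
rewrite -normL2sq_wnsq; apply/esym; apply: integral_supported => // x nOx.
by rewrite (test_function_outside tp nOx).1 expr0n.
Qed.

(** The quotients range over test functions, whose gradients are classical; the lower bound is
    carried over to [H10] by density in [H10_fin]. *)
Definition rayleigh_quotients : set R := [set r | exists phi,
  [/\ test_function Omega phi, 0 < nsq phi & r = esq (gradx phi) / nsq phi]].

Definition rayleigh_inf : R := inf rayleigh_quotients.

Hypotheses (d0 : (0 < d)%N) (O0 : Omega !=set0).

Lemma rayleigh_quotients_neq0 : rayleigh_quotients !=set0.
Proof.
have [x0 Ox0] := O0; have [phi tp p0] := bump_function oO Ox0.
exists (esq (gradx phi) / nsq phi), phi; split => //.
rewrite -lte_fin -test_function_nsq//; apply: (integral_sq_gt0 (x0 := x0)); last by rewrite gt_eqF.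
exact: smooth_continuous tp.1.
Qed.

Lemma poincare_box_test phi M : 0 < M -> Omega `<=` box M -> test_function Omega phi ->
  nsq phi <= 4 * M ^+ 2 * esq (gradx phi).
Proof.
move=> M0 OM tp; rewrite -lee_fin EFinM -test_function_energy// -test_function_nsq//.
move: phi tp; case: d d0 Omega OM => // n _ Om OM phi tp.
apply: poincare_box => //; first exact: tp.1.
move=> x i Mx; have [_ [K [_ KO ->//]]] := tp => /KO /OM /(_ i).
by rewrite ltNge Mx.
Qed.

Lemma rayleigh_inf_gt0 : 0 < rayleigh_inf.
Proof.
have [M M0 OM] := bounded_box bO.
apply: (@lt_le_trans _ _ (4 * M ^+ 2)^-1).
  by rewrite invr_gt0 mulr_gt0// exprn_gt0.
apply: lb_le_inf; first exact: rayleigh_quotients_neq0.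
move=> _ [phi [tp n0 ->]]; rewrite ler_pdivlMr// ler_pdivrMl ?mulr_gt0 ?exprn_gt0//.
exact: poincare_box_test.
Qed.

Lemma rayleigh_le phi : test_function Omega phi ->
  rayleigh_inf * nsq phi <= esq (gradx phi).
Proof.
move=> tp; have [n0|n0] := ltP 0 (nsq phi); last first.
  have -> : nsq phi = 0 by apply/eqP; rewrite eq_le n0 wip_ge0.
  by rewrite mulr0 wip_ge0.
rewrite -ler_pdivlMr//; apply: ge_inf; last by exists phi.
by exists 0 => _ [psi [_ _ ->]]; rewrite divr_ge0 ?wip_ge0.
Qed.

Lemma H10_fin u Du : H10 Omega u Du -> [/\ wfin mu W u, wfin mu WX Du &
  rayleigh_inf * nsq u <= esq Du].
Proof.
move=> [mu_ mDu [phi [tp c cD]]].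
have [fu cu] : wfin mu W u /\ nsq (phi n) @[n --> \oo] --> nsq u.
  apply: wfin_cvg => //; first by move=> n; exact: (test_function_wfin (tp n)).1.
  by under eq_cvg do rewrite -normL2sq_wnsq.
have [fD cDu] : wfin mu WX Du /\ esq (gradx (phi n)) @[n --> \oo] --> esq Du.
  apply: wfin_cvg => //; first by move=> n; exact: (test_function_wfin (tp n)).2.
  by under eq_cvg do rewrite -energy_wnsq.
split => //; apply: ler_cvg_to (cvgMr cu) cDu _.
by apply: nearW => n; exact: rayleigh_le.
Qed.

Lemma H10_lin a u Du v Dv : H10 Omega u Du -> H10 Omega v Dv ->
  H10 Omega (fun x => u x + a * v x) (fun x => Du x + a *: Dv x).
Proof.
move=> [mu_ mDu [phi [tp cu cDu]]] [mv mDv [psi [tq cv cDv]]]; split.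
- by apply: measurable_funD => //; exact: measurable_funM.
- exact: measurable_rV_lin.
exists (fun n x => phi n x + a * psi n x); split.
- by move=> n; exact: test_function_lin.
- under eq_cvg do rewrite normL2sq_wnsq.
  apply: (@wnsq_cvg_lin _ _ _ _ mu W a phi psi u v) => //.
  + by move=> n; exact: (test_function_wfin (tp n)).1.1.
  + by move=> n; exact: (test_function_wfin (tq n)).1.1.
  + by under eq_cvg do rewrite -normL2sq_wnsq.
  + by under eq_cvg do rewrite -normL2sq_wnsq.
have E n : gradx (fun x => phi n x + a * psi n x) =
    (fun x => gradx (phi n) x + a *: gradx (psi n) x).
  by apply/funext => x; rewrite gradx_lin//; [exact: (tp n).1|exact: (tq n).1].
under eq_cvg do rewrite energy_wnsq E.
apply: (@wnsq_cvg_lin _ _ _ _ mu WX a (fun n => gradx (phi n)) (fun n => gradx (psi n)) Du Dv) => //.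
+ by move=> n; exact: (test_function_wfin (tp n)).2.1.
+ by move=> n; exact: (test_function_wfin (tq n)).2.1.
+ by under eq_cvg do rewrite -energy_wnsq.
+ by under eq_cvg do rewrite -energy_wnsq.
Qed.

Lemma minimizing_sequence : exists phi : nat -> 'rV[R]_d -> R, forall n,
  [/\ test_function Omega (phi n), nsq (phi n) = 1 &
      esq (gradx (phi n)) <= rayleigh_inf + n.+1%:R^-1].
Proof.
suff /choice[phi phiP] : forall n : nat, exists f, [/\ test_function Omega f, nsq f = 1 &
      esq (gradx f) <= rayleigh_inf + n.+1%:R^-1] by exists phi.
move=> n; have hasinf : has_inf rayleigh_quotients.
  split; first exact: rayleigh_quotients_neq0.
  by exists 0 => _ [psi [_ _ ->]]; rewrite divr_ge0 ?wip_ge0.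
have [|_ [f [tf n0 ->]] fe] := @inf_adherent R rayleigh_quotients (n.+1%:R^-1) _ hasinf.
  by rewrite invr_gt0.
pose a := (Num.sqrt (nsq f))^-1.
have a2 : a ^+ 2 = (nsq f)^-1 by rewrite exprVn sqr_sqrtr// wip_ge0.
have [ff fD] := test_function_wfin tf.
(* The normalised function is written as [0 + a * f] so that [test_function_lin] and [gradx_lin]
   apply with the zero function. *)
have af : (fun x => 0 + a * f x) = (fun x => a *: (f x : R^o)).
  by apply/funext => x; rewrite add0r.
have aD : gradx (fun x => 0 + a * f x) = (fun x => a *: gradx f x).
  apply/funext => x; rewrite gradx_lin; [|exact: smooth_cst|exact: tf.1].
  by rewrite (_ : gradx _ x = 0) ?add0r//; apply/rowP => i; rewrite !mxE derive_cst.
exists (fun x => 0 + a * f x); split.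
- apply: test_function_lin => //; split; first exact: smooth_cst.
  by exists set0; split => //; exact: compact0.
- by rewrite af (wipZ a ff).2 a2 mulVf// gt_eqF.
- by rewrite aD (wipZ a fD).2 a2 mulrC ltW.
Qed.

(* The parallelogram identity makes the gradients of a minimizing sequence Cauchy
   as soon as the sequence itself is. *)
Lemma gradient_gap f g : test_function Omega f -> test_function Omega g ->
  nsq f = 1 -> nsq g = 1 ->
  esq (fun x => gradx f x + (-1) *: gradx g x) <=
    2 * esq (gradx f) + 2 * esq (gradx g) - 4 * rayleigh_inf +
    rayleigh_inf * nsq (fun x => f x + (-1) *: (g x : R^o)).
Proof.
move=> tf tg f1 g1; have [ff fD] := test_function_wfin tf.
have [gf gD] := test_function_wfin tg.
have := rayleigh_le (test_function_lin 1 tf tg).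
have -> : gradx (fun x => f x + 1 * g x) = (fun x => gradx f x + 1 *: gradx g x).
  by apply/funext => x; rewrite gradx_lin//; [exact: tf.1|exact: tg.1].
have -> : nsq (fun x => f x + 1 * g x) = nsq f + 2 * 1 * wip mu W f g + 1 ^+ 2 * nsq g.
  exact: (wip_sq 1 ff gf).
rewrite (wip_sq 1 fD gD) (wip_sq (-1) fD gD) (wip_sq (-1) ff gf) f1 g1.
rewrite sqrrN expr1n.
move: (wip mu W f g) (wip mu WX _ _) (wip mu WX _ _) (wip mu WX _ _) rayleigh_inf => a b e c l.
by lra.
Qed.

Lemma rayleigh_minimizer : exists u Du, [/\ H10 Omega u Du, nsq u = 1 & esq Du = rayleigh_inf].
Proof.
have [phi phiP] := minimizing_sequence.
have [M M0 OM] := bounded_box bO.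
have l0 := rayleigh_inf_gt0.
have [k [ki kC]] : exists k : nat -> nat, (forall i, (i <= k i)%N) /\
    forall e : R, 0 < e -> exists N, forall i j, (N <= i)%N -> (N <= j)%N ->
      (\int[mu]_x ((phi (k i) x - phi (k j) x) ^+ 2)%:E <= e%:E)%E.
  apply: (@cauchy_subsequence R _ (fun f g => \int[mu]_x ((f x - g x) ^+ 2)%:E)%E phi) => e e0.
  (* The H^1 bound of the minimizing sequence: 1 from the normalisation and at most
     [rayleigh_inf + 1] from the energies, as 1/(n+1) <= 1. *)
  have B0 : 0 < 1 + (rayleigh_inf + 1) by rewrite !addr_gt0.
  have [I [c cP]] := H1_precompact d M0 B0 e0; exists I, c => n m.
  have bd j : H1_bounded M (1 + (rayleigh_inf + 1)) (phi j).
    have [tp n1 e1] := phiP j; split; first exact: tp.1.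
      move=> x i Mx; have [_ [K [_ KO ->//]]] := tp => /KO /OM /(_ i).
      by rewrite ltNge Mx.
    rewrite /H1sq; under eq_integral do rewrite EFinD.
    rewrite ge0_integralD//; last 4 first.
    - by move=> x _; rewrite lee_fin sqr_ge0.
    - apply/measurable_EFinP/measurable_funX; apply: continuous_measurable_rV.
      by apply: smooth_continuous; exact: tp.1.
    - by move=> x _; rewrite lee_fin dotx_ge0.
    - by apply/measurable_EFinP/measurable_dotx => //; apply: measurable_gradx => //; exact: tp.1.
    rewrite test_function_nsq// n1 -/(dirichlet_energy _) test_function_energy// -EFinD lee_fin.
    by rewrite lerD2l (le_trans e1)// lerD2l invf_le1// ler1n.
  exact: cP.
pose f i := phi (k i).
have tf i : test_function Omega (f i) by have [] := phiP (k i).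
have n1 i : nsq (f i) = 1 by have [] := phiP (k i).
have e1 i : esq (gradx (f i)) <= rayleigh_inf + i.+1%:R^-1.
  have [_ _ h] := phiP (k i); rewrite (le_trans h)// lerD2l lef_pV2 ?posrE//.
  by rewrite ler_nat ltnS.
have ff i := (test_function_wfin (tf i)).1; have fD i := (test_function_wfin (tf i)).2.
have diffE i j : (\int[mu]_x ((f i x - f j x) ^+ 2)%:E)%E =
    (nsq (fun x => f i x + (-1) *: (f j x : R^o)))%:E.
  rewrite -(test_function_nsq (test_function_lin (-1) (tf i) (tf j))).
  by apply: eq_integral => x _; rewrite mulN1r.
have [u [mu_ cu]] : exists u : 'rV[R]_d -> R, measurable_fun Omega u /\
    (\int[mu]_(x in Omega) ((f n x - u x) ^+ 2)%:E)%E @[n --> \oo] --> 0%E.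
  apply: L2_complete => //; first by move=> n; exact: (ff n).1.
  move=> e /kC[N NP]; exists N => n m Nn Nm; rewrite (le_trans _ (NP n m Nn Nm))//.
  rewrite integral_supported// => x nOx.
  by rewrite (test_function_outside (tf n) nOx).1 (test_function_outside (tf m) nOx).1 subrr expr0n.
have [Du [mDu cDu]] : exists Du : 'rV[R]_d -> 'rV[R]_d, measurable_fun Omega Du /\
    (\int[mu]_(x in Omega) (dotx (gradx (f n) x - Du x) (gradx (f n) x - Du x))%:E)%E
      @[n --> \oo] --> 0%E.
  apply: L2_complete_rV => //; first by move=> n; exact: (fD n).1.
  (* In [gradient_gap] the two energies exceed [rayleigh_inf] by at most e/8 each, contributing 4
     (e/8), and the distance term contributes [rayleigh_inf] times e/(2 [rayleigh_inf]); the sum is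
     e. *)
  move=> e e0; have [N1 N1P] := kC (e / (2 * rayleigh_inf)) ltac:(by rewrite divr_gt0 ?mulr_gt0).
  have e8 : 0 < e / 8 by rewrite divr_gt0.
  have [N2] := ltr_add_invr e8; rewrite add0r => N2P.
  exists (maxn N1 N2) => n m; rewrite !geq_max => /andP[n1' n2] /andP[m1 m2].
  have := N1P n m n1' m1; rewrite diffE lee_fin ler_pdivlMr ?mulr_gt0// => h1.
  have inv j : (N2 <= j)%N -> esq (gradx (f j)) <= rayleigh_inf + e / 8.
    move=> N2j; rewrite (le_trans (e1 j))// lerD2l (le_trans _ (ltW N2P))// lef_pV2 ?posrE//.
    by rewrite ler_nat ltnS.
  have := gradient_gap (tf n) (tf m) (n1 n) (n1 m).
  have := inv n n2; have := inv m m2 => h2 h3 h4.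
  rewrite (_ : (\int[mu]_(x in Omega) _)%E = (esq (fun x => gradx (f n) x + (-1) *: gradx (f m) x))%:E).
    move: h1 h2 h3 h4; rewrite lee_fin.
    move: (nsq _) (esq (fun x => _)) (esq _) (esq _) rayleigh_inf => a b a' b' l.
    by lra.
  rewrite -wnsqE; last exact: wfin_lin.
  by rewrite -energy_wnsq; apply: eq_integral => x _; rewrite scaleN1r.
have hu : H10 Omega u Du by split => //; exists f; split.
have [fu fDu lu] := H10_fin hu.
have c1 : nsq (f n) @[n --> \oo] --> nsq u.
  by apply: (wfin_cvg _ _ _).2 => //; under eq_cvg do rewrite -normL2sq_wnsq.
have c2 : esq (gradx (f n)) @[n --> \oo] --> esq Du.
  by apply: (wfin_cvg _ _ _).2 => //; under eq_cvg do rewrite -energy_wnsq.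
have u1 : nsq u = 1.
  apply: (cvg_unique (@Rhausdorff R) c1).
  by rewrite (_ : (fun n => _) = cst 1); [exact: cvg_cst|apply/funext => n; exact: n1].
exists u, Du; split => //; apply/eqP; rewrite eq_le; apply/andP; split; last first.
  by move: lu; rewrite u1 mulr1.
apply: ler_cvg_to c2 _ (nearW _ e1).
rewrite -[X in _ --> X]addr0; apply: cvgD; first exact: cvg_cst.
exact: cvg_harmonic.
Qed.

(** Along u + t v the energy minus [rayleigh_inf] times the squared norm is the polynomial 2 t X +
    t^2 Y. It is nonnegative and vanishes at t = 0, so its linear coefficient must vanish. *)
Lemma rayleigh_euler_lagrange u Du v Dv : H10 Omega u Du -> H10 Omega v Dv ->
  esq Du = rayleigh_inf * nsq u ->
  wip mu WX Du Dv = rayleigh_inf * wip mu W u v.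
Proof.
move=> hu hv eu; have [fu fDu _] := H10_fin hu; have [fv fDv _] := H10_fin hv.
pose X := wip mu WX Du Dv - rayleigh_inf * wip mu W u v.
pose Y := esq Dv - rayleigh_inf * nsq v.
have q (t : R) : 0 <= 2 * t * X + t ^+ 2 * Y.
  have [_ _] := H10_fin (H10_lin t hu hv).
  have -> : nsq (fun x => u x + t * v x) = nsq u + 2 * t * wip mu W u v + t ^+ 2 * nsq v.
    exact: (wip_sq t fu fv).
  rewrite (wip_sq t fDu fDv) eu -subr_ge0; congr (0 <= _); rewrite /X /Y; ring.
suff : X = 0 by rewrite /X => /eqP; rewrite subr_eq0 => /eqP.
have Y0 : 0 <= Y by have := q 1; have := q (-1); rewrite sqrrN expr1n; lra.
(* At t = -X/(Y+1) the polynomial equals -X^2 (Y+2)/(Y+1)^2; the shift by 1 avoids a division by Y =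
   0. *)
have := q (- X / (Y + 1)); have Y1 : 0 < Y + 1 by lra.
have -> : 2 * (- X / (Y + 1)) * X + (- X / (Y + 1)) ^+ 2 * Y = - (X ^+ 2 * (Y + 2) / (Y + 1) ^+ 2).
  by field; rewrite gt_eqF.
rewrite oppr_ge0 pmulr_lle0 ?invr_gt0 ?exprn_gt0// pmulr_lle0; last by lra.
by move=> h; apply/eqP; rewrite -sqrf_eq0 eq_le h sqr_ge0.
Qed.

(** [lambda1] is obtained with [get], so its defining property holds only once the set is inhabited;
    the minimizer provides the inhabitant through the Euler-Lagrange equation. Conversely, an
    eigenvalue equation tested with its own eigenfunction makes the eigenvalue a Rayleigh quotient,
    hence at least [rayleigh_inf]. *)
Lemma lambda1E : lambda1 Omega = rayleigh_inf.
Proof.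
have IE u v : \int[mu]_(x in Omega) (u x * v x) = wip mu W u v.
  by apply: eq_Rintegral => x _ /=; rewrite mul1r.
have IX U V : \int[mu]_(x in Omega) dotx (U x) (V x) = wip mu WX U V.
  by apply: eq_Rintegral => x _ /=; rewrite mul1r.
have eig : dirichlet_eigenvalue Omega rayleigh_inf.
  have [u [Du [hu u1 Du1]]] := rayleigh_minimizer; exists u, Du.
  have [fu _ _] := H10_fin hu.
  split => //; first by rewrite normL2sq_wnsq wnsqE// u1 lte_fin.
  move=> v Dv hv; rewrite IE IX; apply: rayleigh_euler_lagrange => //.
  by rewrite Du1 u1 mulr1.
have low m : dirichlet_eigenvalue Omega m -> rayleigh_inf <= m.
  move=> [u [Du [hu u0 ev]]]; have [fu fDu lu] := H10_fin hu.
  have := ev _ _ hu; rewrite IE IX => e; rewrite e in lu.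
  by rewrite -(ler_pM2r (_ : 0 < nsq u))// -lte_fin -wnsqE// -normL2sq_wnsq.
have [l1 l2] : [set lam | dirichlet_eigenvalue Omega lam /\
    forall m, dirichlet_eigenvalue Omega m -> lam <= m] (lambda1 Omega).
  by apply: getPex; exists rayleigh_inf.
by apply/eqP; rewrite eq_le l2//= low.
Qed.

End dirichlet.

(** * Poincare inequality for smooth functions vanishing on the boundary *)

Section poincare.
Context {R : realType} {d : nat} (Omega : set 'rV[R]_d).
Hypotheses (oO : open Omega) (bO : bounded_set Omega) (d0 : (0 < d)%N) (O0 : Omega !=set0).
Let mO : measurable Omega := open_measurable_rV oO.
Local Notation mu := (lebesgue_rV R d).

Lemma lambda1_gt0 : 0 < lambda1 Omega.
Proof. by rewrite (lambda1E oO)//; exact: rayleigh_inf_gt0. Qed.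

Lemma test_function_poincare phi : test_function Omega phi ->
  ((lambda1 Omega)%:E * normL2sq Omega phi <=
   \int[mu]_(x in Omega) (dotx (gradx phi x) (gradx phi x))%:E)%E.
Proof.
move=> tp; have [fp fD] := test_function_wfin oO tp.
rewrite (normL2sq_wnsq oO) (energy_wnsq oO) !wnsqE// -EFinM lee_fin (lambda1E oO)//.
exact: rayleigh_le.
Qed.

Lemma lebesgue_bounded_lty : (mu Omega < +oo)%E.
Proof.
have [M M0 OM] := bounded_box bO; apply: le_lt_trans (lebesgue_box_lty d M).
by apply: le_measure; rewrite ?inE//; exact: measurable_box.
Qed.

Lemma bounded_closure : bounded_set (closure Omega).
Proof.
have /pinfty_ex_gt0[M M0 OM] := bO; exists M; split; first by rewrite num_real.
move=> N MN x clx; rewrite /= (le_trans _ (ltW MN))//.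
suff : closure Omega `<=` [set x | `|x| <= M] by apply.
have /closure_id -> : closed [set x : 'rV[R]_d | `|x| <= M].
  rewrite (_ : [set x | _] = (fun x => `|x|) @^-1` [set y | y <= M])//.
  by apply: closed_comp; [move=> y _; exact: norm_continuous|exact: closed_le].
exact: closure_subset.
Qed.

Section truncation.
Variables (f : 'rV[R]_d -> R) (e : R).
Hypotheses (sf : smooth f) (f0 : forall x, boundary Omega x -> f x = 0) (e0 : 0 < e).

(** The truncated composition may be nonzero outside Omega, where nothing is known about [f], and is
    therefore cut to 0 there. Since it vanishes near the boundary, the cut creates no
    singularity. *)
Definition truncation : 'rV[R]_d -> R := zero_ext Omega (trunc e 0 \o f).

Let cf : continuous (f : 'rV[R]_d -> R).
Proof. exact: smooth_continuous. Qed.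

Lemma trunc_vanishing p : closure Omega p -> ~ Omega p -> \forall x \near p, (trunc e 0 \o f) x = 0.
Proof.
move=> cp nOp; have fp : f p = 0.
  by apply: f0; split=> //; move=> /interior_subset.
have := @cf p; rewrite /continuous_at fp => /cvgrPdist_le /(_ e e0).
by apply: filterS => x; rewrite sub0r normrN => h /=; exact: trunc_small.
Qed.

Lemma smooth_trunc : smooth (trunc e 0 \o f).
Proof. exact: (@smooth_comp R _ (trunc e) f (is_derive_trunc e0) sf 0). Qed.

Lemma test_function_truncation : test_function Omega truncation.
Proof.
split; first by apply: smooth_zero_ext => //; [exact: smooth_trunc|exact: trunc_vanishing].
exists (closure Omega `&` [set x | e <= `|f x|]); split.
- apply: bounded_closed_compact.
    have [M [Mr MP]] := bounded_closure; exists M; split=> // N MN x [clx _].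
    exact: MP N MN x clx.
  apply: closedI; first exact: closed_closure.
  rewrite (_ : [set x | _] = (fun x => `|f x|) @^-1` [set y | e <= y])//.
  apply: closed_comp; last exact: closed_ge.
  by move=> x _; exact: cvg_norm (@cf x).
- move=> x [clx ex]; apply: contrapT => nOx.
  move: ex; rewrite /= f0 ?normr0 ?leNgt ?e0//.
  by split=> // /interior_subset.
- move=> x nK; rewrite /truncation /zero_ext; case: ifPn => // /set_mem Ox.
  apply: trunc_small => //; apply: ltW; rewrite ltNge; apply/negP => ex.
  by apply: nK; split=> //; exact: subset_closure.
Qed.

Lemma gradx_truncation x : Omega x -> gradx truncation x = trunc e 1 (f x) *: gradx f x.
Proof.
move=> Ox; apply/rowP => i; rewrite !mxE.
have E := derive_zero_ext oO (delta_mx ord0 i) trunc_vanishing.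
have {}E := congr1 (fun h : 'rV[R]_d -> R => h x) E.
apply: (eq_trans E); rewrite /zero_ext mem_set//.
by have [_ ->] := is_derive_chain (is_derive_trunc e0 0) (@smooth_derivable _ _ f x (delta_mx ord0 i) sf).
Qed.

Lemma truncation_dist x : Omega x -> `|truncation x - f x| <= 2 * e.
Proof. by move=> Ox; rewrite /truncation /zero_ext mem_set//=; exact: trunc_dist. Qed.

(** Young's inequality f^2 <= (1 + e) t^2 + (1 + 1/e) (t - f)^2, where t is the truncated value and
    |t - f| <= 2e. The last term is at most (1 + 1/e) 4 e^2 = 4 e^2 + 4 e, which still tends to
    0. *)
Lemma sq_truncation x : Omega x -> f x ^+ 2 <= (1 + e) * truncation x ^+ 2 + (4 * e ^+ 2 + 4 * e).
Proof.
move=> /truncation_dist; set t := truncation x => h.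
have h2 : (t - f x) ^+ 2 <= 4 * e ^+ 2.
  rewrite -real_normK ?num_real// (_ : 4 * e ^+ 2 = (2 * e) ^+ 2); last by ring.
  by rewrite ler_sqr ?nnegrE// mulr_ge0// ltW.
rewrite -subr_ge0 -(pmulr_rge0 _ e0).
rewrite (_ : e * _ = (e * t + (t - f x)) ^+ 2 + (1 + e) * (4 * e ^+ 2 - (t - f x) ^+ 2)); last by ring.
by rewrite addr_ge0 ?sqr_ge0// mulr_ge0 ?subr_ge0// addr_ge0// ltW.
Qed.

End truncation.

(* f is not assumed to have compact support in Omega, but [truncation f e] has:
   f is small near the boundary. *)
Lemma poincare_boundary (f : 'rV[R]_d -> R) : smooth f ->
  (forall x, boundary Omega x -> f x = 0) ->
  ((lambda1 Omega)%:E * normL2sq Omega f <=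
   \int[mu]_(x in Omega) (dotx (gradx f x) (gradx f x))%:E)%E.
Proof.
move=> sf f0; set E := (\int[mu]_(x in Omega) _)%E; have l0 := lambda1_gt0.
have E0 : (0 <= E)%E by apply: integral_ge0 => x _; rewrite lee_fin dotx_ge0.
have [Efin|] := ltP E +oo%E; last by rewrite leye_eq => /eqP ->; rewrite leey.
have mf : measurable_fun Omega f.
  by apply: continuous_measurable_rV; exact: smooth_continuous.
have mfin : mu Omega \is a fin_num by rewrite ge0_fin_numE// lebesgue_bounded_lty.
pose l := lambda1 Omega; pose b := fine E; pose m := fine (mu Omega).
have EE : E = b%:E by rewrite fineK// ge0_fin_numE.
have b0 : 0 <= b by exact: fine_ge0.
have m0 : 0 <= m by exact: fine_ge0.
(* The slope of the truncation is at most 1, so its energy is at most b. Combined with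
   [sq_truncation] on a set of measure m this leaves (1 + e) b + l m (4 e^2 + 4 e), and e <= 1
   bounds the last bracket by 8 e. *)
have key (e : R) : 0 < e -> e <= 1 -> (l%:E * normL2sq Omega f <= (b + e * (b + 8 * l * m))%:E)%E.
  move=> e0 e1; have tt := test_function_truncation sf f0 e0.
  have [ft [mgt _]] := test_function_wfin oO tt.
  have mt : measurable_fun Omega (truncation f e) := ft.1.
  have mgf : measurable_fun Omega (gradx f) := measurable_gradx mO sf.
  have h1 : (normL2sq Omega f <= (1 + e)%:E * normL2sq Omega (truncation f e) +
      ((4 * e ^+ 2 + 4 * e) * m)%:E)%E.
    rewrite [X in (_ <= _ + X)%E](_ : _ = \int[mu]_(x in Omega) (4 * e ^+ 2 + 4 * e)%:E)%E; last first.
      by rewrite integral_cst//= EFinM fineK.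
    have ge0 : 0 <= 1 + e by rewrite addr_ge0// ltW.
    have ge1 : 0 <= 4 * e ^+ 2 + 4 * e by rewrite addr_ge0// mulr_ge0 ?sqr_ge0// ltW.
    rewrite /normL2sq -ge0_integralZl_EFin//; last 2 first.
    - by move=> x _; rewrite lee_fin sqr_ge0.
    - exact/measurable_EFinP/measurable_funX.
    rewrite -ge0_integralD//; last 2 first.
    - by move=> x _; rewrite -EFinM lee_fin mulr_ge0// sqr_ge0.
    - by apply: measurable_funeM; exact/measurable_EFinP/measurable_funX.
    apply: ge0_le_integral => //.
    - by move=> x _; rewrite lee_fin sqr_ge0.
    - exact/measurable_EFinP/measurable_funX.
    - apply: emeasurable_funD => //.
      by apply: measurable_funeM; exact/measurable_EFinP/measurable_funX.
    by move=> x Ox; rewrite -EFinM -EFinD lee_fin; exact: sq_truncation.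
  have h2 : (l%:E * normL2sq Omega (truncation f e) <= b%:E)%E.
    apply: le_trans (test_function_poincare tt) _; rewrite -EE.
    apply: ge0_le_integral => //.
    - by move=> x _; rewrite lee_fin dotx_ge0.
    - exact/measurable_EFinP/measurable_dotx.
    - exact/measurable_EFinP/measurable_dotx.
    move=> x Ox; rewrite lee_fin gradx_truncation// dotxZl dotxC dotxZl mulrA -expr2.
    rewrite ler_piMl ?dotx_ge0//.
    by rewrite -real_normK ?num_real// expr_le1// trunc1_bound.
  apply: le_trans (lee_wpmul2l _ h1) _; first by rewrite lee_fin ltW.
  have [t te] : exists t, normL2sq Omega (truncation f e) = t%:E.
    by eexists; rewrite (normL2sq_wnsq oO) wnsqE.
  rewrite te -EFinM lee_fin in h2; rewrite te -(EFinM (1 + e) t) -EFinD -EFinM lee_fin.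
  have t1 : (1 + e) * (l * t) <= (1 + e) * b by rewrite ler_wpM2l// addr_ge0// ltW.
  have lm : 0 <= l * m by rewrite mulr_ge0// ltW.
  have t2 : e ^+ 2 * (l * m) <= e * (l * m) by rewrite ler_wpM2r// expr2 ger_pMl.
  rewrite (_ : l * _ = (1 + e) * (l * t) + 4 * (e ^+ 2 * (l * m)) + 4 * (e * (l * m))); last by ring.
  rewrite (_ : b + _ = (1 + e) * b + 8 * (e * (l * m))); last by ring.
  by lra.
rewrite EE; apply/lee_addgt0Pr => dl dl0.
pose c := b + 8 * l * m; have c0 : 0 <= c.
  by rewrite addr_ge0// mulr_ge0// mulr_ge0// ltW.
pose e := Num.min 1 (dl / (c + 1)).
have e0 : 0 < e by rewrite lt_min ltr01 divr_gt0// ltr_wpDl.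
apply: le_trans (key e e0 _) _; first by rewrite ge_min lexx.
rewrite -EFinD lee_fin lerD2l -/c (@le_trans _ _ (dl / (c + 1) * c))//.
  by rewrite ler_wpM2r// ge_min lexx orbT.
by rewrite mulrAC ler_pdivrMr ?ltr_wpDl// ler_wpM2l ?(ltW dl0)// lerDl.
Qed.

End poincare.

(** * The space V *)

Lemma C_gt0 (R : realType) (s : R) : 0 < s < 1 -> 0 < C_ s.
Proof.
move=> /andP[s0 s1]; rewrite /C_ mulr_gt0 ?powR_gt0// divr_gt0//.
  by rewrite -bessel0 bessel_gt0//; lra.
by rewrite -bessel0 bessel_gt0//; lra.
Qed.

Section slices_xt.
Context {R : realType} {d : nat}.
Implicit Types (f : space_time R d -> R) (x : 'rV[R]_d) (t : R).

Lemma pair_continuous_l t : continuous (fun x : 'rV[R]_d => (x, t)).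
Proof.
move=> x P /nbhs_ballP[e /= e0 eP]; apply/nbhs_ballP; exists e => // y xy.
by apply: eP; split=> //; exact: ballxx.
Qed.

Lemma pair_continuous_r x : continuous (fun t : R => (x, t)).
Proof.
move=> t P /nbhs_ballP[e /= e0 eP]; apply/nbhs_ballP; exists e => // y xy.
by apply: eP; split=> //; exact: ballxx.
Qed.

Lemma pair_lin_l t (h : R) (v x : 'rV[R]_d) :
  ((h *: v + x, t) : space_time R d) = h *: ((v, 0) : space_time R d) + (x, t).
Proof. by apply: injective_projections; rewrite /= ?scaler0 ?add0r. Qed.

Lemma pair_lin_r x (h v t : R) :
  ((x, h *: v + t) : space_time R d) = h *: ((0, v) : space_time R d) + (x, t).
Proof. by apply: injective_projections; rewrite /= ?scaler0 ?add0r. Qed.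

Lemma smooth_slice_x f t : smooth f -> smooth (fun x : 'rV[R]_d => f (x, t)).
Proof.
exact: (@smooth_affine R (space_time R d) 'rV[R]_d (fun x => (x, t)) (fun v => (v, 0))
  (@pair_lin_l t) (@pair_continuous_l t) f).
Qed.

Lemma smooth_slice_t f x : smooth f -> smooth (fun t : R => f (x, t)).
Proof.
exact: (@smooth_affine R (space_time R d) R (fun t => (x, t)) (fun v => (0, v))
  (@pair_lin_r x) (@pair_continuous_r x) f).
Qed.

Lemma gradx_slice_x f t x : gradx (fun x : 'rV[R]_d => f (x, t)) x = (gradxt f (x, t)).1.
Proof.
apply/rowP => i; rewrite !mxE.
exact: (@derive_affine R (space_time R d) 'rV[R]_d (fun x => (x, t)) (fun v => (v, 0)) (@pair_lin_l t) f).
Qed.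

Lemma derive_slice_t f t x : 'D_1 (fun t : R => f (x, t)) t = (gradxt f (x, t)).2.
Proof.
exact: (@derive_affine R (space_time R d) R (fun t => (x, t)) (fun v => (0, v)) (@pair_lin_r x) f).
Qed.

Lemma gradxt1_continuous f i : smooth f -> continuous (fun z => (gradxt f z).1 ord0 i).
Proof.
move=> /(smooth_derive ((delta_mx ord0 i, 0) : space_time R d)) /smooth_continuous.
suff -> : (fun z => (gradxt f z).1 ord0 i) = 'D_((delta_mx ord0 i, 0) : space_time R d) f by [].
by apply/funext => x; rewrite mxE.
Qed.

Lemma gradxt2_continuous f : smooth f -> continuous (fun z => (gradxt f z).2).
Proof. by move=> /(smooth_derive ((0, 1) : space_time R d)) /smooth_continuous. Qed.

Lemma measurable_gradxt (D : set ('rV[R]_d * measurableTypeR R)%type) f : measurable D -> smooth f ->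
  measurable_fun D (fun z => (gradxt f z).1) /\ measurable_fun D (fun z => (gradxt f z).2).
Proof.
move=> mD sf; split; last by apply: continuous_measurable_xt; exact: gradxt2_continuous.
by apply: measurable_rVP => // i; apply: continuous_measurable_xt; exact: gradxt1_continuous.
Qed.

Lemma dotxt_sq_continuous f : smooth f -> continuous (fun z => dotxt (gradxt f z) (gradxt f z)).
Proof.
move=> sf z; suff h : forall s : seq 'I_d,
    continuous (fun z => \sum_(i <- s) (gradxt f z).1 ord0 i * (gradxt f z).1 ord0 i).
  have c := gradxt2_continuous sf (x := z); exact: cvgD (h _ z) (cvgM c c).
elim=> [|i s IH] x.
  by under eq_fun do rewrite big_nil; exact: cst_continuous.
under eq_fun do rewrite big_cons; have c := @gradxt1_continuous f i sf x.
exact: cvgD (cvgM c c) (IH x).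
Qed.

Lemma gradxt_lin f g a z : smooth f -> smooth g ->
  gradxt (fun z => f z + a * g z) z = gradxt f z + a *: gradxt g z.
Proof.
move=> sf sg; apply: injective_projections; rewrite /=.
  by apply/rowP => i; rewrite !mxE derive_lin//; exact: smooth_derivable.
by rewrite derive_lin//; exact: smooth_derivable.
Qed.

End slices_xt.

Section cylinder_slices.
Context {R : realType} {d : nat} (Omega : set 'rV[R]_d).
Hypothesis oO : open Omega.
Implicit Types F G : space_time R d -> \bar R.
Local Open Scope ereal_scope.
Local Notation Q := (cylinder Omega : set ('rV[R]_d * measurableTypeR R)%type).

Let mC : measurable Q := measurable_cylinder oO.

Lemma measurable_cylinder_t F : measurable_fun Q F -> (forall z, Q z -> 0 <= F z) ->
  measurable_fun (`]0%R, +oo[ : set R) (fun t : R => \int[lebesgue_rV R d]_(x in Omega) F (x, t)).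
Proof.
move=> mF F0.
have F'0 z : 0 <= (F \_ Q) z by rewrite patchE; case: ifPn => // /set_mem; exact: F0.
have := @measurable_fun_fubini_tonelli_G _ _ _ (measurableTypeR R) R (lebesgue_rV R d)
  (F \_ Q) ((measurable_restrictT F mC).1 mF) F'0.
move=> /(@measurable_funTS _ _ (measurableTypeR R) _ (`]0%R, +oo[ : set R)).
apply: eq_measurable_fun => t tO; rewrite /fubini_G.
rewrite [RHS]integral_mkcond; apply: eq_integral => x _; rewrite !patchE.
by rewrite cylinderE in_setX tO andbT.
Qed.

Lemma measurable_cylinder_x F : measurable_fun Q F -> (forall z, Q z -> 0 <= F z) ->
  measurable_fun Omega (fun x => \int[lebesgue_measure]_(t in `]0%R, +oo[) F (x, t)).
Proof.
move=> mF F0.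
have F'0 z : 0 <= (F \_ Q) z by rewrite patchE; case: ifPn => // /set_mem; exact: F0.
have := @measurable_fun_fubini_tonelli_F _ _ _ (measurableTypeR R) R lebesgue_measure
  (F \_ Q) ((measurable_restrictT F mC).1 mF) F'0.
move=> /(@measurable_funTS _ _ _ _ Omega).
apply: eq_measurable_fun => x xO; rewrite /fubini_F.
rewrite [RHS]integral_mkcond; apply: eq_integral => t _; rewrite !patchE.
by rewrite cylinderE in_setX xO.
Qed.

Lemma le_integral_cylinder_t F G : measurable_fun Q F -> (forall z, Q z -> 0 <= F z) ->
  measurable_fun Q G -> (forall z, Q z -> 0 <= G z) ->
  (forall t : R, (0 < t)%R -> \int[lebesgue_rV R d]_(x in Omega) F (x, t) <=
     \int[lebesgue_rV R d]_(x in Omega) G (x, t)) ->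
  \int[mu_xt R d]_(z in Q) F z <= \int[mu_xt R d]_(z in Q) G z.
Proof.
move=> mF F0 mG G0 FG; rewrite !integral_cylinder_t//; apply: ge0_le_integral => //.
- move=> t /=; rewrite in_itv/= andbT => t0; apply: integral_ge0 => x Ox.
  by apply: F0; split.
- exact: measurable_cylinder_t.
- exact: measurable_cylinder_t.
- by move=> t /=; rewrite in_itv/= andbT; exact: FG.
Qed.

End cylinder_slices.

Section weighted_space.
Context {R : realType} {d : nat} (s : R) (Omega : set 'rV[R]_d).
Hypotheses (s01 : 0 < s < 1) (oO : open Omega) (bO : bounded_set Omega).
Hypotheses (d0 : (0 < d)%N) (O0 : Omega !=set0).
Let mO : measurable Omega := open_measurable_rV oO.
Local Notation mu := (lebesgue_rV R d).
Local Notation Q := (cylinder Omega : set ('rV[R]_d * measurableTypeR R)%type).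

Lemma measurable_weight (D : set ('rV[R]_d * measurableTypeR R)%type) (a : R) :
  measurable_fun D (fun z => z.2 `^ a).
Proof.
apply: measurable_funTS.
exact: (measurableT_comp (@measurable_powR_pos R a setT) measurable_snd).
Qed.

Lemma measurable_weightM (D : set ('rV[R]_d * measurableTypeR R)%type) (a : R) f :
  measurable_fun D f -> measurable_fun D (fun z => (z.2 `^ a * f z)%:E).
Proof.
by move=> mf; apply/measurable_EFinP/measurable_funM => //; exact: measurable_weight.
Qed.

Definition wformQ : wform ('rV[R]_d * measurableTypeR R)%type R^o :=
  wformR (measurable_cylinder oO) (measurable_weight (1 - 2 * s)) (fun z _ => powR_ge0 _ _).
Definition wformXTQ : wform ('rV[R]_d * measurableTypeR R)%type (space_time R d) :=
  wformXT (measurable_cylinder oO) (measurable_weight (1 - 2 * s)) (fun z _ => powR_ge0 _ _) d.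
Local Notation WQ := wformQ.
Local Notation WXT := wformXTQ.
Local Notation muQ := (mu_xt R d).

Lemma tnormsq_wnsq w : tnormsq s Omega w = wnsq muQ WQ w.
Proof. by apply: eq_integral => z _ /=; rewrite expr2. Qed.

Lemma tnormsqv_wnsq y : tnormsqv s Omega y = wnsq muQ WXT y.
Proof. by apply: eq_integral. Qed.

(** [F] is bounded on the compact set closure(Omega) x [0, T], and s < 1 gives 1 - 2s > -1, so the
    weight is integrable near t = 0 even when it is singular there. *)
Lemma bounded_support_lty (F : space_time R d -> R) T : 0 < T -> continuous F ->
  (forall z, 0 <= F z) -> (forall x t, Omega x -> T < t -> F (x, t) = 0) ->
  (\int[muQ]_(z in Q) (z.2 `^ (1 - 2 * s) * F z)%:E < +oo)%E.
Proof.
move=> T0 cF F0 FT; have /andP[s0 s1] := s01.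
have [M M0 OM] := bounded_box bO.
pose C : set (space_time R d) := closure Omega `*` `[0, T].
have cC : compact C.
  apply: compact_setX; last exact: segment_compact.
  by apply: bounded_closed_compact; [exact: bounded_closure|exact: closed_closure].
have /compact_bounded /pinfty_ex_gt0[c c0 Fc] : compact (F @` C).
  by apply: continuous_compact => //; exact: continuous_subspaceT.
have FC x t : Omega x -> 0 < t -> t <= T -> F (x, t) <= c.
  move=> Ox t0 tT; apply: le_trans (ler_norm _) _; apply: Fc; exists (x, t) => //; split => /=.
    exact: subset_closure.
  by rewrite in_itv /= tT ltW.
have mF : measurable_fun Q (fun z => (z.2 `^ (1 - 2 * s) * F z)%:E).
  apply: measurable_weightM.
  exact: continuous_measurable_xt.
pose m := fine (mu Omega).
have mfin : mu Omega = m%:E by rewrite fineK// ge0_fin_numE// lebesgue_bounded_lty.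
have m0 : 0 <= m by exact: fine_ge0.
pose H (z : space_time R d) : \bar R := (z.2 `^ (1 - 2 * s) * (c * (z.2 <= T)%R%:R))%:E.
have H0 z : (0 <= H z)%E by rewrite lee_fin !mulr_ge0 ?powR_ge0// ltW.
have mle : measurable_fun setT (fun t : R => (t <= T)%R%:R : R).
  rewrite (_ : (fun _ => _) = \1_(`]-oo, T] : set R)); first exact: measurable_indic.
  by apply/funext => t; rewrite indicE mem_setE in_itv.
have mH : measurable_fun Q H.
  apply: measurable_weightM.
  apply: measurable_funM => //; apply: measurable_funTS.
  exact: (measurableT_comp mle measurable_snd).
apply: (@le_lt_trans _ _ (\int[muQ]_(z in Q) H z)%E).
  apply: ge0_le_integral => //.
  - exact: measurable_cylinder.
  - by move=> z _; rewrite lee_fin mulr_ge0// powR_ge0.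
  move=> [x t] [/= Ox t0]; rewrite /H lee_fin ler_wpM2l ?powR_ge0//=.
  by have [tT|tT] := leP t T; [rewrite mulr1 FC|rewrite mulr0 FT].
rewrite integral_cylinder_t//.
have h := @integral_powR0_le R (1 - 2 * s) T ltac:(lra) T0.
apply: (@le_lt_trans _ _ (\int[lebesgue_measure]_(t in (`]0%R, T] : set R)) (t `^ (1 - 2 * s) * (c * m))%:E)%E).
  apply: eq_imp_le.
  rewrite integral_mkcond [RHS]integral_mkcond; apply: eq_integral => t _; rewrite !patchE.
  rewrite !mem_setE !in_itv/= andbT; case: (ltP 0 t) => //= t0.
  rewrite /H /= integral_cst// [X in (_ * X)%E](_ : _ = m%:E)// -EFinM; case: (leP t T) => tT.
    by rewrite mulr1 mulrA.
  by rewrite !mulr0 mul0r.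
under eq_integral do rewrite mulrC EFinM.
rewrite ge0_integralZl_EFin//; last 3 first.
- by move=> t _; rewrite lee_fin powR_ge0.
- by apply/measurable_EFinP; exact: measurable_powR_pos.
- by rewrite mulr_ge0// ltW.
apply: lte_mul_pinfty => //; first by rewrite lee_fin mulr_ge0// ltW.
by apply: le_lt_trans h _; rewrite ltry.
Qed.

(** If M bounds the support, [phi] vanishes for t > M. Taking T = M + 1 leaves a neighbourhood of
    each point with t >= T on which [phi] is 0, so that its gradient vanishes there too. *)
Lemma smoothV_support phi : smoothV Omega phi -> exists2 T, 0 < T &
  forall x t, Omega x -> T <= t -> phi (x, t) = 0 /\ gradxt phi (x, t) = 0.
Proof.
move=> [sp /pinfty_ex_gt0[M M0 bM] _]; exists (M + 1); first by rewrite addr_gt0.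
have out x t : Omega x -> M < t -> phi (x, t) = 0.
  move=> Ox Mt; apply: contrapT => /eqP p0.
  have : `|(x, t) : space_time R d| <= M.
    by apply: bM; split => //; apply: subset_closure; split => //=; exact: lt_trans Mt.
  apply/negP; by rewrite -ltNge prod_normE /= lt_max (lt_le_trans Mt (ler_norm t)) orbT.
move=> x t Ox Tt; have Mt : M < t by lra.
split; first exact: out.
have nz : \forall z \near ((x, t) : space_time R d), phi z = (fun _ => 0 : R) z.
  have : nbhs x Omega by exact: open_nbhs_nbhs.
  move=> /nbhs_ballP[e /= e0 eO]; apply/nbhs_ballP; exists (Num.min e (t - M)).
    by rewrite /= lt_min e0 subr_gt0.
  move=> [x' t'] [/= xx' tt']; apply: out.
    by apply: eO; apply: le_ball xx'; rewrite ge_min lexx.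
  by have := tt'; rewrite /ball /= lt_min => /andP[_]; rewrite ltr_norml; lra.
apply: injective_projections => /=.
  by apply/rowP => i; rewrite !mxE (near_eq_derive _ nz) derive_cst.
by rewrite (near_eq_derive _ nz) derive_cst.
Qed.

Lemma smoothV_lin a phi psi : smoothV Omega phi -> smoothV Omega psi ->
  smoothV Omega (fun z => phi z + a * psi z).
Proof.
move=> [sp [M [Mr MP]] p0] [sq [N [Nr NP]] q0]; split; first exact: smooth_lin.
  exists (Num.max M N); split; first by rewrite num_real.
  move=> K; rewrite gt_max => /andP[MK NK] z [clz /= nz].
  have [pz|pz] := eqVneq (phi z) 0; last exact: MP K MK z (conj clz pz).
  apply: (NP K NK z); split=> //; apply: contra nz => /eqP ->.
  by rewrite pz mulr0 addr0.
by move=> z zb; rewrite p0// q0// mulr0 addr0.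
Qed.

Lemma smoothV_wfin phi : smoothV Omega phi -> wfin muQ WQ phi /\ wfin muQ WXT (gradxt phi).
Proof.
move=> vp; have [T T0 TP] := smoothV_support vp; have [sp _ _] := vp.
have mQ := measurable_cylinder oO.
have cp : continuous (phi : space_time R d -> R) by exact: smooth_continuous.
split; split.
- exact: continuous_measurable_xt.
- rewrite -tnormsq_wnsq; apply: (@bounded_support_lty (fun z => phi z ^+ 2) T) => //.
  + by move=> z; exact: continuous_sqr (@cp z).
  + by move=> z; exact: sqr_ge0.
  + by move=> x t Ox /ltW Tt; rewrite (TP x t Ox Tt).1 expr0n.
- exact: measurable_gradxt.
- rewrite -tnormsqv_wnsq; apply: (@bounded_support_lty (fun z => dotxt (gradxt phi z) (gradxt phi z)) T) => //.
  + exact: dotxt_sq_continuous.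
  + by move=> z; rewrite addr_ge0 ?dotx_ge0// -expr2 sqr_ge0.
  + by move=> x t Ox /ltW Tt; rewrite (TP x t Ox Tt).2 /dotxt dotx0 mul0r addr0.
Qed.

Let sq_ge0 (a : R) (b : R) z : 0 <= b -> Q z -> (0 <= (z.2 `^ a * b)%:E)%E.
Proof. by move=> b0 _; rewrite lee_fin mulr_ge0// powR_ge0. Qed.

(** For every t > 0 the slice vanishes on the boundary of Omega, so [poincare_boundary] applies to
    it; the weight depends on t alone and factors out of the slice integrals. *)
Lemma smoothV_slice_poincare phi : smoothV Omega phi ->
  (\int[muQ]_(z in Q) (z.2 `^ (1 - 2 * s) * (lambda1 Omega * phi z ^+ 2))%:E <=
   \int[muQ]_(z in Q) (z.2 `^ (1 - 2 * s) * dotx (gradxt phi z).1 (gradxt phi z).1)%:E)%E.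
Proof.
move=> [sp _ p0]; have mQ := measurable_cylinder oO.
have l0 := lambda1_gt0 oO bO d0 O0.
have [mg1 _] := measurable_gradxt mQ sp.
have cp : continuous (phi : space_time R d -> R) by exact: smooth_continuous.
apply: le_integral_cylinder_t => //.
- apply: measurable_weightM.
  by apply: measurable_funM => //; apply: measurable_funX; exact: continuous_measurable_xt.
- by move=> z; apply: sq_ge0; rewrite mulr_ge0 ?sqr_ge0// ltW.
- apply: measurable_weightM.
  exact: measurable_dotx.
- by move=> z; apply: sq_ge0; exact: dotx_ge0.
move=> t t0 /=; have st := smooth_slice_x t sp.
have mst : measurable_fun Omega (fun x : 'rV[R]_d => phi (x, t)).
  by apply: continuous_measurable_rV; exact: smooth_continuous.
have := @poincare_boundary R d Omega oO bO d0 O0 (fun x => phi (x, t)) st.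
move=> /(_ (fun x xb => p0 (x, t) (conj xb t0))) h.
have t1 : 0 <= t `^ (1 - 2 * s) := powR_ge0 _ _.
have mrow : measurable_fun Omega (fun x => (gradxt phi (x, t)).1).
  rewrite (_ : (fun x => _) = gradx (fun x => phi (x, t))); first exact: measurable_gradx.
  by apply/funext => x; rewrite gradx_slice_x.
under eq_integral do rewrite EFinM EFinM; under [leRHS]eq_integral do rewrite EFinM.
rewrite ge0_integralZl_EFin//; last 2 first.
- by move=> x _; rewrite -EFinM lee_fin mulr_ge0 ?sqr_ge0// ltW.
- by apply: measurable_funeM; exact/measurable_EFinP/measurable_funX.
rewrite ge0_integralZl_EFin//; last 3 first.
- by move=> x _; rewrite lee_fin sqr_ge0.
- exact/measurable_EFinP/measurable_funX.
- exact: ltW.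
rewrite ge0_integralZl_EFin//; last 2 first.
- by move=> x _; rewrite lee_fin dotx_ge0.
- by apply/measurable_EFinP; exact: (measurable_dotx mrow mrow).
apply: lee_wpmul2l; first by rewrite lee_fin.
apply: le_trans h _; apply: eq_imp_le.
by apply: eq_integral => x _; rewrite gradx_slice_x.
Qed.

Lemma smoothV_friedrichs phi : smoothV Omega phi ->
  lambda1 Omega * wip muQ WQ phi phi <= wip muQ WXT (gradxt phi) (gradxt phi).
Proof.
move=> vp; have [fp fD] := smoothV_wfin vp; have [sp _ _] := vp.
have mQ := measurable_cylinder oO.
have l0 := lambda1_gt0 oO bO d0 O0.
have cp : continuous (phi : space_time R d -> R) by exact: smooth_continuous.
have [mg1 mg2] := measurable_gradxt mQ sp.
rewrite -lee_fin EFinM -!wnsqE// -tnormsq_wnsq -tnormsqv_wnsq.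
rewrite /tnormsq -ge0_integralZl_EFin//; last 3 first.
- by move=> z; apply: sq_ge0; exact: sqr_ge0.
- apply: measurable_weightM.
  by apply: measurable_funX; exact: continuous_measurable_xt.
- exact: ltW.
apply: (@le_trans _ _ (\int[muQ]_(z in Q) (z.2 `^ (1 - 2 * s) * (lambda1 Omega * phi z ^+ 2))%:E)%E).
  by apply: eq_imp_le; apply: eq_integral => z _; rewrite -EFinM mulrCA.
apply: le_trans (smoothV_slice_poincare vp) _; apply: ge0_le_integral => //.
- by move=> z; apply: sq_ge0; exact: dotx_ge0.
- apply: measurable_weightM.
  exact: measurable_dotx.
- apply: measurable_weightM.
  by apply: measurable_funD; [exact: measurable_dotx|exact: measurable_funM].
by move=> z _; rewrite lee_fin ler_wpM2l ?powR_ge0// lerDl -expr2 sqr_ge0.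
Qed.

(** On each vertical line the one-dimensional inequality is used with m^2 = lambda1. After
    integration over Omega its zero-order term lambda1 phi^2 is bounded by the x-gradient through
    the slice Poincare inequality, so the right-hand side is exactly the full energy and no constant
    is lost. *)
Lemma smoothV_trace phi : smoothV Omega phi ->
  (((lambda1 Omega `^ s) * C_ s)%:E * normL2sq Omega (fun x => phi (x, 0%R)) <=
   (wip muQ WXT (gradxt phi) (gradxt phi))%:E)%E.
Proof.
move=> vp; have [fp fD] := smoothV_wfin vp; have [sp _ _] := vp.
have mQ := measurable_cylinder oO; have [T T0 TP] := smoothV_support vp.
have l0 := lambda1_gt0 oO bO d0 O0; pose m := Num.sqrt (lambda1 Omega).
have m0 : 0 < m by rewrite sqrtr_gt0.
have m2 : m ^+ 2 = lambda1 Omega by rewrite sqr_sqrtr// ltW.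
have ms : m `^ (2 * s) = lambda1 Omega `^ s by rewrite powRrM powR_mulrn ?m2// ltW.
have cp : continuous (phi : space_time R d -> R) by exact: smooth_continuous.
have [mg1 mg2] := measurable_gradxt mQ sp.
have k0 : 0 <= lambda1 Omega `^ s * C_ s.
  by rewrite mulr_ge0 ?powR_ge0// ltW// C_gt0.
have mp0 : measurable_fun Omega (fun x : 'rV[R]_d => phi (x, 0)).
  by apply: continuous_measurable_rV; exact: smooth_continuous (smooth_slice_x 0 sp).
rewrite /normL2sq -ge0_integralZl_EFin//; last 2 first.
- by move=> x _; rewrite lee_fin sqr_ge0.
- exact/measurable_EFinP/measurable_funX.
pose F z := (z.2 `^ (1 - 2 * s) * ((gradxt phi z).2 ^+ 2 + lambda1 Omega * phi z ^+ 2))%:E.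
have F0 z : Q z -> (0 <= F z)%E.
  by apply: sq_ge0; rewrite addr_ge0 ?sqr_ge0// mulr_ge0 ?sqr_ge0// ltW.
have mF1 : measurable_fun Q (fun z => (z.2 `^ (1 - 2 * s) * (gradxt phi z).2 ^+ 2)%:E).
  apply: measurable_weightM.
  exact: measurable_funX.
have mF2 : measurable_fun Q (fun z => (z.2 `^ (1 - 2 * s) * (lambda1 Omega * phi z ^+ 2))%:E).
  apply: measurable_weightM.
  by apply: measurable_funM => //; apply: measurable_funX; exact: continuous_measurable_xt.
have FE z : F z = ((z.2 `^ (1 - 2 * s) * (gradxt phi z).2 ^+ 2)%:E +
    (z.2 `^ (1 - 2 * s) * (lambda1 Omega * phi z ^+ 2))%:E)%E.
  by rewrite /F mulrDr EFinD.
have mF : measurable_fun Q F.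
  by apply: eq_measurable_fun (emeasurable_funD mF1 mF2) => z _; exact: esym (FE z).
apply: (@le_trans _ _ (\int[muQ]_(z in Q) F z)%E).
  rewrite integral_cylinder//; apply: ge0_le_integral => //.
  - by move=> x _; rewrite -EFinM lee_fin mulr_ge0// sqr_ge0.
  - by apply: measurable_funeM; exact/measurable_EFinP/measurable_funX.
  - exact: measurable_cylinder_x.
  move=> x Ox; have su := smooth_slice_t x sp.
  have du (t : R) : is_derive t 1 (fun t : R => phi (x, t)) ((gradxt phi (x, t)).2).
    by split; [exact: smooth_derivable|exact: derive_slice_t].
  have cu : continuous (fun t : R => (gradxt phi (x, t)).2).
    have := smooth_continuous (smooth_derive (1 : R) su).
    suff -> : 'D_1 (fun t : R => phi (x, t)) = (fun t : R => (gradxt phi (x, t)).2) by [].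
    by apply/funext => t; exact: derive_slice_t.
  have := weighted_trace_1D s01 m0 T0 du cu (fun t Tt => (TP x t Ox Tt).1).
  by rewrite ms m2 -EFinM.
under eq_integral do rewrite FE.
rewrite ge0_integralD//; last 2 first.
- by move=> z; apply: sq_ge0; exact: sqr_ge0.
- by move=> z; apply: sq_ge0; rewrite mulr_ge0 ?sqr_ge0// ltW.
apply: le_trans (leeD2l _ (smoothV_slice_poincare vp)) _.
rewrite -ge0_integralD//; last 3 first.
- by move=> z; apply: sq_ge0; exact: sqr_ge0.
- by move=> z; apply: sq_ge0; exact: dotx_ge0.
- apply: measurable_weightM.
  exact: measurable_dotx.
rewrite -wnsqE// -tnormsqv_wnsq; apply: eq_imp_le.
by apply: eq_integral => z _; rewrite -EFinD -mulrDr [X in _ * X]addrC.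
Qed.

End weighted_space.

Section space_V.
Context {R : realType} {d : nat} (s : R) (Omega : set 'rV[R]_d).
Hypotheses (s01 : 0 < s < 1) (oO : open Omega) (bO : bounded_set Omega).
Hypotheses (d0 : (0 < d)%N) (O0 : Omega !=set0).
Let mO : measurable Omega := open_measurable_rV oO.
Local Notation mu := (lebesgue_rV R d).
Local Notation muQ := (mu_xt R d).
Local Notation Q := (cylinder Omega : set ('rV[R]_d * measurableTypeR R)%type).
Local Notation W := (wformR1 R (open_measurable_rV oO)).
Local Notation WQ := (wformQ s oO).
Local Notation WXT := (wformXTQ s oO).

Lemma measurable_pair_adm (D : set ('rV[R]_d * measurableTypeR R)%type)
    (y : space_time R d -> space_time R d) :
  measurable_fun D (y : ('rV[R]_d * measurableTypeR R)%type -> ('rV[R]_d * measurableTypeR R)%type) ->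
  measurable_fun D (fun z => (y z).1) /\ measurable_fun D (fun z => (y z).2).
Proof.
by move=> my; split; [exact: (measurableT_comp measurable_fst my)|exact: (measurableT_comp measurable_snd my)].
Qed.

Lemma measurable_pair_of_adm (D : set ('rV[R]_d * measurableTypeR R)%type)
    (f : 'rV[R]_d * measurableTypeR R -> 'rV[R]_d * measurableTypeR R) : measurable D ->
  measurable_fun D (fun z => (f z).1) -> measurable_fun D (fun z => (f z).2) -> measurable_fun D f.
Proof.
move=> mD m1 m2; apply/(measurable_restrictT f mD)/measurable_fun_pairP; split.
  have := (measurable_restrictT _ mD).1 m1; congr measurable_fun.
  by apply/funext => z; rewrite /= !patchE; case: ifPn.
have := (measurable_restrictT _ mD).1 m2; congr measurable_fun.
by apply/funext => z; rewrite /= !patchE; case: ifPn.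
Qed.

Lemma approxV_cvg phi w Dw : approxV s Omega phi w Dw ->
  wnsq muQ WQ (fun z => phi n z - w z) @[n --> \oo] --> 0%E /\
  wnsq muQ WXT (fun z => gradxt (phi n) z - Dw z) @[n --> \oo] --> 0%E.
Proof.
move=> [_ cD c]; split.
  by rewrite (_ : (fun n => _) = (fun n => tnormsq s Omega (phi n \- w)))//; apply/funext => n; rewrite tnormsq_wnsq.
by rewrite (_ : (fun n => _) = (fun n => tnormsqv s Omega (gradxt (phi n) \- Dw)))//; apply/funext => n; rewrite tnormsqv_wnsq.
Qed.

Lemma inV_wfin w Dw : inV s Omega w Dw -> wfin muQ WQ w /\ wfin muQ WXT Dw.
Proof.
move=> [mw mDw [phi ap]]; have [c cD] := approxV_cvg ap; have [vp _ _] := ap.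
have fp n := smoothV_wfin s01 oO bO (vp n); split.
  have [] // := wfin_cvg (fun n => (fp n).1) _ c.
have [] // := wfin_cvg (fun n => (fp n).2) _ cD; exact: measurable_pair_adm.
Qed.

Lemma inV_friedrichs w Dw : inV s Omega w Dw ->
  lambda1 Omega * wip muQ WQ w w <= wip muQ WXT Dw Dw.
Proof.
move=> vw; have [fw fDw] := inV_wfin vw; have [_ _ [phi ap]] := vw.
have [c cD] := approxV_cvg ap; have [vp _ _] := ap.
have fp n := smoothV_wfin s01 oO bO (vp n).
have [_ c1] := wfin_cvg (fun n => (fp n).1) fw.1 c.
have [_ c2] := wfin_cvg (fun n => (fp n).2) fDw.1 cD.
apply: ler_cvg_to (cvgMr c1) c2 _; apply: nearW => n.
exact: smoothV_friedrichs.
Qed.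

Lemma inV_lin a w Dw v Dv : inV s Omega w Dw -> inV s Omega v Dv ->
  inV s Omega (fun z => w z + a * v z) (fun z => Dw z + a *: Dv z).
Proof.
move=> vw vv; have [fw fDw] := inV_wfin vw; have [fv fDv] := inV_wfin vv.
have [mw mDw [phi ap]] := vw; have [mv mDv [psi aq]] := vv.
have [cp cDp] := approxV_cvg ap; have [vp _ _] := ap.
have [cq cDq] := approxV_cvg aq; have [vq _ _] := aq.
have fp n := smoothV_wfin s01 oO bO (vp n); have fq n := smoothV_wfin s01 oO bO (vq n).
have [m1 m2] := (wfin_lin a fDw fDv).1.
split.
- exact: (wfin_lin a fw fv).1.
- exact: measurable_pair_of_adm (measurable_cylinder oO) m1 m2.
exists (fun n z => phi n z + a * psi n z); split.
- by move=> n; exact: smoothV_lin.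
- have := wnsq_cvg_lin a (fun n => (fp n).2.1) (fun n => (fq n).2.1) fDw.1 fDv.1 cDp cDq.
  rewrite (_ : (fun n => wnsq _ _ _) = (fun n => tnormsqv s Omega
    (gradxt (fun z => phi n z + a * psi n z) \- (fun z => Dw z + a *: Dv z))))//.
  apply/funext => n; rewrite tnormsqv_wnsq; congr wnsq; apply/funext => z /=.
  by rewrite gradxt_lin//; [have [] := vp n|have [] := vq n].
- have := wnsq_cvg_lin a (fun n => (fp n).1.1) (fun n => (fq n).1.1) fw.1 fv.1 cp cq.
  rewrite (_ : (fun n => wnsq _ _ _) = (fun n => tnormsq s Omega
    ((fun z => phi n z + a * psi n z) \- (fun z => w z + a * v z))))//.
Qed.

(** The trace inequality applied to differences of approximants makes their values at t = 0 Cauchy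
    in L^2(Omega); their limit is a trace and inherits the bound. The weak equation and the weak
    normal trace can be tested with e only because such a trace exists. *)
Lemma inV_trace w Dw : inV s Omega w Dw -> exists w0,
  [/\ traceV s Omega w Dw w0, wfin mu W w0 &
      lambda1 Omega `^ s * C_ s * wip mu W w0 w0 <= wip muQ WXT Dw Dw].
Proof.
move=> vw; have [fw fDw] := inV_wfin vw; have [_ _ [phi ap]] := vw.
have [c cD] := approxV_cvg ap; have [vp _ _] := ap.
have fp n := smoothV_wfin s01 oO bO (vp n).
have l0 := lambda1_gt0 oO bO d0 O0.
pose k := lambda1 Omega `^ s * C_ s.
have k0 : 0 < k by rewrite mulr_gt0 ?powR_gt0// C_gt0.
have tr psi : smoothV Omega psi -> wfin mu W (fun x => psi (x, 0)) /\
    k * wip mu W (fun x => psi (x, 0)) (fun x => psi (x, 0)) <= wip muQ WXT (gradxt psi) (gradxt psi).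
  move=> vpsi; have := smoothV_trace s01 oO bO d0 O0 vpsi; rewrite -/k => h.
  have mt : wadm W (fun x => psi (x, 0)).
    apply: continuous_measurable_rV; have [sp _ _] := vpsi.
    exact: smooth_continuous (smooth_slice_x 0 sp).
  have ft : wfin mu W (fun x => psi (x, 0)).
    split=> //; rewrite -(normL2sq_wnsq oO).
    have : ((k^-1)%:E * (k%:E * normL2sq Omega (fun x => psi (x, 0%R))) < +oo)%E.
      apply: lte_mul_pinfty; rewrite ?lee_fin ?invr_ge0 ?(ltW k0)//.
      by apply: le_lt_trans h _; rewrite ltry.
    by rewrite muleA -EFinM mulVf ?gt_eqF// mul1e.
  by split=> //; move: h; rewrite (normL2sq_wnsq oO) wnsqE// -EFinM lee_fin.
have ft n := (tr _ (vp n)).1.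
have [w0 [mw0 cw0]] : exists w0 : 'rV[R]_d -> R, measurable_fun Omega w0 /\
    (\int[mu]_(x in Omega) ((phi n (x, 0%R) - w0 x) ^+ 2)%:E)%E @[n --> \oo] --> 0%E.
  apply: L2_complete => //; first by move=> n; exact: (ft n).1.
  (* Both gradients are within e k/4 of [Dw] in squared norm, so their squared distance is at most 2
     (e k/4) + 2 (e k/4) = e k; dividing by the trace constant k leaves e. *)
  move=> e e0; move/fine_cvgP : cD => [[N1 _ N1P]] /cvgrPdist_le /(_ (e * k / 4)).
  case; first by rewrite divr_gt0// mulr_gt0.
  move=> N2 _ N2P; exists (maxn N1 N2).
  have bnd n : (maxn N1 N2 <= n)%N -> wfin muQ WXT (fun z => gradxt (phi n) z + (-1) *: Dw z) /\
      wip muQ WXT (fun z => gradxt (phi n) z + (-1) *: Dw z) (fun z => gradxt (phi n) z + (-1) *: Dw z) <= e * k / 4.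
    rewrite geq_max => /andP[n1 n2]; have f := wfin_lin (-1) (fp n).2 fDw; split=> //.
    have := N2P n n2; rewrite /= sub0r normrN => h; rewrite -lee_fin -wnsqE//.
    have E : (fun z => gradxt (phi n) z + (-1) *: Dw z) = (fun z => gradxt (phi n) z - Dw z).
      by apply/funext => z; rewrite scaleN1r.
    rewrite E in f *; rewrite wnsqE// lee_fin; move: h; rewrite wnsqE//= ger0_norm// wip_ge0//.
  move=> n m /bnd[fn hn] /bnd[fm hm].
  have [fd td] := tr _ (smoothV_lin (-1) (vp n) (vp m)).
  rewrite (_ : (\int[mu]_(x in Omega) _)%E = (wip mu W (fun x => phi n (x, 0%R) + (-1) * phi m (x, 0%R))
      (fun x => phi n (x, 0%R) + (-1) * phi m (x, 0%R)))%:E); last first.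
    rewrite -wnsqE// -(normL2sq_wnsq oO); apply: eq_integral => x _; by rewrite mulN1r.
  rewrite lee_fin -(ler_pM2l k0); apply: le_trans td _.
  pose u z := gradxt (phi n) z + (-1) *: Dw z; pose v z := gradxt (phi m) z + (-1) *: Dw z.
  have -> : gradxt (fun z => phi n z + (-1) * phi m z) = (fun z => u z + (-1) *: v z).
    apply/funext => z; rewrite gradxt_lin; [|by have [] := vp n|by have [] := vp m].
    by rewrite /u /v !scaleN1r opprB addrA subrK.
  rewrite (wip_sq (-1) fn fm); have := wip_ge0 muQ WXT (fun z => u z + 1 *: v z).
  rewrite (wip_sq 1 fn fm).
  move: hn hm; rewrite -/u -/v; move: (wip muQ WXT u u) (wip muQ WXT u v) (wip muQ WXT v v) => a b c'.
  by rewrite sqrrN !expr1n; lra.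
have c0 : wnsq mu W (fun x => phi n (x, 0%R) - w0 x) @[n --> \oo] --> 0%E.
  rewrite (_ : (fun n => _) = (fun n => \int[mu]_(x in Omega) ((phi n (x, 0%R) - w0 x) ^+ 2)%:E)%E)//.
  by apply/funext => n; rewrite -(normL2sq_wnsq oO).
have [fw0 cw] := wfin_cvg ft mw0 c0.
have [_ cDw] := wfin_cvg (fun n => (fp n).2) fDw.1 cD.
exists w0; split=> //; last first.
  by apply: ler_cvg_to (cvgMr cw) cDw _; apply: nearW => n; exact: (tr _ (vp n)).2.
split; first by split=> //; rewrite (normL2sq_wnsq oO); exact: fw0.2.
by exists phi.
Qed.

(** [A] and [B] stand for the squared errors of gradient and flux and [X] for their mixed product;
    [E] and [T] are its volume and trace parts. [ee] and [tt] are the Young terms in e and in its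
    trace, absorbed into a1 A and a2 A, while [K1] and [K2] are the computable residuals. *)
Lemma estimate_arith (A B X T E K1 K2 a1 a2 ee tt : R) :
  2 * `|E| <= ee + K1 -> 2 * `|T| <= tt + K2 -> ee <= a1 * A -> tt <= a2 * A ->
  X = - (T + E) ->
  (1 - a1 - a2) * A + B <= A + B - 2 * X + (K1 + K2) /\
  A + B - 2 * X - (K1 + K2) <= (1 + a1 + a2) * A + B.
Proof.
move=> h1 h2 h3 h4 ->.
have := ler_norm E; have := ler_norm (- E); have := ler_norm T; have := ler_norm (- T).
by rewrite !normrN => *; split; lra.
Qed.

(** * Error identity and estimates for a fixed weak trace *)

Section estimate.
Variables (g : 'rV[R]_d -> R) (w : space_time R d -> R) (Dw : space_time R d -> space_time R d).
Variables (wt : space_time R d -> R) (Dwt : space_time R d -> space_time R d).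
Variables (y : space_time R d -> space_time R d) (divy : space_time R d -> R).
Hypotheses (hg : L2 Omega g) (hw : weak_solution s Omega g w Dw).
Hypotheses (hwt : inV s Omega wt Dwt) (hy : Ysdiv s Omega y divy).

Let Y z : space_time R d := z.2 `^ (2 * s - 1) *: y z.
Let q (z : space_time R d) : R := z.2 `^ (2 * s - 1) * divy z.
Let De z := Dwt z + (-1) *: Dw z.
Let Ep z := Y z + (-1) *: Dw z.

Lemma weight_cancel (t : R) : 0 < t -> t `^ (1 - 2 * s) * t `^ (2 * s - 1) = 1.
Proof.
move=> t0; rewrite -powRD; last by rewrite (gt_eqF t0) implybT.
by rewrite (_ : _ + _ = 0) ?powRr0//; ring.
Qed.

(** The factor t^(2s-1) turns the dual weight of Y^s into the weight of the energy norm, since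
    t^(1-2s) t^(2(2s-1)) = t^(2s-1). Fluxes and gradients thus belong to the same weighted space. *)
Lemma flux_wfin : wfin muQ WXT Y.
Proof.
have [[my fy] _ _ _] := hy; have [m1 m2] := measurable_pair_adm my.
have mQ := measurable_cylinder oO.
split; first split.
- apply: (measurable_rVP mQ) => i; rewrite (_ : (fun z => _) = fun z => z.2 `^ (2 * s - 1) * (y z).1 ord0 i).
    by apply: measurable_funM; [exact: measurable_weight|exact: measurable_coord_fun].
  by apply/funext => z; rewrite mxE.
- by apply: measurable_funM => //; exact: measurable_weight.
apply: le_lt_trans fy; apply: eq_imp_le.
apply: eq_integral => z /set_mem[_ z0] /=; congr EFin.
transitivity ((z.2 `^ (1 - 2 * s) * z.2 `^ (2 * s - 1)) * z.2 `^ (2 * s - 1) * dotxt (y z) (y z)).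
  by rewrite /dotxt /Y /= dotxZl [dotx (y z).1 _]dotxC dotxZl /GRing.scale /=; ring.
by rewrite weight_cancel// mul1r.
Qed.

Lemma div_wfin : wfin muQ WQ q.
Proof.
have [_ mq _ fq] := hy; split.
  by apply: measurable_funM; [exact: measurable_weight|exact: mq].
apply: le_lt_trans fq; apply: eq_imp_le.
apply: eq_integral => z /set_mem[_ z0] /=; congr EFin; rewrite /q.
rewrite (_ : _ * (_ * _) = (z.2 `^ (1 - 2 * s) * z.2 `^ (2 * s - 1)) * z.2 `^ (2 * s - 1) *
  divy z ^+ 2); last by ring.
by rewrite weight_cancel// mul1r.
Qed.

Lemma error_estimate y0 a1 a2 : normal_trace s Omega y divy y0 -> 0 < a1 -> 0 < a2 ->
  let A := wip muQ WXT De De in let B := wip muQ WXT Ep Ep in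
  let P := wip muQ WXT (fun z => De z + (-1) *: Ep z) (fun z => De z + (-1) *: Ep z) in
  let K := (a1 * lambda1 Omega)^-1 * wip muQ WQ q q +
           (a2 * (lambda1 Omega `^ s * C_ s))^-1 * wip mu W (g \+ y0) (g \+ y0) in
  [/\ wfin mu W (g \+ y0), (1 - a1 - a2) * A + B <= P + K & P - K <= (1 + a1 + a2) * A + B].
Proof.
move=> ny0 a10 a20 A B P K; have l0 := lambda1_gt0 oO bO d0 O0.
have [vw ws] := hw; have [fw fDw] := inV_wfin vw; have [fwt fDwt] := inV_wfin hwt.
have ve := inV_lin (-1) hwt vw; have [fe fDe] := inV_wfin ve.
have [tr [ht ftr trle]] := inV_trace ve; have fr := inV_friedrichs ve.
have fY := flux_wfin; have fq := div_wfin; have fEp := wfin_lin (-1) fY fDw.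
have k0 : 0 < lambda1 Omega `^ s * C_ s by rewrite mulr_gt0 ?powR_gt0// C_gt0.
have [[my0 fy0] ny] := ny0; have [mg fg'] := hg.
have fg : wfin mu W g by split=> //; rewrite -(normL2sq_wnsq oO).
have fy : wfin mu W y0 by split=> //; rewrite -(normL2sq_wnsq oO).
have gyE : (g \+ y0) = (fun x => g x + 1 *: (y0 x : R^o)).
  by apply/funext => x; rewrite scale1r.
have fgy : wfin mu W (g \+ y0) by rewrite gyE; exact: wfin_lin.
pose e z := wt z + (-1) * w z.
(* The weak equation for w, tested with e. *)
have e1 : wip muQ WXT De Dw = wip mu W g tr.
  have := ws _ _ _ ve ht => /eqP; rewrite subr_eq0 => /eqP h.
  rewrite wipC; apply: etrans (etrans h _); first by [].
  by apply: eq_Rintegral => x _ /=; rewrite mul1r.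
(* The definition of the normal trace, tested with e. The opposite weights cancel for t > 0, which
   turns its unweighted integrals into weighted products with [q] and [Y]. *)
have e2 : wip mu W tr y0 = - (wip muQ WQ e q + wip muQ WXT De Y).
  have h := ny _ _ _ ve ht; transitivity (\int[mu]_(x in Omega) (tr x * y0 x)).
    by apply: eq_Rintegral => x _ /=; rewrite mul1r.
  rewrite h; congr (- _); rewrite /wip -RintegralD//; last 3 first.
  - exact: measurable_cylinder.
  - exact: wfin_integrable fe fq.
  - exact: wfin_integrable fDe fY.
  apply: eq_Rintegral => z /set_mem[_ z0] /=.
  rewrite [dotxt _ (Y z)](_ : _ = z.2 `^ (2 * s - 1) * dotxt (De z) (y z)); last first.
    by rewrite /dotxt /Y /= dotxC dotxZl dotxC /GRing.scale /=; ring.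
  rewrite /q !mulrA weight_cancel// mul1r; congr (_ + _).
  transitivity ((z.2 `^ (1 - 2 * s) * z.2 `^ (2 * s - 1)) * (e z * divy z)).
    by rewrite weight_cancel// mul1r.
  by ring.
(* Subtracting the two tested identities eliminates the unknown w from the mixed term: only the
   divergence of y and the Neumann residual g + y0 remain, paired with e. *)
have XE : wip muQ WXT De Ep = - (wip mu W tr (g \+ y0) + wip muQ WQ e q).
  have L1 : wip muQ WXT Ep De = wip muQ WXT Y De + -1 * wip muQ WXT Dw De.
    exact: wip_linl fY fDw fDe.
  have L2 : wip mu W (g \+ y0) tr = wip mu W g tr + 1 * wip mu W y0 tr.
    by rewrite gyE; exact: wip_linl fg fy ftr.
  have C1 : wip muQ WXT De Ep = wip muQ WXT Ep De by exact: wipC.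
  have C2 : wip muQ WXT Y De = wip muQ WXT De Y by exact: wipC.
  have C3 : wip muQ WXT Dw De = wip muQ WXT De Dw by exact: wipC.
  have C4 : wip mu W tr (g \+ y0) = wip mu W (g \+ y0) tr by exact: wipC.
  have C5 : wip mu W y0 tr = wip mu W tr y0 by exact: wipC.
  rewrite C1 L1 C2 C3 e1 C4 L2 C5 e2.
  by ring.
have PE : P = A + B - 2 * wip muQ WXT De Ep.
  rewrite /P (wip_sq (-1) fDe fEp) sqrrN expr1n -/A -/B.
  by move: A B (wip muQ WXT De Ep) => a b c; ring.
(* These Young parameters are matched to the Friedrichs and trace constants: the terms in e become
   at most a1 A and a2 A. *)
have c10 : 0 < a1 * lambda1 Omega by rewrite mulr_gt0.
have c20 : 0 < a2 * (lambda1 Omega `^ s * C_ s) by rewrite mulr_gt0.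
have h1 : 2 * `|wip muQ WQ e q| <= a1 * lambda1 Omega * wip muQ WQ e e +
    (a1 * lambda1 Omega)^-1 * wip muQ WQ q q by exact: wip_amgm c10 fe fq.
have h2 := wip_amgm c20 ftr fgy.
have h3 : a1 * lambda1 Omega * wip muQ WQ e e <= a1 * A by rewrite -mulrA ler_pM2l.
have h4 : a2 * (lambda1 Omega `^ s * C_ s) * wip mu W tr tr <= a2 * A by rewrite -mulrA ler_pM2l.
by rewrite PE /K; have [] := estimate_arith B h1 h2 h3 h4 XE.
Qed.

End estimate.

End space_V.

(** * Infimum over weak traces, constants and conclusion *)

Section infimum_bounds.
Context {R : realType}.
Implicit Types (L P k : R) (S : set (\bar R)).

(** Solving for x gives a finite lower bound of the set, hence of its infimum. If the set is empty,
    which is the case of a flux without trace in L^2(Omega), the infimum is +oo and k > 0 makes the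
    right-hand side +oo. *)
Lemma le_add_scaled_inf L P k S : 0 < k -> (forall x, S x -> (L%:E <= P%:E + k%:E * x)%E) ->
  (L%:E <= P%:E + k%:E * ereal_inf S)%E.
Proof.
move=> k0 H; have : (((L - P) / k)%:E <= ereal_inf S)%E.
  apply: le_ereal_inf_tmp => x /H; case: x => [r| |] h.
  - move: h; rewrite -EFinM -EFinD !lee_fin ler_pdivrMr// mulrC; lra.
  - exact: leey.
  - by move: h; rewrite gt0_muleNy ?lte_fin.
case: (ereal_inf S) => [r| |] h.
- by move: h; rewrite -EFinM -EFinD !lee_fin ler_pdivrMr// mulrC; lra.
- by rewrite gt0_muley ?lte_fin// addey// leey.
- by move: h; rewrite leeNy_eq.
Qed.

Lemma sub_scaled_inf_le L P k S : 0 < k -> (forall x, S x -> (P%:E - k%:E * x <= L%:E)%E) ->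
  (P%:E - k%:E * ereal_inf S <= L%:E)%E.
Proof.
move=> k0 H; have : (((P - L) / k)%:E <= ereal_inf S)%E.
  apply: le_ereal_inf_tmp => x /H; case: x => [r| |] h.
  - move: h; rewrite -EFinM -EFinB !lee_fin ler_pdivrMr// mulrC; lra.
  - exact: leey.
  - by move: h; rewrite gt0_muleNy ?lte_fin.
case: (ereal_inf S) => [r| |] h.
- by move: h; rewrite -EFinM -EFinB !lee_fin ler_pdivrMr// mulrC; lra.
- by rewrite gt0_muley ?lte_fin// leNye.
- by move: h; rewrite leeNy_eq.
Qed.

End infimum_bounds.

Section constants.
Context {R : realType} {d : nat} (s : R) (Omega : set 'rV[R]_d).
Hypotheses (s01 : 0 < s < 1) (l0 : 0 < lambda1 Omega).

Lemma C_F_sq : C_F Omega ^+ 2 = (lambda1 Omega)^-1.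
Proof.
rewrite /C_F -powR_mulrn ?powR_ge0// -powRrM (_ : - 2^-1 * _ = - 1).
  by rewrite powRN powRr1// ltW.
by field.
Qed.

Lemma C_F_powR : C_F Omega `^ (2 * s) = (lambda1 Omega `^ s)^-1.
Proof. by rewrite /C_F -powRrM -powRN; congr (_ `^ _); field. Qed.

Lemma kappa_sq : kappa s ^+ 2 = (C_ s)^-1.
Proof.
have C0 := C_gt0 s01; rewrite /kappa -powR_mulrn ?powR_ge0// -powRrM (_ : - 2^-1 * _ = - 1).
  by rewrite powRN powRr1// ltW.
by field.
Qed.

End constants.

Lemma integral_cylinder_set0 {R : realType} {d : nat} (f : space_time R d -> \bar R) :
  (\int[mu_xt R d]_(z in cylinder (set0 : set 'rV[R]_d)) f z = 0)%E.
Proof.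
rewrite (_ : cylinder set0 = set0) ?integral_set0//.
by apply/seteqP; split=> // z [].
Qed.

Theorem mainTheorem3 (R : realType) (d : nat) (hd : (0 < d)%N)
  (Omega : set 'rV[R]_d) (hOmega : lipschitz_domain Omega)
  (s : R) (hs : 0 < s < 1)
  (g : 'rV[R]_d -> R) (hg : L2 Omega g)
  (w : space_time R d -> R) (Dw : space_time R d -> space_time R d)
  (hw : weak_solution s Omega g w Dw)
  (wt : space_time R d -> R) (Dwt : space_time R d -> space_time R d)
  (hwt : inV s Omega wt Dwt)
  (y : space_time R d -> space_time R d) (divy : space_time R d -> R)
  (hy : Ysdiv s Omega y divy) :
  let p := tscale (1 - 2 * s) Dw in
  let grad_ew := Dwt \- Dw in
  let ep := y \- p in
  (forall a1 a2 : R, 0 < a1 -> 0 < a2 -> a1 + a2 < 1 ->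
     ((1 - a1 - a2)%:E * tnormsqv s Omega grad_ew
        + tnormsqv s Omega (tscale (2 * s - 1) ep)
      <= tnormsqv s Omega (Dwt \- tscale (2 * s - 1) y)%R
        + (C_F Omega ^+ 2 / a1)%:E
            * tnormsq s Omega (fun z => z.2 `^ (2 * s - 1) * divy z)%R
        + (C_F Omega `^ (2 * s) * kappa s ^+ 2 / a2)%:E
            * trace_residual_sq s Omega g y divy)%E)
  /\
  (forall a1 a2 : R, 0 < a1 -> 0 < a2 ->
     ((1 + a1 + a2)%:E * tnormsqv s Omega grad_ew
        + tnormsqv s Omega (tscale (2 * s - 1) ep)
      >= tnormsqv s Omega (Dwt \- tscale (2 * s - 1) y)%R
        - (C_F Omega ^+ 2 / a1)%:E
            * tnormsq s Omega (fun z => z.2 `^ (2 * s - 1) * divy z)%R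
        - (C_F Omega `^ (2 * s) * kappa s ^+ 2 / a2)%:E
            * trace_residual_sq s Omega g y divy)%E).
Proof.
move=> p grad_ew ep; have [oO _ bO _] := hOmega.
(* [lipschitz_domain] admits the empty set, which has no Dirichlet eigenvalue. There all integrals
   over the cylinder vanish and only the sign of the trace term matters. *)
have [Oempty|/eqP/set0P O0] := pselect (Omega = set0).
  have k0 a : 0 < a -> (0 <= (C_F Omega `^ (2 * s) * kappa s ^+ 2 / a)%:E *
      trace_residual_sq s Omega g y divy)%E.
    move=> a0; rewrite mule_ge0 ?lee_fin ?mulr_ge0 ?powR_ge0 ?sqr_ge0 ?invr_ge0 ?(ltW a0)//.
    apply: le_ereal_inf_tmp => _ [y0 _ <-]; apply: integral_ge0 => x _.
    by rewrite lee_fin sqr_ge0.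
  have vz u : tnormsqv s Omega u = 0%E by rewrite /tnormsqv Oempty integral_cylinder_set0.
  have sz u : tnormsq s Omega u = 0%E by rewrite /tnormsq Oempty integral_cylinder_set0.
  split=> a1 a2 a10 a20 => [_|]; rewrite !vz sz !mule0 !add0e.
    exact: k0.
  by rewrite oppe0 sub0e leeNl oppe0 k0.
have l0 := lambda1_gt0 oO bO hd O0; have [vw _] := hw.
have [fw fDw] := inV_wfin hs oO bO vw; have [fwt fDwt] := inV_wfin hs oO bO hwt.
have fY := flux_wfin oO hy; have fq := div_wfin oO hy.
pose Y z : space_time R d := z.2 `^ (2 * s - 1) *: y z.
pose De z := Dwt z + (-1) *: Dw z; pose Ep z := Y z + (-1) *: Dw z.
have fDe : wfin (mu_xt R d) (wformXTQ s oO) De by exact: wfin_lin.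
have fEp : wfin (mu_xt R d) (wformXTQ s oO) Ep by exact: wfin_lin.
have fP := wfin_lin (-1) fDe fEp.
have eA : tnormsqv s Omega grad_ew = (wip (mu_xt R d) (wformXTQ s oO) De De)%:E.
  rewrite -wnsqE// -(tnormsqv_wnsq s oO); congr tnormsqv.
  by apply/funext => z; rewrite /De scaleN1r.
(* The identity t^(2s-1) p = Dw needs t > 0, so it is used under the integral over the cylinder and
   not as an equality of functions. *)
have eB : tnormsqv s Omega (tscale (2 * s - 1) ep) = (wip (mu_xt R d) (wformXTQ s oO) Ep Ep)%:E.
  rewrite -wnsqE// -(tnormsqv_wnsq s oO); apply: eq_integral => z /set_mem[_ z0].
  suff -> : tscale (2 * s - 1) ep z = Ep z by [].
  have -> : tscale (2 * s - 1) ep z =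
      Y z - z.2 `^ (2 * s - 1) *: (z.2 `^ (1 - 2 * s) *: Dw z) by exact: scalerBr.
  by rewrite scalerA (mulrC (z.2 `^ (2 * s - 1))) weight_cancel// scale1r /Ep scaleN1r.
(* The computable quantity is the difference of the two errors: w cancels in De - Ep. *)
have eP : tnormsqv s Omega (Dwt \- tscale (2 * s - 1) y) =
    (wip (mu_xt R d) (wformXTQ s oO) (fun z => De z + (-1) *: Ep z) (fun z => De z + (-1) *: Ep z))%:E.
  rewrite -wnsqE// -(tnormsqv_wnsq s oO); congr tnormsqv; apply/funext => z.
  by rewrite /De /Ep /Y /tscale /= !scaleN1r opprB addrA subrK.
have eq_ : tnormsq s Omega (fun z => z.2 `^ (2 * s - 1) * divy z) =
   (wip (mu_xt R d) (wformQ s oO) (fun z => z.2 `^ (2 * s - 1) * divy z)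
     (fun z => z.2 `^ (2 * s - 1) * divy z))%:E.
  by rewrite -wnsqE// -(tnormsq_wnsq s oO).
have C0 := C_gt0 hs.
rewrite eA eB eP eq_ (C_F_sq l0) (C_F_powR s) (kappa_sq hs).
have ls0 : 0 < lambda1 Omega `^ s by rewrite powR_gt0.
split=> a1 a2 a10 a20 => [_|]; rewrite -!EFinM -!EFinD -?EFinB.
  apply: le_add_scaled_inf => [|_ [y0 ny0 <-]]; first by rewrite divr_gt0// mulr_gt0 ?invr_gt0.
  have [fr h _] := error_estimate hs oO bO hd O0 hg hw hwt hy ny0 a10 a20.
  rewrite (normL2sq_wnsq oO) wnsqE// -EFinM -EFinD lee_fin (le_trans h)// addrA.
  by rewrite !invfM [a1^-1 * _]mulrC [a2^-1 * _]mulrC.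
apply: sub_scaled_inf_le => [|_ [y0 ny0 <-]]; first by rewrite divr_gt0// mulr_gt0 ?invr_gt0.
have [fr _ h] := error_estimate hs oO bO hd O0 hg hw hwt hy ny0 a10 a20.
rewrite (normL2sq_wnsq oO) wnsqE// -EFinM -EFinB lee_fin (le_trans _ h)// opprD addrA.
by rewrite !invfM [a1^-1 * _]mulrC [a2^-1 * _]mulrC.
Qed.
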